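(* Let $k$ be an algebraically closed field of arbitrary characteristic and let $H$ be a finite-dimensional Hopf algebra over $k$. Let $NT(H)$ and $NT(H^* )$ be the sets of gauge equivalence classes of non-degenerate twists for $H$ and for $H^*$, respectively. Then the map $D_H:NT(H)\to NT(H^* )$, sending the class of $J$ to the class of the dual twist $D_\pi(J)$, is a bijection, and $D_H^{-1}=D_{H^*}$ (where $H^{**}$ is identified with $H$).
   Context: Let $\Delta,\varepsilon$ be the comultiplication and counit of $H$; Sweedler notation $\Delta(h)=h_{(1)}\otimes h_{(2)}$. A twist for $H$ is an invertible $J\in H\otimes H$ with $(\Delta\otimes\mathrm{id})(J)(J\otimes 1)=(\mathrm{id}\otimes\Delta)(J)(1\otimes J)$, normalized by $(\varepsilon\otimes\mathrm{id})(J)=(\mathrm{id}\otimes\varepsilon)(J)=1$. Twists $J,J'$ are gauge equivalent if $J'=\Delta(x)J(x^{-1}\otimes x^{-1})$ for some invertible $x\in H$ with $\varepsilon(x)=1$. For a twist $J$, $H^{(J)}$ is the coalgebra with underlying space $H$, comultiplication $c\mapsto\Delta(c)J$ and counit $\varepsilon$. The twist $J$ is non-degenerate if the coalgebra $H^{(J)}$ is simple (a property depending only on the gauge class). The dual twist: let $J$ be a non-degenerate twist for $H$, and let $H^*_{(J)}:=(H^{(J)})^*$ be the dual algebra, which is a simple algebra and a right $H$-module algebra via $\langle a\cdot h,c\rangle=\langle a,hc\rangle$ ($a\in H^*_{(J)}$, $c\in H^{(J)}$, $h\in H$). By the Skolem-Noether theorem for Hopf algebras this action is inner: there is a convolution invertible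 map $\pi\in\mathrm{Hom}_k(H,H^*_{(J)})$, with convolution inverse $\overline\pi$, such that $a\cdot h=\overline\pi(h_{(1)})\,a\,\pi(h_{(2)})$ for all $a\in H^*_{(J)}$, $h\in H$, and $\pi(1)=\overline\pi(1)=1$. Such $\pi$ is called a Skolem-Noether map. For all $g,h\in H$ the element $c(h\otimes g):=\pi(h_{(1)}g_{(1)})\,\overline\pi(g_{(2)})\,\overline\pi(h_{(2)})$ is a scalar, and the form $c\in H^*\otimes H^*$ is a twist for $H^*$, denoted $D_\pi(J)$. The gauge equivalence class of $D_\pi(J)$ does not depend on the choice of $\pi$ and depends only on the gauge class of $J$; the induced map is denoted $D_H$. The map $D_{H^*}:NT(H^* )\to NT(H^{**})=NT(H)$ is defined by the same construction applied to $H^*$. *)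

(* Defs.v *)
From HB Require Import structures.
From mathcomp Require Import all_boot all_algebra all_field.
From mathcomp Require Import ring.
From mathcomp Require Import classical_sets functions.

Set Implicit Arguments.
Unset Strict Implicit.
Unset Printing Implicit Defensive.

Import GRing.Theory VectorInternalTheory.
Local Open Scope ring_scope.

(******************************************************************************)
(*                Tensor products of finite-dimensional spaces                *)
(*                                                                            *)
(* tens U V is realised as the space of matrices of coordinates with respect  *)
(* to the bases fixed by the vectType structures of U and V; it satisfies the *)
(* universal property through tpure and tlift (tlift_pure, tensE).            *)
(******************************************************************************)

Definition tens (k : fieldType) (U V : vectType k) : Type :=
  'M[k]_(dim U, dim V).

HB.instance Definition _ (k : fieldType) (U V : vectType k) :=
  Vector.copy (tens U V) 'M[k]_(dim U, dim V).

Section Tensor.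
Variable k : fieldType.
Implicit Types U V W : vectType k.

Definition tpure U V (u : U) (v : V) : tens U V := (v2r u)^T *m v2r v.

Definition vb U (i : 'I_(dim U)) : U := r2v (delta_mx 0 i).

Definition bilin (U V W : lmodType k) (B : U -> V -> W) :=
  (forall v, linear (B^~ v)) /\ (forall u, linear (B u)).

(* For B bilinear, the linear map on tens U V with u (x) v |-> B u v; it is   *)
(* only meaningful (independent of the bases) for bilinear B.                 *)
Definition tlift U V (W : lmodType k) (B : U -> V -> W) (t : tens U V) : W :=
  \sum_i \sum_j (t : 'M[k]_(dim U, dim V)) i j *: B (vb i) (vb j).

Lemma vbE U (u : U) : u = \sum_i v2r u 0 i *: vb i.
Proof.
apply: v2r_inj; rewrite linear_sum /=; apply/rowP=> j.
rewrite summxE (bigD1 j) //= linearZ /= /vb r2vK !mxE !eqxx mulr1 big1 ?addr0 //.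
by move=> i nij; rewrite linearZ /= r2vK !mxE eqxx eq_sym (negPf nij) mulr0.
Qed.

Lemma vb_free U (c : 'I_(dim U) -> k) :
  \sum_i c i *: vb i = 0 -> forall i, c i = 0.
Proof.
move=> c0 i; have /rowP/(_ i) := congr1 v2r c0.
rewrite linear_sum linear0 summxE mxE => <-.
rewrite (bigD1 i) //= linearZ /= /vb r2vK !mxE !eqxx mulr1 big1 ?addr0 //.
by move=> j nij; rewrite linearZ /= r2vK !mxE eqxx eq_sym (negPf nij) mulr0.
Qed.

Lemma tlift_is_linear U V (W : lmodType k) (B : U -> V -> W) :
  linear (tlift B).
Proof.
move=> a s t; rewrite /tlift scaler_sumr -big_split /=; apply: eq_bigr => i _.
rewrite scaler_sumr -big_split /=; apply: eq_bigr => j _.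
by rewrite !mxE scalerDl scalerA.
Qed.
HB.instance Definition _ U V (W : lmodType k) (B : U -> V -> W) :=
  GRing.isLinear.Build k (tens U V) W *:%R (tlift B) (tlift_is_linear B).

Lemma eq_tlift U V (W : lmodType k) (B B' : U -> V -> W) :
  (forall u v, B u v = B' u v) -> tlift B =1 tlift B'.
Proof.
by move=> BB' t; apply: eq_bigr => i _; apply: eq_bigr => j _; rewrite BB'.
Qed.

Section Bilin.
Variables (U V W : lmodType k) (B : U -> V -> W).
Hypothesis bB : bilin B.
Let Bl v := GRing.isLinear.Build k U W *:%R (B^~ v) (bB.1 v).
Let Br u := GRing.isLinear.Build k V W *:%R (B u) (bB.2 u).
Let BL v : {linear U -> W} := HB.pack (B^~ v) (Bl v).
Let BR u : {linear V -> W} := HB.pack (B u) (Br u).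
Lemma bilinZl a u v : B (a *: u) v = a *: B u v.
Proof. exact: (linearZ_LR (BL v)). Qed.
Lemma bilinZr a u v : B u (a *: v) = a *: B u v.
Proof. exact: (linearZ_LR (BR u)). Qed.
Lemma bilin_suml I r (P : pred I) F v :
  B (\sum_(i <- r | P i) F i) v = \sum_(i <- r | P i) B (F i) v.
Proof. exact: (linear_sum (BL v)). Qed.
Lemma bilin_sumr I r (P : pred I) F u :
  B u (\sum_(i <- r | P i) F i) = \sum_(i <- r | P i) B u (F i).
Proof. exact: (linear_sum (BR u)). Qed.
End Bilin.

Lemma tpure_bilin U V : bilin (@tpure U V).
Proof.
split=> w a u v; rewrite /tpure.
  by rewrite !linearP /= mulmxDl -scalemxAl.
by rewrite !linearP /=.
Qed.

Lemma tpureE U V (u : U) (v : V) i j :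
  (tpure u v : 'M[k]_(dim U, dim V)) i j = v2r u 0 i * v2r v 0 j.
Proof. by rewrite /tpure !mxE big_ord1 !mxE. Qed.

Lemma tlift_pure U V (W : lmodType k) (B : U -> V -> W) u v :
  bilin B -> tlift B (tpure u v) = B u v.
Proof.
move=> bB; rewrite {2}(vbE u) (bilin_suml bB); apply: eq_bigr => i _.
rewrite (bilinZl bB) {2}(vbE v) (bilin_sumr bB) scaler_sumr.
by apply: eq_bigr => j _; rewrite (bilinZr bB) scalerA tpureE.
Qed.

Lemma tensE U V (t : tens U V) : t = tlift (@tpure U V) t.
Proof.
apply/matrixP=> i j; rewrite /tlift !summxE (bigD1 i) //= summxE (bigD1 j) //=.
rewrite mxE tpureE /vb !r2vK !mxE !eqxx !mulr1 big1; last first.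
  move=> l nlj; rewrite mxE tpureE !r2vK !mxE !eqxx.
  by rewrite [j == l]eq_sym (negPf nlj) !mulr0.
rewrite big1 ?addr0 // => l nli; rewrite summxE big1 // => m _.
by rewrite mxE tpureE !r2vK !mxE !eqxx eq_sym (negPf nli) mul0r mulr0.
Qed.

Lemma tens_ind U V (P : tens U V -> Prop) :
  (forall u v, P (tpure u v)) ->
  (forall a s t, P s -> P t -> P (a *: s + t)) -> forall t, P t.
Proof.
move=> Pp PD t.
have P0 : P 0.
  by have := Pp 0 0; rewrite /tpure linear0 trmx0 mul0mx.
have PS : forall (I : Type) (r : seq I) F,
    (forall i, P (F i)) -> P (\sum_(i <- r) F i).
  move=> I r F PF; elim: r => [|i r IH]; first by rewrite big_nil.
  by rewrite big_cons -[F i]scale1r; apply: PD.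
rewrite (tensE t); apply: (PS) => i; apply: (PS) => j.
by rewrite -[_ *: _]addr0; apply: PD.
Qed.

Lemma tens_ext U V (W : lmodType k) (f g : tens U V -> W) :
  linear f -> linear g -> (forall u v, f (tpure u v) = g (tpure u v)) ->
  f =1 g.
Proof.
move=> lf lg fg; elim/tens_ind => // a s t fgs fgt.
by rewrite lf lg fgs fgt.
Qed.

Lemma scalar_comb (U : lmodType k) (f : U -> k) : scalar f ->
  forall (I : finType) (c : I -> k) (w : I -> U),
    f (\sum_i c i *: w i) = \sum_i c i * f (w i).
Proof.
move=> lf I c w.
have f0 : f 0 = 0 by have := lf (-1) 0 0; rewrite scaler0 addr0 mulN1r addNr.
have fD : {morph f : x y / x + y >-> x + y}.
  by move=> x y; have := lf 1 x y; rewrite scale1r mul1r.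
rewrite (big_morph f fD f0); apply: eq_bigr => i _.
by rewrite -[_ *: _]addr0 lf f0 addr0.
Qed.

(* A tensor is determined by its pairings with separating families. *)
Lemma tens_sep U V (X Y : Type) (f : X -> U -> k) (g : Y -> V -> k) :
  (forall x, scalar (f x)) -> (forall y, scalar (g y)) ->
  (forall u, (forall x, f x u = 0) -> u = 0) ->
  (forall v, (forall y, g y v = 0) -> v = 0) ->
  forall t, (forall x y, tlift (fun u v => f x u * g y v : k^o) t = 0) -> t = 0.
Proof.
move=> lf lg f0 g0 t t0; apply/matrixP=> i j; rewrite mxE.
pose tm : 'M[k]_(dim U, dim V) := t.
have row0 : forall y l, \sum_j tm l j * g y (vb j) = 0.
  move=> y; apply: (@vb_free U (fun l => \sum_j tm l j * g y (vb j))).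
  apply: f0 => x; rewrite (scalar_comb (lf x)); apply: etrans (t0 x y).
  apply: eq_bigr => m _; rewrite mulr_suml; apply: eq_bigr => n _.
  by rewrite -mulrA [g _ _ * _]mulrC.
apply: (@vb_free V (fun j => tm i j)); apply: g0 => y.
by rewrite (scalar_comb (lg y)); exact: row0.
Qed.

Definition tmap U U' V V' (f : U -> U') (g : V -> V') (t : tens U V) :
  tens U' V' := tlift (fun u v => tpure (f u) (g v)) t.

Definition tassoc U V W (t : tens (tens U V) W) : tens U (tens V W) :=
  tlift (fun uv w => tlift (fun u v => tpure u (tpure v w)) uv) t.

End Tensor.

Section TensorBilin.
Variable k : fieldType.
Implicit Types U V W : vectType k.

Lemma tpurePl U V a (u u' : U) (v : V) :
  tpure (a *: u + u') v = a *: tpure u v + tpure u' v.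
Proof. exact: (tpure_bilin U V).1. Qed.

Lemma tpurePr U V a (u : U) (v v' : V) :
  tpure u (a *: v + v') = a *: tpure u v + tpure u v'.
Proof. exact: (tpure_bilin U V).2. Qed.

Lemma tliftPB U V (W : lmodType k) a (B B' : U -> V -> W) t :
  tlift (fun u v => a *: B u v + B' u v) t = a *: tlift B t + tlift B' t.
Proof.
rewrite /tlift scaler_sumr -big_split; apply: eq_bigr => i _ /=.
rewrite scaler_sumr -big_split; apply: eq_bigr => j _ /=.
by rewrite scalerDr !scalerA mulrC.
Qed.

Lemma tlift_comp U V (W W' : lmodType k) (B : U -> V -> W)
    (f : {linear W -> W'}) t :
  f (tlift B t) = tlift (fun u v => f (B u v)) t.
Proof.
rewrite /tlift linear_sum; apply: eq_bigr => i _ /=.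
by rewrite linear_sum; apply: eq_bigr => j _; rewrite linearZ.
Qed.

Lemma tmapP U U' V V' (f : U -> U') (g : V -> V') a s t :
  tmap f g (a *: s + t) = a *: tmap f g s + tmap f g t.
Proof. exact: linearP. Qed.

Lemma tmap_pure U U' V V' (f : {linear U -> U'}) (g : {linear V -> V'}) u v :
  tmap f g (tpure u v) = tpure (f u) (g v).
Proof.
rewrite /tmap tlift_pure //.
by split=> w a x y; rewrite linearP ?tpurePl ?tpurePr.
Qed.

Lemma tassocP U V W a (s t : tens (tens U V) W) :
  tassoc (a *: s + t) = a *: tassoc s + tassoc t.
Proof. exact: linearP. Qed.

Lemma tassoc_pure U V W (u : U) (v : V) (w : W) :
  tassoc (tpure (tpure u v) w) = tpure u (tpure v w).
Proof.
have b2 (w' : W) : bilin (fun u v => tpure (u : U) (tpure (v : V) w')).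
  by split=> x a y z; rewrite ?tpurePl ?tpurePr.
rewrite /tassoc tlift_pure ?tlift_pure //.
split=> x a y z; first by rewrite linearP.
rewrite -tliftPB; apply: eq_tlift => u' v'.
by rewrite !tpurePr.
Qed.

End TensorBilin.

Section TensorAlgebra.
Variables (k : fieldType) (A B : falgType k).

Definition tone : tens A B := tpure 1 1.
Definition tmul (s t : tens A B) : tens A B :=
  tlift (fun a b => tlift (fun a' b' => tpure (a * a') (b * b')) t) s.

Lemma tmulPl a s s' t : tmul (a *: s + s') t = a *: tmul s t + tmul s' t.
Proof. exact: linearP. Qed.

Lemma tmulPr a s t t' : tmul s (a *: t + t') = a *: tmul s t + tmul s t'.
Proof. by rewrite -tliftPB; apply: eq_tlift => x y; rewrite linearP. Qed.

Lemma tmul_pure a b c d :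
  tmul (tpure a b) (tpure c d) = tpure (a * c) (b * d).
Proof.
have b2 x y : bilin (fun a' b' => tpure ((x : A) * a') ((y : B) * b')).
  by split=> w l u v; rewrite mulrDr -scalerAr ?tpurePl ?tpurePr.
rewrite /tmul tlift_pure ?tlift_pure //.
split=> w l u v; rewrite -tliftPB; apply: eq_tlift => x y.
  by rewrite mulrDl -scalerAl tpurePl.
by rewrite mulrDl -scalerAl tpurePr.
Qed.

Lemma tmulA : associative tmul.
Proof.
elim/tens_ind=> [a b|l s s' IH IH' t u]; last first.
  by rewrite !tmulPl IH IH'.
elim/tens_ind=> [c d|l s s' IH IH' t]; last first.
  by rewrite !(tmulPl, tmulPr) IH IH'.
elim/tens_ind=> [e f|l s s' IH IH']; last first.
  by rewrite !tmulPr IH IH'.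
by rewrite !tmul_pure !mulrA.
Qed.

Lemma tmul1x : left_id tone tmul.
Proof.
elim/tens_ind=> [a b|l s s' IH IH']; last by rewrite tmulPr IH IH'.
by rewrite tmul_pure !mul1r.
Qed.

Lemma tmulx1 : right_id tone tmul.
Proof.
elim/tens_ind=> [a b|l s s' IH IH']; last by rewrite tmulPl IH IH'.
by rewrite tmul_pure !mulr1.
Qed.

Lemma tmulDl : left_distributive tmul +%R.
Proof. by move=> s t u; have := tmulPl 1 s t u; rewrite !scale1r. Qed.

Lemma tmulDr : right_distributive tmul +%R.
Proof. by move=> s t u; have := tmulPr 1 s t u; rewrite !scale1r. Qed.

Lemma tone_neq0 : tone != 0.
Proof.
have nz (C : falgType k) : exists i, v2r (1 : C) 0 i != 0.
  apply/rV0Pn; apply/eqP => /(congr1 r2v); rewrite v2rK linear0.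
  by apply/eqP; apply: oner_neq0.
have [i ni] := nz A; have [j nj] := nz B.
apply/eqP => /matrixP /(_ i j); rewrite tpureE mxE => /eqP.
by rewrite mulf_eq0 (negPf ni) (negPf nj).
Qed.

HB.instance Definition _ := GRing.Zmodule_isNzRing.Build (tens A B)
  tmulA tmul1x tmulx1 tmulDl tmulDr tone_neq0.

Fact tens_scaleAl (a : k) (s t : tens A B) : a *: (s * t) = a *: s * t.
Proof. exact: esym (linearZ_LR (tlift _) a s). Qed.
HB.instance Definition _ := GRing.Lmodule_isLalgebra.Build k (tens A B)
  tens_scaleAl.

Fact tens_scaleAr (a : k) (s t : tens A B) : a *: (s * t) = s * (a *: t).
Proof.
have s0 : tmul s 0 = 0 by apply: (@mulr0 (tens A B)).
by have := tmulPr a s t 0; rewrite s0 !addr0.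
Qed.
HB.instance Definition _ := GRing.Lalgebra_isAlgebra.Build k (tens A B)
  tens_scaleAr.
HB.instance Definition _ := Algebra_isFalgebra.Build k (tens A B).

End TensorAlgebra.


Notation "x '⊗' y" := (tpure x y) (at level 40, left associativity) : ring_scope.

HB.mixin Record Vector_isCoalgebra (k : fieldType) C of Vector k C := {
  comul : {linear C -> tens C C};
  counit : {linear C -> k^o};
  comulA : forall c : C,
    tassoc (tmap comul idfun (comul c)) = tmap idfun comul (comul c);
  comul_counitl : forall c : C,
    tlift (fun x y => counit x *: y) (comul c) = c;
  comul_counitr : forall c : C,
    tlift (fun x y => counit y *: x) (comul c) = c
}.

#[short(type="coalgType")]
HB.structure Definition Coalgebra (k : fieldType) :=
  { C of Vector k C & Vector_isCoalgebra k C }.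

(* Nonzero coalgebras: those whose dual algebra is a falgType (a nontrivial   *)
(* algebra).                                                                  *)
HB.mixin Record Coalgebra_isNontrivial (k : fieldType) C of Coalgebra k C := {
  counit_neq0 : exists c : C, counit c != 0
}.

#[short(type="nzCoalgType")]
HB.structure Definition NzCoalgebra (k : fieldType) :=
  { C of Coalgebra k C & Coalgebra_isNontrivial k C }.

HB.mixin Record Falgebra_Coalgebra_isHopf (k : fieldType) H
    of Falgebra k H & NzCoalgebra k H := {
  comulM : forall x y : H, comul (x * y) = comul x * comul y :> tens H H;
  comul1 : comul (1 : H) = 1 :> tens H H;
  counitM : forall x y : H, counit (x * y) = counit x * counit y;
  counit1 : counit (1 : H) = 1;
  antipode : {linear H -> H};
  antipodel : forall h : H,
    tlift (fun x y => antipode x * y) (comul h) = (counit h : k)%:A;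
  antipoder : forall h : H,
    tlift (fun x y => x * antipode y) (comul h) = (counit h : k)%:A
}.

#[short(type="hopfType")]
HB.structure Definition Hopf (k : fieldType) :=
  { H of Falgebra k H & NzCoalgebra k H & Falgebra_Coalgebra_isHopf k H }.

(* The subspace U (x) V of the tensor square of C. *)
Definition tensv (k : fieldType) (C : vectType k) (U V : {vspace C}) :
  {vspace tens C C} := <<[seq u ⊗ v | u <- vbasis U, v <- vbasis V]>>%VS.

Definition subcoalgebra (k : fieldType) (C : coalgType k) (D : {vspace C}) :=
  forall c : C, c \in D -> comul c \in tensv D D.

Definition simple_coalgebra (k : fieldType) (C : coalgType k) :=
  ({:C} != 0)%VS /\
  forall D : {vspace C}, subcoalgebra D -> D = 0%VS \/ D = fullv.

Definition dual (k : fieldType) (V : vectType k) : Type := 'Hom(V, k^o).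

HB.instance Definition _ (k : fieldType) (V : vectType k) :=
  Vector.copy (dual V) 'Hom(V, k^o).

Definition dual_app (k : fieldType) (V : vectType k) (a : dual V) : V -> k :=
  fun_of_lfun (a : 'Hom(V, k^o)).
Coercion dual_app : dual >-> Funclass.

Section DualSpace.
Variable k : fieldType.
Implicit Types U V W : vectType k.

Fact dual_app_is_scalar V (a : dual V) : scalar (dual_app a).
Proof. by move=> c x y; rewrite /dual_app linearP. Qed.
HB.instance Definition _ V (a : dual V) :=
  GRing.isLinear.Build k V k *%R (dual_app a) (dual_app_is_scalar a).

Lemma dual_ext V (a b : dual V) : dual_app a =1 dual_app b -> a = b.
Proof. by move=> ab; apply/lfunP. Qed.

Lemma dualP V c (a b : dual V) x : dual_app (c *: a + b) x = c * a x + b x.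
Proof. by rewrite /dual_app add_lfunE scale_lfunE. Qed.

(* The functional with underlying function f, for f linear. *)
Definition mkdual V (f : V -> k) : dual V := linfun (f : V -> k^o).

Lemma mkdualE V (f : V -> k) : scalar f -> mkdual f =1 f.
Proof.
move=> lf x; pose F : {linear V -> k^o} :=
  HB.pack (f : V -> k^o) (GRing.isLinear.Build k V k^o *:%R _ lf).
by rewrite /mkdual /dual_app -[f]/(F : V -> k^o) lfunE.
Qed.

(* The functional a (x) b on U (x) V. *)
Definition tpair2 U V (a : dual U) (b : dual V) (t : tens U V) : k :=
  tlift (fun u v => a u * b v : k^o) t.

(* The pairing of (dual U) (x) (dual V) with U (x) V on pure tensors. *)
Definition tpair U V (t : tens (dual U) (dual V)) (u : U) (v : V) : k :=
  tlift (fun (a : dual U) (b : dual V) => a u * b v : k^o) t.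

Lemma tpair2_bilin U V (a : dual U) (b : dual V) :
  @bilin k U V k^o (fun u v => a u * b v).
Proof.
by split=> w c x y; rewrite linearP /= ?mulrDl ?mulrDr /GRing.scale /= ?mulrA
  // [a w * c]mulrC.
Qed.

Lemma tpair2_pure U V (a : dual U) (b : dual V) u v :
  tpair2 a b (u ⊗ v) = a u * b v.
Proof. exact: tlift_pure (tpair2_bilin a b). Qed.

Lemma tpair2P U V (a : dual U) (b : dual V) c s t :
  tpair2 a b (c *: s + t) = c * tpair2 a b s + tpair2 a b t.
Proof. by rewrite /tpair2 tlift_is_linear. Qed.

Lemma tpair2Pl U V c (a a' : dual U) (b : dual V) t :
  tpair2 (c *: a + a') b t = c * tpair2 a b t + tpair2 a' b t.
Proof.
elim/tens_ind: t => [u v|l s t IH IH'].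
  by rewrite !tpair2_pure dualP; ring.
by rewrite !tpair2P IH IH'; ring.
Qed.

Lemma tpair2Pr U V c (a : dual U) (b b' : dual V) t :
  tpair2 a (c *: b + b') t = c * tpair2 a b t + tpair2 a b' t.
Proof.
elim/tens_ind: t => [u v|l s t IH IH'].
  by rewrite !tpair2_pure dualP; ring.
by rewrite !tpair2P IH IH'; ring.
Qed.

Lemma tpair_pure U V (a : dual U) (b : dual V) u v :
  tpair (a ⊗ b) u v = a u * b v.
Proof.
rewrite /tpair tlift_pure //.
by split=> w c x y; rewrite dualP /GRing.scale /=; ring.
Qed.

Lemma tpairP U V c (s t : tens (dual U) (dual V)) u v :
  tpair (c *: s + t) u v = c * tpair s u v + tpair t u v.
Proof. by rewrite /tpair tlift_is_linear. Qed.

Lemma tpairPl U V (t : tens (dual U) (dual V)) c u u' v :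
  tpair t (c *: u + u') v = c * tpair t u v + tpair t u' v.
Proof.
elim/tens_ind: t => [a b|l s t IH IH'].
  by rewrite !tpair_pure linearP /=; ring.
by rewrite !tpairP IH IH'; ring.
Qed.

Lemma tpairPr U V (t : tens (dual U) (dual V)) c u v v' :
  tpair t u (c *: v + v') = c * tpair t u v + tpair t u v'.
Proof.
elim/tens_ind: t => [a b|l s t IH IH'].
  by rewrite !tpair_pure linearP /=; ring.
by rewrite !tpairP IH IH'; ring.
Qed.

Lemma tpair_eq0 U V (t : tens (dual U) (dual V)) :
  (forall u v, tpair t u v = 0) -> t = 0.
Proof.
move=> t0; apply: (@tens_sep k (dual U) (dual V) U V
  (fun u (a : dual U) => a u) (fun v (b : dual V) => b v)) => //.
- by move=> u c a b; rewrite dualP.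
- by move=> u c a b; rewrite dualP.
- by move=> a a0; apply: dual_ext => x; rewrite a0 /dual_app zero_lfunE.
- by move=> a a0; apply: dual_ext => x; rewrite a0 /dual_app zero_lfunE.
Qed.

Lemma tpair_ext U V (s t : tens (dual U) (dual V)) :
  (forall u v, tpair s u v = tpair t u v) -> s = t.
Proof.
move=> st; apply/eqP; rewrite -subr_eq0; apply/eqP/tpair_eq0 => u v.
by rewrite addrC -scaleN1r tpairP st; ring.
Qed.

Definition tpair3 U V W (t : tens (dual U) (tens (dual V) (dual W)))
  (u : U) (v : V) (w : W) : k :=
  tlift (fun (a : dual U) bc => a u * tpair bc v w : k^o) t.

Lemma tpair3_pure U V W (a : dual U) (t : tens (dual V) (dual W)) u v w :
  tpair3 (a ⊗ t) u v w = a u * tpair t v w.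
Proof.
rewrite /tpair3 tlift_pure //.
by split=> x c y z; rewrite ?dualP ?tpairP /GRing.scale /=; ring.
Qed.

Lemma tpair3P U V W c (s t : tens (dual U) (tens (dual V) (dual W))) u v w :
  tpair3 (c *: s + t) u v w = c * tpair3 s u v w + tpair3 t u v w.
Proof. by rewrite /tpair3 tlift_is_linear. Qed.

Lemma tpair3_ext U V W (s t : tens (dual U) (tens (dual V) (dual W))) :
  (forall u v w, tpair3 s u v w = tpair3 t u v w) -> s = t.
Proof.
move=> st; apply/eqP; rewrite -subr_eq0; apply/eqP.
apply: (@tens_sep k (dual U) (tens (dual V) (dual W)) U (V * W)
  (fun u (a : dual U) => a u) (fun vw b => tpair b vw.1 vw.2)) => //.
- by move=> u c a b; rewrite dualP.
- by move=> u c a b; rewrite tpairP.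
- by move=> a a0; apply: dual_ext => x; rewrite a0 /dual_app zero_lfunE.
- by move=> a a0; apply: tpair_eq0 => x y; apply: (a0 (x, y)).
move=> u [v w] /=; rewrite -/(tpair3 (s - t) u v w).
by rewrite addrC -scaleN1r tpair3P st; ring.
Qed.

Lemma tlift_tmap U U' V V' (X : lmodType k) (B : U' -> V' -> X)
    (f : {linear U -> U'}) (g : {linear V -> V'}) t :
  bilin B -> tlift B (tmap f g t) = tlift (fun u v => B (f u) (g v)) t.
Proof.
by move=> bB; rewrite /tmap (tlift_comp _ (tlift B));
  apply: eq_tlift => u v /=; rewrite tlift_pure.
Qed.

Lemma eq_tliftk U V (B B' : U -> V -> k) t : (forall u v, B u v = B' u v) ->
  tlift (B : U -> V -> k^o) t = tlift (B' : U -> V -> k^o) t :> k.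
Proof. by move=> BB'; apply: (@eq_tlift k U V k^o). Qed.

Lemma tliftk_linP U V (B : U -> V -> k) a s t :
  tlift (B : U -> V -> k^o) (a *: s + t) =
  a * (tlift (B : U -> V -> k^o) s : k) + tlift (B : U -> V -> k^o) t :> k.
Proof. by rewrite tlift_is_linear. Qed.

Lemma tliftPk U V a (B B' : U -> V -> k) t :
  tlift (fun u v => a * B u v + B' u v : k^o) t =
  a * (tlift (B : U -> V -> k^o) t : k) + tlift (B' : U -> V -> k^o) t :> k.
Proof. exact: (@tliftPB k U V k^o). Qed.

End DualSpace.

Section DualAlgebra.
Variables (k : fieldType) (C : nzCoalgType k).

Definition dmul (a b : dual C) : dual C :=
  mkdual (fun c => tpair2 a b (comul c)).
Definition dunit : dual C := mkdual (counit : C -> k).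

Lemma dunitE c : dunit c = counit c.
Proof. by rewrite /dunit mkdualE // => l x y; rewrite linearP. Qed.

Lemma dmulE a b c : dmul a b c = tpair2 a b (comul c).
Proof. by rewrite mkdualE // => l x y; rewrite linearP /= tpair2P. Qed.

Fact dmulPl l a a' b : dmul (l *: a + a') b = l *: dmul a b + dmul a' b.
Proof. by apply: dual_ext => c; rewrite !(dmulE, dualP) tpair2Pl. Qed.
Fact dmulPr l a b b' : dmul a (l *: b + b') = l *: dmul a b + dmul a b'.
Proof. by apply: dual_ext => c; rewrite !(dmulE, dualP) tpair2Pr. Qed.

Fact dmulA : associative dmul.
Proof.
move=> a b d; apply: dual_ext => c; rewrite !dmulE.
pose F (t : tens C (tens C C)) : k :=
  tlift (fun x yz => a x * tpair2 b d yz : k^o) t.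
have FP l s t : F (l *: s + t) = l * F s + F t by rewrite /F tlift_is_linear.
have Fp x t : F (x ⊗ t) = a x * tpair2 b d t.
  rewrite /F tlift_pure //.
  by split=> w l y z; rewrite ?tpair2P ?linearP /GRing.scale /=; ring.
have El t : tpair2 (dmul a b) d t = F (tassoc (tmap comul idfun t)).
  elim/tens_ind: t => [x y|l s t IH IH']; last first.
    by rewrite tpair2P tmapP tassocP FP IH IH'.
  rewrite tpair2_pure tmap_pure /= dmulE.
  elim/tens_ind: (comul x) => [u v|l s t IH IH'].
    by rewrite tassoc_pure Fp !tpair2_pure mulrA.
  by rewrite tpair2P tpurePl tassocP FP -IH -IH'; ring.
have Er t : tpair2 a (dmul b d) t = F (tmap idfun comul t).
  elim/tens_ind: t => [x y|l s t IH IH']; last first.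
    by rewrite tpair2P tmapP FP IH IH'.
  by rewrite tpair2_pure tmap_pure /= dmulE Fp.
by rewrite El Er comulA.
Qed.

Fact dmul1x : left_id dunit dmul.
Proof.
move=> a; apply: dual_ext => c; rewrite dmulE.
rewrite -[in RHS](comul_counitl c).
elim/tens_ind: (comul c) => [x y|l s t IH IH'].
  rewrite tpair2_pure dunitE tlift_pure ?scalarZ //.
  split=> w l u v; first by rewrite linearP scalerDl scalerA.
  by rewrite scalerDr !scalerA mulrC.
by rewrite tpair2P !linearP /= IH IH'.
Qed.

Fact dmulx1 : right_id dunit dmul.
Proof.
move=> a; apply: dual_ext => c; rewrite dmulE.
rewrite -[in RHS](comul_counitr c).
elim/tens_ind: (comul c) => [x y|l s t IH IH'].
  rewrite tpair2_pure dunitE tlift_pure ?scalarZ 1?mulrC //.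
  split=> w l u v; last by rewrite linearP scalerDl scalerA.
  by rewrite scalerDr !scalerA mulrC.
by rewrite tpair2P !linearP /= IH IH'.
Qed.

Fact dmulDl : left_distributive dmul +%R.
Proof. by move=> s t u; have := dmulPl 1 s t u; rewrite !scale1r. Qed.

Fact dmulDr : right_distributive dmul +%R.
Proof. by move=> s t u; have := dmulPr 1 s t u; rewrite !scale1r. Qed.

Fact dunit_neq0 : dunit != 0.
Proof.
have [c nc] := @counit_neq0 k C; apply: contraNneq nc => d0.
by rewrite -dunitE d0 /dual_app zero_lfunE.
Qed.

HB.instance Definition _ := GRing.Zmodule_isNzRing.Build (dual C)
  dmulA dmul1x dmulx1 dmulDl dmulDr dunit_neq0.

Fact dual_scaleAl (l : k) (a b : dual C) : l *: (a * b) = l *: a * b.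
Proof.
have b0 : dmul 0 b = 0 by apply: (@mul0r (dual C)).
by have := dmulPl l a 0 b; rewrite b0 !addr0.
Qed.
HB.instance Definition _ := GRing.Lmodule_isLalgebra.Build k (dual C)
  dual_scaleAl.

Fact dual_scaleAr (l : k) (a b : dual C) : l *: (a * b) = a * (l *: b).
Proof.
have a0 : dmul a 0 = 0 by apply: (@mulr0 (dual C)).
by have := dmulPr l a b 0; rewrite a0 !addr0.
Qed.
HB.instance Definition _ := GRing.Lalgebra_isAlgebra.Build k (dual C)
  dual_scaleAr.
HB.instance Definition _ := Algebra_isFalgebra.Build k (dual C).

Lemma dual1E c : dual_app (1 : dual C) c = counit c. Proof. exact: dunitE. Qed.
Lemma dualME (a b : dual C) c : dual_app (a * b) c = tpair2 a b (comul c).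
Proof. exact: dmulE. Qed.

End DualAlgebra.

Section DualCoalgebra.
Variables (k : fieldType) (A : falgType k).

Definition dvb (i : 'I_(dim A)) : dual A := mkdual (fun v => v2r v 0 i).

Lemma dvbE i v : dvb i v = v2r v 0 i.
Proof. by rewrite mkdualE // => l x y; rewrite linearP !mxE. Qed.

(* The element of (dual A) (x) (dual A) corresponding to the bilinear form    *)
(* (x, y) |-> a (x * y), written in the dual bases (tpair_dcomul).            *)
Definition dcomul (a : dual A) : tens (dual A) (dual A) :=
  \sum_i \sum_j a (vb i * vb j) *: (dvb i ⊗ dvb j).

Definition dcounit (a : dual A) : k^o := a 1.

Fact dcomul_is_linear : linear dcomul.
Proof.
move=> l a b; rewrite /dcomul scaler_sumr -big_split; apply: eq_bigr => i _ /=.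
rewrite scaler_sumr -big_split; apply: eq_bigr => j _ /=.
by rewrite dualP scalerDl scalerA.
Qed.
HB.instance Definition _ := GRing.isLinear.Build k (dual A)
  (tens (dual A) (dual A)) *:%R dcomul dcomul_is_linear.

Fact dcounit_is_linear : linear dcounit.
Proof. by move=> l a b; rewrite /dcounit dualP. Qed.
HB.instance Definition _ := GRing.isLinear.Build k (dual A) k^o *:%R
  dcounit dcounit_is_linear.

Lemma tpair_dcomul a x y : tpair (dcomul a) x y = a (x * y).
Proof.
rewrite [in RHS](vbE x) mulr_suml (linear_sum (dual_app a)) /= /dcomul.
rewrite /tpair linear_sum; apply: eq_bigr => i _ /=.
rewrite [in RHS](vbE y) mulr_sumr (linear_sum (dual_app a)) /= linear_sum.
apply: eq_bigr => j _ /=; rewrite linearZ /= -/(tpair _ _ _) tpair_pure !dvbE.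
by rewrite -scalerAl -scalerAr !scalarZ /GRing.scale /=; ring.
Qed.

Fact dcomulA a :
  tassoc (tmap dcomul idfun (dcomul a)) = tmap idfun dcomul (dcomul a).
Proof.
have El t u v w :
  tpair3 (tassoc (tmap dcomul idfun t)) u v w = tpair t (u * v) w.
  elim/tens_ind: t => [x y|l s t IH IH']; last first.
    by rewrite tmapP tassocP tpair3P tpairP IH IH'.
  rewrite tmap_pure /= tpair_pure -tpair_dcomul.
  elim/tens_ind: (dcomul x) => [b c|l s t IH IH'].
    by rewrite tassoc_pure tpair3_pure !tpair_pure mulrA.
  by rewrite tpurePl tassocP tpair3P tpairP IH IH'; ring.
have Er t u v w : tpair3 (tmap idfun dcomul t) u v w = tpair t u (v * w).
  elim/tens_ind: t => [x y|l s t IH IH']; last first.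
    by rewrite tmapP tpair3P tpairP IH IH'.
  by rewrite tmap_pure /= tpair_pure tpair3_pure tpair_dcomul.
by apply: tpair3_ext => u v w; rewrite El Er !tpair_dcomul mulrA.
Qed.

Fact dcounitl a : tlift (fun x y => dcounit x *: y) (dcomul a) = a.
Proof.
apply: dual_ext => w; rewrite -[in RHS](mul1r w) -tpair_dcomul.
elim/tens_ind: (dcomul a) => [x y|l s t IH IH'].
  rewrite tpair_pure tlift_pure.
    by rewrite /dual_app scale_lfunE.
  split=> z c u v; first by rewrite linearP scalerDl scalerA.
  by rewrite scalerDr !scalerA mulrC.
by rewrite linearP /= dualP tpairP IH IH'.
Qed.

Fact dcounitr a : tlift (fun x y => dcounit y *: x) (dcomul a) = a.
Proof.
apply: dual_ext => w; rewrite -[in RHS](mulr1 w) -tpair_dcomul.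
elim/tens_ind: (dcomul a) => [x y|l s t IH IH'].
  rewrite tpair_pure tlift_pure.
    by rewrite /dual_app scale_lfunE mulrC.
  split=> z c u v; last by rewrite linearP scalerDl scalerA.
  by rewrite scalerDr !scalerA mulrC.
by rewrite linearP /= dualP tpairP IH IH'.
Qed.

Fact dcounit_neq0 : exists a : dual A, dcounit a != 0.
Proof.
have /rV0Pn[i ni] : v2r (1 : A) != 0.
  apply/eqP => /(congr1 r2v); rewrite v2rK linear0.
  by apply/eqP; apply: oner_neq0.
by exists (dvb i); rewrite /dcounit dvbE.
Qed.

HB.instance Definition _ := Vector_isCoalgebra.Build k (dual A)
  dcomulA dcounitl dcounitr.
HB.instance Definition _ := Coalgebra_isNontrivial.Build k (dual A)
  dcounit_neq0.

Lemma tpair_comul (a : dual A) x y : tpair (comul a) x y = a (x * y).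
Proof. exact: tpair_dcomul. Qed.

Lemma dual_counitE (a : dual A) : counit a = a 1.
Proof. by []. Qed.

End DualCoalgebra.

Section DualHopf.
Variables (k : fieldType) (H : hopfType k).

Fact tpairM (s t : tens (dual H) (dual H)) x y :
  tpair (s * t) x y =
  tlift (fun x1 x2 =>
    tlift (fun y1 y2 => tpair s x1 y1 * tpair t x2 y2 : k^o) (comul y))
    (comul x).
Proof.
elim/tens_ind: s => [a b|l s s' IH IH']; last first.
  rewrite mulrDl -scalerAl tpairP IH IH'.
  rewrite -tliftPk; apply: eq_tliftk => u v.
  rewrite -tliftPk; apply: eq_tliftk => u' v'.
  by rewrite tpairP mulrDl -mulrA.
elim/tens_ind: t => [c d|l t t' IH IH']; last first.
  rewrite mulrDr -scalerAr tpairP IH IH'.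
  rewrite -tliftPk; apply: eq_tliftk => u v.
  rewrite -tliftPk; apply: eq_tliftk => u' v'.
  by rewrite [tpair (_ + _) _ _]tpairP mulrDr mulrCA.
have -> : (a ⊗ b) * (c ⊗ d) = (a * c) ⊗ (b * d) by exact: tmul_pure.
rewrite tpair_pure !dualME.
transitivity (tlift (fun x1 x2 => a x1 * c x2 *: (tpair2 b d (comul y) : k^o)) (comul x)).
  elim/tens_ind: (comul x) => [u v|l s t IH IH'].
    rewrite tpair2_pure tlift_pure //.
    by split=> w l p q; rewrite linearP /= /GRing.scale /=; ring.
  by rewrite tpair2P mulrDl -mulrA IH IH' linearP.
apply: eq_tliftk => u v; elim/tens_ind: (comul y) => [u' v'|l s t IH IH'].
  rewrite tpair2_pure tlift_pure; first by rewrite !tpair_pure mulrACA.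
  by split=> w l p q; rewrite !tpair_pure linearP /= /GRing.scale /=; ring.
by rewrite tpair2P tliftk_linP -IH -IH' /GRing.scale /= mulrDr mulrCA.
Qed.

Fact dcomulM (a b : dual H) :
  comul (a * b) = comul a * comul b :> tens (dual H) (dual H).
Proof.
apply: tpair_ext => x y; rewrite tpairM tpair_comul dualME comulM.
elim/tens_ind: (comul x) => [u v|l s t IH IH']; last first.
  by rewrite mulrDl -scalerAl tpair2P linearP IH IH'.
rewrite tlift_pure; last first.
  split=> w l p q; rewrite -tliftPB; apply: eq_tliftk => u' v'.
    by rewrite tpairPl /GRing.scale /=; ring.
  by rewrite tpairPl /GRing.scale /=; ring.
elim/tens_ind: (comul y) => [u' v'|l s t IH IH']; last first.
  by rewrite mulrDr -scalerAr tpair2P linearP IH IH'.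
have -> : (u ⊗ v) * (u' ⊗ v') = (u * u') ⊗ (v * v') by exact: tmul_pure.
rewrite tpair2_pure tlift_pure ?tpair_comul //.
by split=> w l p q; rewrite tpairPr /GRing.scale /=; ring.
Qed.

Fact dcomul1 : comul (1 : dual H) = 1 :> tens (dual H) (dual H).
Proof.
apply: tpair_ext => x y; rewrite tpair_comul dual1E counitM.
by rewrite -[1 : tens _ _]/(1 ⊗ 1) tpair_pure !dual1E.
Qed.

Fact dcounitM (a b : dual H) : counit (a * b) = counit a * counit b.
Proof.
rewrite !dual_counitE dualME comul1 -[1 : tens _ _]/(1 ⊗ 1).
exact: tpair2_pure.
Qed.

Fact dcounit1 : counit (1 : dual H) = 1.
Proof. by rewrite dual_counitE dual1E counit1. Qed.

Definition dantipode (a : dual H) : dual H := mkdual (fun h => a (antipode h)).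

Lemma dantipodeE a h : dantipode a h = a (antipode h).
Proof. by rewrite mkdualE // => l x y; rewrite !linearP. Qed.

Fact dantipode_is_linear : linear dantipode.
Proof.
by move=> l a b; apply: dual_ext => h; rewrite dualP !dantipodeE dualP.
Qed.
HB.instance Definition _ := GRing.isLinear.Build k (dual H) (dual H) *:%R
  dantipode dantipode_is_linear.

Fact dantipodel (a : dual H) :
  tlift (fun x y => dantipode x * y) (comul a) = (counit a : k)%:A.
Proof.
apply: dual_ext => h.
have E t : dual_app (tlift (fun x y : dual H => dantipode x * y) t) h =
    tlift (fun h1 h2 => tpair t (antipode h1) h2 : k^o) (comul h).
  elim/tens_ind: t => [x y|l s t IH IH']; last first.
    rewrite linearP /= dualP IH IH' -tliftPk.
    by apply: eq_tliftk => u v; rewrite tpairP.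
  rewrite tlift_pure; last first.
    by split=> w l u v; rewrite ?linearP ?mulrDl ?mulrDr -?scalerAl -?scalerAr.
  rewrite dualME; apply: eq_tliftk => u v.
  by rewrite dantipodeE tpair_pure.
rewrite E; transitivity (dual_app a (tlift (fun x y => antipode x * y) (comul h))).
  rewrite /dual_app tlift_comp; apply: eq_tliftk => u v.
  by rewrite tpair_comul.
rewrite antipodel scalarZ dual_counitE.
by rewrite /dual_app scale_lfunE -/(dual_app 1 h) dual1E /GRing.scale /= mulrC.
Qed.

Fact dantipoder (a : dual H) :
  tlift (fun x y => x * dantipode y) (comul a) = (counit a : k)%:A.
Proof.
apply: dual_ext => h.
have E t : dual_app (tlift (fun x y : dual H => x * dantipode y) t) h =
    tlift (fun h1 h2 => tpair t h1 (antipode h2) : k^o) (comul h).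
  elim/tens_ind: t => [x y|l s t IH IH']; last first.
    rewrite linearP /= dualP IH IH' -tliftPk.
    by apply: eq_tliftk => u v; rewrite tpairP.
  rewrite tlift_pure; last first.
    by split=> w l u v; rewrite ?linearP ?mulrDl ?mulrDr -?scalerAl -?scalerAr.
  rewrite dualME; apply: eq_tliftk => u v.
  by rewrite dantipodeE tpair_pure.
rewrite E; transitivity (dual_app a (tlift (fun x y => x * antipode y) (comul h))).
  rewrite /dual_app tlift_comp; apply: eq_tliftk => u v.
  by rewrite tpair_comul.
rewrite antipoder scalarZ dual_counitE.
by rewrite /dual_app scale_lfunE -/(dual_app 1 h) dual1E /GRing.scale /= mulrC.
Qed.

HB.instance Definition _ := Falgebra_Coalgebra_isHopf.Build k (dual H)
  dcomulM dcomul1 dcounitM dcounit1 dantipodel dantipoder.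

End DualHopf.

Section Bidual.
Variables (k : fieldType) (H : hopfType k).

Definition ev (h : H) : dual (dual H) := mkdual (fun a : dual H => a h).

Lemma evE h (a : dual H) : ev h a = a h.
Proof. by rewrite mkdualE // => l b c; rewrite dualP. Qed.

Fact ev_is_linear : linear ev.
Proof.
by move=> l x y; apply: dual_ext => a; rewrite dualP !evE linearP.
Qed.
HB.instance Definition _ := GRing.isLinear.Build k H (dual (dual H)) *:%R
  ev ev_is_linear.

Lemma ev_inj : injective ev.
Proof.
move=> x y xy; apply: v2r_inj; apply/rowP => i.
by rewrite -!(@dvbE k H) -!evE xy.
Qed.

Lemma ev1 : ev 1 = 1.
Proof. by apply: dual_ext => a; rewrite evE. Qed.

Lemma evM x y : ev (x * y) = ev x * ev y.
Proof.
apply: dual_ext => a; rewrite evE dualME -tpair_comul.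
by apply: eq_tliftk => b c; rewrite !evE.
Qed.

Lemma ev_counit x : counit (ev x) = counit x.
Proof. by rewrite dual_counitE evE dual1E. Qed.

Lemma ev_comul x : comul (ev x) = tmap ev ev (comul x).
Proof.
apply: tpair_ext => a b; rewrite tpair_comul evE dualME.
elim/tens_ind: (comul x) => [u v|l s t IH IH'].
  by rewrite tpair2_pure tmap_pure tpair_pure !evE.
by rewrite tpair2P tmapP tpairP IH IH'.
Qed.

End Bidual.

Section Twist.
Variables (k : fieldType) (H : hopfType k).

Definition is_twist (J : tens H H) : Prop :=
  [/\ J \is a GRing.unit,
      tassoc (tmap comul idfun J * (J ⊗ 1)) = tmap idfun comul J * (1 ⊗ J),
      tlift (fun x y => (counit x : k) *: y) J = 1
    & tlift (fun x y => (counit y : k) *: x) J = 1].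

Record twist := Twist { twist_val :> tens H H; twistP : is_twist twist_val }.

Definition gauge_equiv (J J' : tens H H) : Prop :=
  exists x : H, [/\ x \is a GRing.unit, counit x = 1
    & J' = comul x * J * (x^-1 ⊗ x^-1)].

(* Gauge transforms of a twist are again twists, so gauge_class J consists of *)
(* twists when J is one.                                                      *)
Definition gauge_class (J : tens H H) : set (tens H H) :=
  [set J' | gauge_equiv J J'].

End Twist.

Section DualTwist.
Variables (k : fieldType) (H : hopfType k).
Implicit Types J : twist H.

(* The coalgebra H^(J): the space H with the comultiplication                 *)
(* c |-> Delta(c) J.                                                          *)
Definition twcoalg (J : twist H) : Type := H.

HB.instance Definition _ (J : twist H) := Vector.copy (twcoalg J) H.

Definition twcomul (J : twist H) (c : twcoalg J) : tens (twcoalg J) (twcoalg J) :=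
  comul (c : H) * (J : tens H H).

Definition twcounit (J : twist H) (c : twcoalg J) : k^o := counit (c : H).

Fact twcomul_is_linear J : linear (@twcomul J).
Proof. by move=> l x y; rewrite /twcomul linearP mulrDl -scalerAl. Qed.
HB.instance Definition _ J := GRing.isLinear.Build k (twcoalg J)
  (tens (twcoalg J) (twcoalg J)) *:%R (@twcomul J) (@twcomul_is_linear J).

Fact twcounit_is_linear J : linear (@twcounit J).
Proof. by move=> l x y; rewrite /twcounit linearP. Qed.
HB.instance Definition _ J := GRing.isLinear.Build k (twcoalg J) k^o *:%R
  (@twcounit J) (@twcounit_is_linear J).

Lemma tpureM (A B : falgType k) (a c : A) (b d : B) :
  (a ⊗ b) * (c ⊗ d) = (a * c) ⊗ (b * d).
Proof. exact: tmul_pure. Qed.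

Lemma tassocM (s t : tens (tens H H) H) : tassoc (s * t) = tassoc s * tassoc t.
Proof.
elim/tens_ind: s => [u c|l s s' IH IH']; last first.
  by rewrite mulrDl -scalerAl !tassocP IH IH' mulrDl -scalerAl.
elim/tens_ind: t => [u' c'|l t t' IH IH']; last first.
  by rewrite mulrDr -scalerAr !tassocP IH IH' mulrDr -scalerAr.
rewrite tpureM; elim/tens_ind: u => [a b|l s s' IH IH']; last first.
  by rewrite mulrDl -scalerAl !tpurePl !tassocP IH IH' mulrDl -scalerAl.
elim/tens_ind: u' => [a' b'|l t t' IH IH']; last first.
  by rewrite mulrDr -scalerAr !tpurePl !tassocP IH IH' mulrDr -scalerAr.
by rewrite tpureM !tassoc_pure !tpureM.
Qed.

Lemma tmap_comullM (s t : tens H H) :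
  tmap comul idfun (s * t) = tmap comul idfun s * tmap comul idfun t.
Proof.
elim/tens_ind: s => [a b|l s s' IH IH']; last first.
  by rewrite mulrDl -scalerAl !tmapP IH IH' mulrDl -scalerAl.
elim/tens_ind: t => [a' b'|l s s' IH IH']; last first.
  by rewrite mulrDr -scalerAr !tmapP IH IH' mulrDr -scalerAr.
by rewrite tpureM !tmap_pure tpureM comulM.
Qed.

Lemma tmap_comulrM (s t : tens H H) :
  tmap idfun comul (s * t) = tmap idfun comul s * tmap idfun comul t.
Proof.
elim/tens_ind: s => [a b|l s s' IH IH']; last first.
  by rewrite mulrDl -scalerAl !tmapP IH IH' mulrDl -scalerAl.
elim/tens_ind: t => [a' b'|l s s' IH IH']; last first.
  by rewrite mulrDr -scalerAr !tmapP IH IH' mulrDr -scalerAr.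
by rewrite tpureM !tmap_pure tpureM comulM.
Qed.

Lemma counitl_bilin : @bilin k H H H (fun x y => (counit x : k) *: y).
Proof.
split=> w l x y; first by rewrite linearP scalerDl scalerA.
by rewrite scalerDr !scalerA mulrC.
Qed.

Lemma counitr_bilin : @bilin k H H H (fun x y => (counit y : k) *: x).
Proof.
split=> w l x y; last by rewrite linearP scalerDl scalerA.
by rewrite scalerDr !scalerA mulrC.
Qed.

Lemma counitlM (s t : tens H H) :
  tlift (fun x y => (counit x : k) *: y) (s * t) =
  tlift (fun x y => (counit x : k) *: y) s *
  tlift (fun x y => (counit x : k) *: y) t.
Proof.
elim/tens_ind: s => [a b|l s s' IH IH']; last first.
  by rewrite mulrDl -scalerAl !linearP /= IH IH' mulrDl -scalerAl.
elim/tens_ind: t => [a' b'|l s s' IH IH']; last first.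
  by rewrite mulrDr -scalerAr !linearP /= IH IH' mulrDr -scalerAr.
rewrite tpureM !(tlift_pure _ _ counitl_bilin) counitM.
by rewrite -scalerAl -scalerAr scalerA.
Qed.

Lemma counitrM (s t : tens H H) :
  tlift (fun x y => (counit y : k) *: x) (s * t) =
  tlift (fun x y => (counit y : k) *: x) s *
  tlift (fun x y => (counit y : k) *: x) t.
Proof.
elim/tens_ind: s => [a b|l s s' IH IH']; last first.
  by rewrite mulrDl -scalerAl !linearP /= IH IH' mulrDl -scalerAl.
elim/tens_ind: t => [a' b'|l s s' IH IH']; last first.
  by rewrite mulrDr -scalerAr !linearP /= IH IH' mulrDr -scalerAr.
rewrite tpureM !(tlift_pure _ _ counitr_bilin) counitM.
by rewrite -scalerAl -scalerAr scalerA.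
Qed.

Fact twcomulA (J : twist H) (c : twcoalg J) :
  tassoc (tmap (@twcomul J) idfun (twcomul c)) =
  tmap idfun (@twcomul J) (twcomul c).
Proof.
have [_ JA _ _] := twistP J.
have El (t : tens H H) : tmap (@twcomul J) idfun (t : tens (twcoalg J) _) =
    tmap comul idfun t * ((J : tens H H) ⊗ 1) :> tens (tens H H) H.
  elim/tens_ind: t => [x y|l s t IH IH'].
    by rewrite !tmap_pure tpureM /= mulr1.
  by rewrite !tmapP IH IH' mulrDl -scalerAl.
have Er (t : tens H H) : tmap idfun (@twcomul J) (t : tens _ (twcoalg J)) =
    tmap idfun comul t * (1 ⊗ (J : tens H H)) :> tens H (tens H H).
  elim/tens_ind: t => [x y|l s t IH IH'].
    by rewrite !tmap_pure tpureM /= mulr1.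
  by rewrite !tmapP IH IH' mulrDl -scalerAl.
rewrite El Er /twcomul tmap_comullM tmap_comulrM -!mulrA tassocM.
by rewrite comulA JA.
Qed.

Fact twcounitl (J : twist H) (c : twcoalg J) :
  tlift (fun x y => twcounit x *: y) (twcomul c) = c.
Proof.
have [_ _ JL _] := twistP J.
by rewrite [LHS](counitlM (comul (c : H)) J) JL mulr1 [LHS]comul_counitl.
Qed.

Fact twcounitr (J : twist H) (c : twcoalg J) :
  tlift (fun x y => twcounit y *: x) (twcomul c) = c.
Proof.
have [_ _ _ JR] := twistP J.
by rewrite [LHS](counitrM (comul (c : H)) J) JR mulr1 [LHS]comul_counitr.
Qed.

Fact twcounit_neq0 (J : twist H) : exists c : twcoalg J, twcounit c != 0.
Proof. by exists (1 : H); rewrite /twcounit counit1 oner_neq0. Qed.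

HB.instance Definition _ (J : twist H) := Vector_isCoalgebra.Build k (twcoalg J)
  (@twcomulA J) (@twcounitl J) (@twcounitr J).
HB.instance Definition _ (J : twist H) :=
  Coalgebra_isNontrivial.Build k (twcoalg J) (twcounit_neq0 J).

Definition nondegenerate (J : twist H) : Prop := simple_coalgebra (twcoalg J).

Definition NT : set (set (tens H H)) :=
  [set C | exists J : twist H, nondegenerate J /\ C = gauge_class J].

Section SkolemNoether.
Variable J : twist H.

(* dual (twcoalg J) is the algebra dual to the coalgebra H^(J). *)
Definition dual_act (a : dual (twcoalg J)) (h : H) : dual (twcoalg J) :=
  mkdual (fun c : H => a (h * c)).

Definition conv_inverse (p q : 'Hom(H, dual (twcoalg J))) : Prop :=
  forall h : H,
    tlift (fun h1 h2 => p h1 * q h2) (comul h) = (counit h : k)%:A /\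
    tlift (fun h1 h2 => q h1 * p h2) (comul h) = (counit h : k)%:A.

Definition skolem_noether (p q : 'Hom(H, dual (twcoalg J))) : Prop :=
  [/\ conv_inverse p q,
      forall (a : dual (twcoalg J)) (h : H),
        dual_act a h = tlift (fun h1 h2 => q h1 * a * p h2) (comul h)
    & p 1 = 1 /\ q 1 = 1].

(* c is the form <c, h (x) g> with values determined by the scalar elements   *)
(* p(h_1 g_1) q(g_2) q(h_2) of the algebra dual (twcoalg J).                  *)
Definition is_dual_twist (p q : 'Hom(H, dual (twcoalg J)))
    (c : tens (dual H) (dual H)) : Prop :=
  forall h g : H, (tpair c h g)%:A =
    tlift (fun h1 h2 =>
      tlift (fun g1 g2 => p (h1 * g1) * q g2 * q h2) (comul g)) (comul h).

End SkolemNoether.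

(* The map D_H, on gauge classes: the union of the gauge classes of the       *)
(* D_p(J), over all J in C and all Skolem-Noether maps p for J.               *)
Definition dual_map (C : set (tens H H)) : set (tens (dual H) (dual H)) :=
  [set K | exists (J : twist H) (p q : 'Hom(H, dual (twcoalg J))) c,
    [/\ C J, nondegenerate J, skolem_noether p q, is_dual_twist p q c
      & gauge_equiv c K]].

End DualTwist.

Arguments NT {k} H _.

(* D for the Hopf algebra dual H, with dual (dual H) identified with H by ev. *)
Definition dual_map_inv (k : fieldType) (H : hopfType k)
  (C : set (tens (dual H) (dual H))) : set (tens H H) :=
  [set J | dual_map C (tmap (@ev k H) (@ev k H) J)].

(* Main.v *)
From HB Require Import structures.
Require Import Defs.
From mathcomp Require Import all_boot all_algebra all_field.
From mathcomp Require Import ring.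
From mathcomp Require Import boolp classical_sets functions.

(** Write A for the algebra dual to the coalgebra H^(J), p for a Skolem-Noether
    map of J, q for its convolution inverse and c for the resulting form on H.
    Put h * g = sum c(h2, g2) h1 g1 for h, g in H ([star] below); for a twist
    K = c of the dual Hopf algebra this is the multiplication of the algebra
    dual to the coalgebra (H^* )^(K), under the identification of H with its
    bidual.  The definition of c says exactly that q(h * g) = q(g) q(h), and the
    condition that p makes the action of H inner can be written in terms of q
    alone: q(h) a = sum (a . h1) q(h2).

    The point of the proof is that q is bijective.  It is then an
    anti-isomorphism from the algebra (H, star) onto A, and its two properties
    become symmetric under exchanging (H, J) and (H^*, K): the inverse of q has
    the same two properties with respect to K and J ([dual_pair_sym]).  So
    K is dual to J if and only if J is dual to K, and A is simple if and only if
    the algebra dual to (H^* )^(K) is, which carries nondegeneracy from one side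
    to the other ([dual_pair_nondegenerate]).

    Bijectivity of q is obtained in two steps.  The map p is injective because
    the twisted comultiplication still has a Galois property, proved with the
    antipode and the inverse of J ([twcomul_galois], [sn_map_inj]); by
    dimension it is onto.  The image of q is a subalgebra S of A, and q is an
    invertible element of the finite-dimensional algebra Hom(H, A) lying in
    the subalgebra Hom(H, S), so its inverse p also has values in S; hence
    S = A ([sn_inverse_surj]).

    Two more facts are needed.  Skolem-Noether maps exist
    ([exists_skolem_noether]): the coaction a |-> (h |-> a . h) and the constant
    map are two homomorphisms from the matrix algebra A to the algebra
    Hom(H, A), and two homomorphisms from a matrix algebra to any
    finite-dimensional algebra E are conjugate ([units_conj]).  Moreover J
    determines c up to gauge ([dual_pair_unique]): two maps q for the same J
    differ by a convolution factor that commutes with A, that is by an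
    invertible element of H^*.

    Computations with several Sweedler indices are done as identities between
    elements of the rings Hom(H, A) and Hom(H, Hom(H, A)). *)

Set Implicit Arguments.
Unset Strict Implicit.
Unset Printing Implicit Defensive.

Import GRing.Theory VectorInternalTheory.
Local Open Scope ring_scope.

(** * Burnside's theorem *)

Section Representations.
Variables (k : closedFieldType) (E : falgType k).

Definition is_rep m (rho : E -> 'M[k]_m) :=
  [/\ linear rho, rho 1 = 1%:M & forall x y, rho (x * y) = rho x *m rho y].

(** Matrices act on row vectors, so invariant subspaces are row spaces. *)
Definition stable_under m (rho : E -> 'M[k]_m) (U : 'M[k]_m) :=
  forall x, stablemx U (rho x).

Definition irreducible m (rho : E -> 'M[k]_m) :=
  forall U, stable_under rho U -> U = 0 \/ row_full U.

Lemma rep_sumZ m (rho : E -> 'M[k]_m) (I : finType) (c : I -> k) (x : I -> E) :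
  linear rho -> rho (\sum_i c i *: x i) = \sum_i c i *: rho (x i).
Proof.
move=> lr; pose f : {linear E -> 'M[k]_m} :=
  HB.pack rho (GRing.isLinear.Build k E 'M[k]_m *:%R _ lr).
rewrite -[LHS]/(f _) linear_sum; apply: eq_bigr => i _.
by rewrite linearZ.
Qed.

Lemma rep_sum m (rho : E -> 'M[k]_m) (I : finType) (x : I -> E) :
  linear rho -> rho (\sum_i x i) = \sum_i rho (x i).
Proof.
move=> lr; have := rep_sumZ (fun=> 1) x lr.
by under eq_bigr do rewrite scale1r; under [RHS]eq_bigr do rewrite scale1r.
Qed.

Lemma closed_eigenvalue n (A : 'M[k]_n) : (n > 0)%N ->
  exists a, eigenvalue A a.
Proof.
move=> n0; have /closed_rootP[a] : size (char_poly A) != 1%N.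
  by rewrite size_char_poly eqSS -lt0n.
by rewrite -eigenvalue_root_char; exists a.
Qed.

Lemma rank_factor m n (A : 'M[k]_(m, n)) :
  exists (C : 'M_(m, \rank A)) (B : 'M_(\rank A, n)),
    [/\ C *m B = A, row_full C, row_free B & (B :=: A)%MS].
Proof.
exists (col_base A), (row_base A); split; first exact: mulmx_base.
- exact: col_base_full.
- exact: row_base_free.
- exact: eq_row_base.
Qed.

Section Irreducible.
Variables (m : nat) (rho : E -> 'M[k]_m).
Hypotheses (repr : is_rep rho) (irr : irreducible rho).

Lemma irr_transitive (v w : 'rV[k]_m) : v != 0 -> exists x, v *m rho x = w.
Proof.
have [lr r1 rM] := repr; move=> v0.
pose U : 'M[k]_(dim E, m) := \matrix_i (v *m rho (vb i)).
have inU x : (v *m rho x <= U)%MS.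
  rewrite (vbE x) rep_sumZ // mulmx_sumr summx_sub // => i _.
  rewrite -scalemxAr scalemx_sub // (eq_row_sub i) // rowK //.
have stU : stable_under rho <<U>>%MS.
  move=> x; rewrite genmxE.
  rewrite (submx_trans (submxMr (rho x) (_ : (_ <= U)%MS))) ?genmxE //.
  apply/row_subP => i; rewrite row_mul rowK -mulmxA -rM; exact: inU.
case: (irr stU) => [U0|].
  have := inU 1; rewrite r1 mulmx1.
  have -> : U = 0 by apply/eqP; rewrite -mxrank_eq0 -(mxrank_gen U) U0 mxrank0.
  by move/submx0null/eqP; rewrite (negPf v0).
rewrite /row_full mxrank_gen => fU.
have /submxP[c ->] : (w <= U)%MS by apply: submx_full.
exists (\sum_i c 0 i *: vb i); rewrite rep_sumZ // mulmx_sumr.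
rewrite (mulmx_sum_row c U); apply: eq_bigr => i _.
by rewrite rowK -scalemxAr.
Qed.

(** A row vector that kills all the rho x *m c would, its orbit being
    everything, force c = 0. *)
Lemma irr_cotransitive (c d : 'cV[k]_m) : c != 0 -> exists x, rho x *m c = d.
Proof.
have [lr r1 rM] := repr; move=> c0.
pose U : 'M[k]_(m, dim E) := \matrix_(i, j) (rho (vb j) *m c) i 0.
have fU : row_free U.
  rewrite -kermx_eq0; apply/eqP/row_matrixP => i; rewrite row0.
  set v := row i _.
  have vU : v *m U = 0.
    by apply/sub_kermxP; rewrite row_sub.
  apply/eqP/negP => /negP v0; case/negP: c0; apply/eqP/matrixP => a b.
  have [x vx] := irr_transitive (delta_mx 0 a) v0.
  have -> : c a b = (v *m (rho x *m c)) 0 0.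
    rewrite mulmxA vx mxE (bigD1 a) //= !mxE !eqxx mul1r.
    rewrite big1 ?addr0 ?(ord1 b) //.
    by move=> j nj; rewrite mxE eqxx (negPf nj) mul0r.
  rewrite (vbE x) rep_sumZ // mulmx_suml mulmx_sumr summxE big1 ?mxE // => j _.
  rewrite -scalemxAl -scalemxAr mxE.
  have /matrixP/(_ 0 j) := vU; rewrite !mxE => vU'.
  rewrite [X in _ * X](_ : _ = 0) ?mulr0 // -[RHS]vU'.
  by apply: eq_bigr => l _; rewrite !mxE.
have : U *m (pinvmx U *m d) = d by rewrite mulmxA mulmxVp ?mul1mx.
move: (pinvmx U *m d) => e <-; exists (\sum_j e j 0 *: vb j).
rewrite rep_sumZ //; apply/matrixP => a b.
rewrite (ord1 b) mulmx_suml summxE [RHS]mxE.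
by apply: eq_bigr => j _; rewrite -scalemxAl !mxE mulrC.
Qed.

(** Let T = rho x have minimal nonzero rank.  If the rank exceeds 1, some
    T *m rho y *m T is not a multiple of T, while rho y *m T has an eigenvalue l
    on the row space of T; then T *m rho y *m T - l *: T is nonzero and of
    smaller rank. *)
Lemma irr_rank1 : (m > 0)%N -> exists x, \rank (rho x) = 1%N.
Proof.
have [lr r1 rM] := repr; move=> m0.
pose P r := `[< exists x, \rank (rho x) = r /\ (0 < r)%N >].
have exP : exists r, P r.
  by exists m; apply/asboolP; exists 1; rewrite r1 mxrank1.
case: (ex_minnP exP) => r /asboolP[x [rx r0]] minr.
exists x; apply/eqP; rewrite eqn_leq rx r0 andbT leqNgt; apply/negP => r2.
set T := rho x in rx; have [C [B [eT _ fB sBT]]] := rank_factor T.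
have Tr : (1 < \rank T)%N by rewrite rx.
pose i0 : 'I_(\rank T) := Ordinal (ltnW Tr).
pose i1 : 'I_(\rank T) := Ordinal Tr.
have sB i : exists v, v *m T = row i B.
  have /submxP[v ->] : (row i B <= T)%MS.
    by rewrite (submx_trans (row_sub _ _)) ?sBT.
  by exists v.
have [v0 e0] := sB i0; have [v1 e1] := sB i1.
have nz i : row i B != 0.
  apply/eqP => /(congr1 (fun v => v *m pinvmx B)).
  rewrite mul0mx -row_mul mulmxVp // => /matrixP /(_ 0 i).
  by rewrite !mxE eqxx; apply/eqP; rewrite oner_eq0.
have [y ey] := irr_transitive v1 (nz i0).
have /submxP[N eN] : (B *m rho y *m T <= B)%MS.
  by rewrite (submx_trans (submxMl _ _)) // sBT.
have [l /eigenvalueP[z zN z0]] := @closed_eigenvalue _ N (ltnW Tr).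
have eq1 : rho (x * y * x - l *: x) = C *m (N - l%:M) *m B.
  rewrite mulmxBr mulmxBl -(mulmxA _ N B) -eN !mulmxA eT.
  rewrite mul_mx_scalar -scalemxAl eT -[x * y * x - _]addrC -scaleNr lr !rM.
  by rewrite scaleNr addrC.
pose x2 := x * y * x - l *: x.
have lt : (\rank (rho x2) < r)%N.
  rewrite eq1 (leq_ltn_trans (mxrankM_maxl _ _)) //.
  rewrite (leq_ltn_trans (mxrankM_maxr _ _)) // -rx.
  rewrite ltn_neqAle rank_leq_row andbT.
  apply/negP; rewrite -/(row_free _) => fr; case/negP: z0.
  apply/eqP; apply: (row_free_inj fr) => /=.
  by rewrite mul0mx mulmxBr zN mul_mx_scalar subrr.
suff: P (\rank (rho x2)) by move/minr; rewrite leqNgt lt.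
apply/asboolP; exists x2; split=> //.
rewrite lt0n mxrank_eq0; apply/eqP => /(congr1 (mulmx v0)).
rewrite /x2 -[x * y * x - _]addrC -scaleNr lr !rM -/T.
rewrite mulmx0 mulmxDr -scalemxAr !mulmxA.
rewrite e0 ey e1 => /(congr1 (fun v => v *m pinvmx B)).
rewrite mul0mx mulmxDl -scalemxAl -!row_mul mulmxVp // => /matrixP /(_ 0 i1).
by rewrite !mxE eqxx /= mulr0 add0r; apply/eqP; rewrite oner_eq0.
Qed.

(** Multiplying an element of rank one on both sides yields, by transitivity
    on rows and on columns, every elementary matrix. *)
Lemma burnside (M : 'M[k]_m) : exists x, rho x = M.
Proof.
have [lr r1 rM] := repr.
case: (posnP m) => [m0|m0].
  by exists 0; apply/matrixP => i; move: (ltn_ord i); rewrite {2}m0.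
have [x rx] := irr_rank1 m0.
have [c' [b' [ecb c0 b0]]] : exists (c' : 'cV[k]_m) (b' : 'rV[k]_m),
    [/\ c' *m b' = rho x, c' != 0 & b' != 0].
  have [] := rank_factor (rho x); rewrite rx => c' [b' [ecb _ _ _]].
  exists c', b'; split=> //; apply/eqP => z0; move: rx;
    by rewrite -ecb z0 ?mul0mx ?mulmx0 mxrank0.
have delta i j : exists y, rho y = delta_mx i j.
  have [y ey] := irr_cotransitive (delta_mx i 0) c0.
  have [z ez] := irr_transitive (delta_mx 0 j) b0.
  exists (y * x * z); rewrite !rM -ecb !mulmxA ey -mulmxA ez mul_delta_mx //.
pose y i j := sval (cid (delta i j)).
exists (\sum_i \sum_j M i j *: y i j).
rewrite rep_sum // [RHS]matrix_sum_delta; apply: eq_bigr => i _.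
rewrite rep_sumZ //; apply: eq_bigr => j _.
by rewrite (svalP (cid (delta i j))).
Qed.

End Irreducible.

(** The two smaller representations are the one on U and the one on the
    quotient; rho is block triangular in a basis adapted to U. *)
Lemma rep_split m (rho : E -> 'M[k]_m) (U : 'M[k]_m) :
    is_rep rho -> stable_under rho U -> U <> 0 -> ~ row_full U ->
  exists m1 (rho1 : E -> 'M[k]_m1) m2 (rho2 : E -> 'M[k]_m2),
    [/\ (0 < m1 < m)%N, (m2 < m)%N, is_rep rho1, is_rep rho2
      & forall x, rho1 x \in unitmx -> rho2 x \in unitmx -> rho x \in unitmx].
Proof.
move=> [lr r1 rM] stU U0 fU.
have [_ [B [_ _ fB eB]]] := rank_factor U.
have [C [R [eC fC fR _]]] := rank_factor (cokermx U).
have [B' [BK B'K]] : exists B' : 'M_(m, \rank U), B *m B' = 1%:M /\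
    forall p (v : 'M_(p, m)), (v <= U)%MS -> v *m B' *m B = v.
  exists (pinvmx B); split; first exact: mulmxVp.
  by move=> p v vU; apply: mulmxKpV; rewrite eB.
have [C' CK] : exists C' : 'M_(\rank (cokermx U), m), C' *m C = 1%:M.
  by exists (pinvmx C); apply: mulVpmx.
have rk : (0 < \rank U < m)%N.
  rewrite lt0n mxrank_eq0 ltn_neqAle rank_leq_row andbT.
  by apply/andP; split; [apply/eqP | apply/negP].
have CU p (v : 'M_(p, m)) : v *m C = 0 -> (v <= U)%MS.
  by move=> vC; rewrite submxE -eC mulmxA vC mul0mx.
have UC p (v : 'M_(p, m)) : (v <= U)%MS -> v *m C = 0.
  move=> vU; apply: (row_free_inj fR) => /=.
  by rewrite mul0mx -mulmxA eC; apply/eqP; rewrite -submxE.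
have sub1 x : B *m rho x *m B' *m B = B *m rho x.
  by apply: B'K; apply: submx_trans (stU x); apply: submxMr; rewrite eB.
have sub2 x : C *m (C' *m (rho x *m C)) = rho x *m C.
  have sU : (1%:M - C *m C' <= U)%MS.
    by apply: CU; rewrite mulmxBl mul1mx -mulmxA CK mulmx1 subrr.
  have /eqP : (1%:M - C *m C') *m rho x *m C = 0.
    by apply: UC; apply: submx_trans (stU x); apply: submxMr.
  by rewrite !mulmxBl mul1mx subr_eq0 !mulmxA => /eqP.
exists (\rank U), (fun x => B *m rho x *m B').
exists (\rank (cokermx U)), (fun x => C' *m rho x *m C); split=> //.
- by rewrite mxrank_coker ltn_subrL; case/andP: rk => -> /(leq_ltn_trans _)->.
- split=> [a x y||x y].
  + by rewrite lr mulmxDr mulmxDl -scalemxAr -scalemxAl.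
  + by rewrite r1 mulmx1 BK.
  + by rewrite rM !mulmxA sub1.
- split=> [a x y||x y].
  + by rewrite lr mulmxDr mulmxDl -scalemxAr -scalemxAl.
  + by rewrite r1 mulmx1 CK.
  + by rewrite -!mulmxA sub2 rM !mulmxA.
move=> x u1 u2; rewrite -row_free_unit -kermx_eq0.
move: (kermx _) (mulmx_ker (rho x)) => v vx.
have vC : v *m C = 0.
  rewrite -[v *m C](mulmxK u2) [X in X *m _](_ : _ = 0) ?mul0mx //.
  by rewrite -!mulmxA sub2 mulmxA vx mul0mx.
have /submxP[w ew] : (v <= B)%MS by rewrite eB CU.
have : w *m (B *m rho x *m B') *m B = 0.
  by rewrite -mulmxA sub1 mulmxA -ew.
rewrite -[RHS](mul0mx _ B) => /(row_free_inj fB) wr.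
by rewrite ew -[w](mulmxK u1) wr !mul0mx.
Qed.

End Representations.

(** * Conjugacy of systems of matrix units *)

Section MatrixUnits.
Variables (k : closedFieldType) (n : nat).

Definition matrix_units (E : pzRingType) (e : 'I_n.+1 -> 'I_n.+1 -> E) :=
  (forall i j l p, e i j * e l p = e i p *+ (j == l)) /\ \sum_i e i i = 1.

(** The idempotents F i i are equivalent to each other, hence of equal rank,
    and their row spaces decompose the whole space. *)
Lemma mx_units_rank m (F : 'I_n.+1 -> 'I_n.+1 -> 'M[k]_m) :
  matrix_units F -> (n.+1 * \rank (F ord0 ord0))%N = m.
Proof.
move=> [FM' F1'].
have F1 : \sum_i F i i = 1%:M := F1'.
have FM i j l p : F i j *m F l p = F i p *+ (j == l) := FM' i j l p.
have rk i : \rank (F i i) = \rank (F ord0 ord0).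
  apply/eqP; rewrite eqn_leq; apply/andP; split.
    have -> : F i i = F i ord0 *m F ord0 ord0 *m F ord0 i.
      by rewrite !(FM, eqxx, mulr1n).
    by rewrite (leq_trans (mxrankM_maxl _ _)) // mxrankM_maxr.
  have -> : F ord0 ord0 = F ord0 i *m F i i *m F i ord0.
    by rewrite !(FM, eqxx, mulr1n).
  by rewrite (leq_trans (mxrankM_maxl _ _)) // mxrankM_maxr.
have dir : mxdirect (\sum_i F i i)%MS.
  apply/mxdirect_sumsP => i _; apply/eqP; rewrite -submx0.
  set V := (_ :&: _)%MS.
  have V1 : V *m F i i = V.
    have /submxP[c ec] : (V <= F i i)%MS by apply: capmxSl.
    by rewrite ec -mulmxA FM eqxx.
  have /sub_sumsmxP[c ec] : (V <= \sum_(j | j != i) F j j)%MS by apply: capmxSr.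
  rewrite -V1 ec mulmx_suml big1 ?sub0mx // => j nji.
  by rewrite -mulmxA FM (negPf nji) mulmx0.
have full : (1%:M <= \sum_i F i i)%MS.
  by rewrite -F1; apply: summx_sub_sums.
have /= := mxdirectP dir. under [X in _ = X -> _]eq_bigr do rewrite rk.
rewrite sum_nat_const card_ord => <-.
by apply/eqP; rewrite -[_ == m]/(row_full _) -sub1mx.
Qed.

(** By [mx_units_rank] the idempotents F 0 0 and G 0 0 have the same rank, so
    they are p *m q and q *m p for suitable p and q, and
    \sum_i F i 0 *m p *m G 0 i is an invertible intertwiner. *)
Lemma mx_units_conj m (F G : 'I_n.+1 -> 'I_n.+1 -> 'M[k]_m) :
    matrix_units F -> matrix_units G ->
  exists2 w, w \in unitmx & forall i j, F i j *m w = w *m G i j.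
Proof.
move=> uF uG; have [[FM' F1'] [GM' _]] := (uF, uG).
have F1 : \sum_i F i i = 1%:M := F1'.
have FM i j l p : F i j *m F l p = F i p *+ (j == l) := FM' i j l p.
have GM i j l p : G i j *m G l p = G i p *+ (j == l) := GM' i j l p.
have erk : \rank (F ord0 ord0) = \rank (G ord0 ord0).
  by apply/eqP; rewrite -(eqn_pmul2l (ltn0Sn n)) !mx_units_rank.
have idem (e : 'M[k]_m) : e *m e = e ->
    exists C B, C *m B = e /\ B *m C = 1%:M :> 'M_(\rank e).
  move=> ee; have [C [B [eCB fC fB _]]] := rank_factor e.
  exists C, B; split=> //; apply: (row_full_inj fC) => /=.
  by apply: (row_free_inj fB) => /=; rewrite mulmx1 mulmxA eCB -mulmxA eCB.
have [|C1 [B1 [CB1 BC1]]] := idem (F ord0 ord0); first by rewrite FM eqxx.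
have [|C2 [B2 [CB2 BC2]]] := idem (G ord0 ord0); first by rewrite GM eqxx.
have [p [q [pq qp pG qF]]] : exists p q, [/\ p *m q = F ord0 ord0,
    q *m p = G ord0 ord0, p *m G ord0 ord0 = p & q *m F ord0 ord0 = q].
  move: C1 B1 CB1 BC1 C2 B2 CB2 BC2; rewrite -erk.
  move: (\rank _) => r C1 B1 CB1 BC1 C2 B2 CB2 BC2.
  exists (C1 *m B2), (C2 *m B1); rewrite -CB1 -CB2.
  split; rewrite !mulmxA.
  - by rewrite -[C1 *m B2 *m C2]mulmxA BC2 mulmx1.
  - by rewrite -[C2 *m B1 *m C1]mulmxA BC1 mulmx1.
  - by rewrite -[C1 *m B2 *m C2]mulmxA BC2 mulmx1.
  - by rewrite -[C2 *m B1 *m C1]mulmxA BC1 mulmx1.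
pose w := \sum_i F i ord0 *m p *m G ord0 i.
pose w' := \sum_i G i ord0 *m q *m F ord0 i.
have ww' : w *m w' = 1%:M.
  rewrite mulmx_suml -F1; apply: eq_bigr => i _.
  rewrite mulmx_sumr (bigD1 i) //= big1 ?addr0 => [|j nji].
    rewrite !mulmxA -[_ *m G ord0 i *m G i ord0]mulmxA GM eqxx mulr1n.
    rewrite -[F _ _ *m p *m G _ _]mulmxA pG -[F _ _ *m p *m q]mulmxA pq.
    by rewrite !(FM, eqxx, mulr1n).
  rewrite !mulmxA -[_ *m G ord0 i *m G j ord0]mulmxA GM eq_sym (negPf nji).
  by rewrite mulmx0 !mul0mx.
exists w; first by case/mulmx1_unit: ww'.
move=> i j; rewrite mulmx_sumr mulmx_suml (bigD1 j) //= big1 => [|l nl].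
  rewrite [RHS](bigD1 i) //= [X in _ = _ + X]big1 => [|l nl].
    rewrite !mulmxA FM eqxx -[_ *m G ord0 i *m _]mulmxA GM eqxx //.
  by rewrite -[_ *m G _ _ *m _]mulmxA GM (negPf nl) mulmx0.
by rewrite !mulmxA FM eq_sym (negPf nl) !mul0mx.
Qed.

End MatrixUnits.

(** The determinants are polynomials in t, the first nonzero at t = 0 and the
    second at t = 1, so their product has a nonroot. *)
Lemma det_pencil_generic (k : closedFieldType) m1 m2
    (a1 b1 : 'M[k]_m1) (a2 b2 : 'M[k]_m2) :
    a1 \in unitmx -> b2 \in unitmx ->
  exists t, a1 + t *: (b1 - a1) \in unitmx /\ a2 + t *: (b2 - a2) \in unitmx.
Proof.
move=> u1 u2.
pose P m (a b : 'M[k]_m) := \det (map_mx polyC a + 'X *: map_mx polyC (b - a)).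
have PE m (a b : 'M[k]_m) t : (P m a b).[t] = \det (a + t *: (b - a)).
  rewrite -[_.[t]]/(horner_eval t _) -det_map_mx; congr (\det _).
  apply/matrixP => i j; rewrite !mxE /= /horner_eval;
 by rewrite !hornerE.
have n1 : P _ a1 b1 != 0.
  apply: contraTneq u1 => P0; rewrite unitmxE -[a1]addr0.
  by rewrite -(scale0r (b1 - a1)) -PE P0 horner0 unitr0.
have n2 : P _ a2 b2 != 0.
  apply: contraTneq u2 => P0; rewrite unitmxE.
  by rewrite -[b2](subrK a2) addrC -[b2 - a2]scale1r -PE P0 horner0 unitr0.
have /closed_nonrootP[t] : P _ a1 b1 * P _ a2 b2 != 0 by rewrite mulf_neq0.
rewrite rootM negb_or /root !PE => /andP[t1 t2].
by exists t; rewrite !unitmxE !unitfE.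
Qed.

Section SkolemNoether.
Variables (k : closedFieldType) (E : falgType k) (n : nat).

Lemma rep_units m (rho : E -> 'M[k]_m) (e : 'I_n.+1 -> 'I_n.+1 -> E) :
  is_rep rho -> matrix_units e -> matrix_units (fun i j => rho (e i j)).
Proof.
move=> [lr r1 rM] [eM e1]; split=> [i j l p|].
  rewrite -[LHS]/(rho (e i j) *m rho (e l p)) -rM eM.
  case: eqP => _; rewrite ?mulr1n // !mulr0n.
  by have := lr (-1) 0 0; rewrite scaler0 addr0 scaleN1r addNr.
by rewrite -rep_sum // e1 r1.
Qed.

(** An irreducible rho is onto, so the conjugating matrix given by
    [mx_units_conj] lifts to E, and is turned into an intertwiner by summing
    over matrix units.  A reducible rho is handled by a generic combination of
    the intertwiners for its two pieces. *)
Lemma units_conj_rep (f g : 'I_n.+1 -> 'I_n.+1 -> E) :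
    matrix_units f -> matrix_units g ->
  forall m (rho : E -> 'M[k]_m), is_rep rho ->
  exists u, (forall i j, f i j * u = u * g i j) /\ rho u \in unitmx.
Proof.
move=> uf ug; elim/ltn_ind=> m IH rho repr.
have [irr|/existsNP[U /not_implyP[stU /not_orP[U0 fU]]]] :=
  EM (irreducible rho).
  have [w uw wP] := mx_units_conj (rep_units repr uf) (rep_units repr ug).
  have [x xw] := burnside repr irr w.
  have [lr r1 rM] := repr; have [[fM f1] [gM g1]] := (uf, ug).
  exists (\sum_i f i ord0 * x * g ord0 i); split.
    move=> i j; rewrite mulr_sumr mulr_suml (bigD1 j) //= big1 => [|l nl].
      rewrite [RHS](bigD1 i) //= [X in _ = _ + X]big1 => [|l nl].
        by rewrite !mulrA fM eqxx -[_ * g ord0 i * _]mulrA gM eqxx.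
      by rewrite -[_ * g _ _ * _]mulrA gM (negPf nl) mulr0.
    by rewrite !mulrA fM eq_sym (negPf nl) !mul0r.
  rewrite rep_sum //; under eq_bigr do rewrite !rM xw wP -mulmxA -rM gM eqxx.
  by rewrite -mulmx_sumr -rep_sum // g1 r1 mulmx1.
have [m1 [r1 [m2 [r2 [/andP[_ l1] l2 rep1 rep2 H]]]]] :=
  rep_split repr stU U0 fU.
have [u1 [f1 v1]] := IH _ l1 _ rep1; have [u2 [f2 v2]] := IH _ l2 _ rep2.
have [t [t1 t2]] := det_pencil_generic (r1 u2) (r2 u1) v1 v2.
have pen p (r : E -> 'M[k]_p) : is_rep r ->
    r (t *: (u2 - u1) + u1) = r u1 + t *: (r u2 - r u1).
  move=> [lr _ _]; rewrite lr addrC; congr (_ + _ *: _).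
  by rewrite -[u2 - u1]addrC -scaleN1r lr scaleN1r addrC.
exists (t *: (u2 - u1) + u1); split; last by apply: H; rewrite pen.
move=> i j; rewrite mulrDr mulrDl -scalerAr -scalerAl mulrBr mulrBl.
by rewrite f1 f2.
Qed.

Definition regular_rep (x : E) : 'M[k]_(dim E) :=
  lin1_mx (v2r \o amulr x \o r2v).

Lemma regular_repE x v : v *m regular_rep x = v2r (r2v v * x).
Proof. by rewrite mul_rV_lin1 /= lfunE. Qed.

Lemma regular_repP : is_rep regular_rep.
Proof.
split=> [a x y||x y].
- apply/row_matrixP => i; rewrite !rowE mulmxDr -scalemxAr !regular_repE.
  by rewrite mulrDr linearD /= -scalerAr linearZ.
- by apply/row_matrixP => i; rewrite !rowE regular_repE mulr1 r2vK mulmx1.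
- apply/row_matrixP => i; rewrite !rowE mulmxA !regular_repE v2rK.
  by rewrite mulrA.
Qed.

Lemma regular_rep_unit u : regular_rep u \in unitmx -> u \is a GRing.unit.
Proof.
move=> uu; pose v := r2v (v2r 1 *m invmx (regular_rep u)).
have vu : v * u = 1.
  by apply: v2r_inj; rewrite -regular_repE mulmxKV.
apply/unitrP; exists v; split=> //; apply: v2r_inj.
apply: (row_free_inj (_ : row_free (regular_rep u))).
  by rewrite row_free_unit.
by rewrite /= !regular_repE !v2rK -mulrA vu mulr1 mul1r.
Qed.

(** On each composition factor of the regular module both systems have the
    same multiplicity, which is why E may be any finite-dimensional algebra. *)
Theorem units_conj (f g : 'I_n.+1 -> 'I_n.+1 -> E) :
    matrix_units f -> matrix_units g ->
  exists2 u, u \is a GRing.unit & forall i j, f i j * u = u * g i j.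
Proof.
move=> uf ug.
have [u [fu /regular_rep_unit]] := units_conj_rep uf ug regular_repP.
by exists u.
Qed.

End SkolemNoether.

(** * Simple algebras over an algebraically closed field *)

Definition ideal (k : fieldType) (A : falgType k) (I : {vspace A}) :=
  forall a x, x \in I -> a * x \in I /\ x * a \in I.

Definition simple_algebra (k : fieldType) (A : falgType k) :=
  forall I : {vspace A}, ideal I -> I = 0%VS \/ I = fullv.

Section Wedderburn.
Variables (k : closedFieldType) (A : falgType k).

Lemma exists_irreducible_rep :
  exists m (rho : A -> 'M[k]_m), [/\ (0 < m)%N, is_rep rho & irreducible rho].
Proof.
suff H m : forall rho : A -> 'M[k]_m, (0 < m)%N -> is_rep rho ->
    exists m' (rho' : A -> 'M[k]_m'),
      [/\ (0 < m')%N, is_rep rho' & irreducible rho'].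
  by apply: H (@regular_rep k A) (FalgType_proper A) (@regular_repP k A).
elim/ltn_ind: m => m IH rho m0 repr.
have [irr|/existsNP[U /not_implyP[stU /not_orP[U0 fU]]]] :=
  EM (irreducible rho).
  by exists m, rho.
have [m1 [r1 [_ [_ [/andP[m10 l1] _ rep1 _ _]]]]] := rep_split repr stU U0 fU.
exact: IH l1 r1 m10 rep1.
Qed.

Hypothesis simA : simple_algebra A.

(** An irreducible representation of A is faithful because A is simple, and
    onto by [burnside]. *)
Lemma simple_matrix_units :
  exists n (e : 'I_n.+1 -> 'I_n.+1 -> A), matrix_units e /\
    forall a, exists c : 'I_n.+1 -> 'I_n.+1 -> k,
      a = \sum_i \sum_j c i j *: e i j.
Proof.
have [m [rho [m0 repr irr]]] := exists_irreducible_rep.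
case: m m0 rho repr irr => // n _ rho repr irr.
have [lr r1 rM] := repr; have onto := burnside repr irr.
pose rhoL : {linear A -> 'M[k]_n.+1} :=
  HB.pack rho (GRing.isLinear.Build k A 'M[k]_n.+1 *:%R _ lr).
have injr x y : rho x = rho y -> x = y.
  move=> rxy; pose I := lker (linfun rhoL).
  have memI z : (z \in I) = (rho z == 0) by rewrite memv_ker lfunE.
  have idI : ideal I.
    move=> a z; rewrite !memI !rM => /eqP->.
    by rewrite mul0mx mulmx0 eqxx.
  case: (simA idI) => I0.
    have : x - y \in I.
      by rewrite memI -[rho _]/(rhoL (x - y)) linearB /= rxy subrr.
    by rewrite I0 memv0 subr_eq0 => /eqP.
  have : 1 \in I by rewrite I0 memvf.
  by rewrite memI r1 oner_eq0.
have delta i j : exists x, rho x = delta_mx i j by apply: onto.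
pose e i j := sval (cid (delta i j)).
have eE i j : rho (e i j) = delta_mx i j by apply: (svalP (cid (delta i j))).
exists n, e; split; first split.
- move=> i j l p; apply: injr; rewrite rM !eE.
  have [->|njl] := eqVneq j l; first by rewrite mul_delta_mx mulr1n eE.
  by rewrite mul_delta_mx_0 // mulr0n -[RHS]/(rhoL 0) linear0.
- apply: injr; rewrite rep_sum // r1 [RHS]matrix_sum_delta.
  apply: eq_bigr => i _; rewrite eE (bigD1 i) //= mxE eqxx scale1r.
  rewrite big1 ?addr0 // => j nji.
  by rewrite mxE eq_sym (negPf nji) scale0r.
- move=> a; exists (fun i j => rho a i j); apply: injr.
  rewrite rep_sum // [LHS]matrix_sum_delta; apply: eq_bigr => i _.
  by rewrite rep_sumZ //; apply: eq_bigr => j _; rewrite eE.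
Qed.

(** If c is an eigenvalue of the multiplication by z, the annihilator of the
    central element z - c is a nonzero ideal. *)
Lemma simple_center (z : A) :
  (forall a, a * z = z * a) -> exists c : k, z = c%:A.
Proof.
move=> zC; have [c /eigenvalueP[v vz v0]] :=
  closed_eigenvalue (regular_rep z) (FalgType_proper A).
exists c; pose I := lker (amulr (z - c%:A)).
have memI x : (x \in I) = (x * (z - c%:A) == 0) by rewrite memv_ker lfunE.
have zcC a : a * (z - c%:A) = (z - c%:A) * a.
  by rewrite mulrBr mulrBl zC -scalerAr -scalerAl mulr1 mul1r.
have idI : ideal I.
  move=> a x; rewrite !memI => /eqP x0.
  by rewrite -!mulrA x0 zcC mulrA x0 mul0r mulr0 eqxx.
case: (simA idI) => I0.
  case/negP: v0; have : r2v v \in I.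
    rewrite memI; apply/eqP/v2r_inj; rewrite mulrBr -scalerAr mulr1 linearB /=.
    by rewrite -regular_repE vz linearZ /= r2vK linear0 subrr.
  by rewrite I0 memv0 => /eqP/(congr1 v2r); rewrite r2vK linear0 => ->.
have : 1 \in I by rewrite I0 memvf.
by rewrite memI mul1r subr_eq0 => /eqP.
Qed.

Lemma simple_conj (E : falgType k) (f g : {linear A -> E}) :
    f 1 = 1 -> g 1 = 1 -> {morph f : x y / x * y} -> {morph g : x y / x * y} ->
  exists2 u, u \is a GRing.unit & forall a, f a * u = u * g a.
Proof.
move=> f1 g1 fM gM; have [n [e [[eM e1] eS]]] := simple_matrix_units.
have mu (h : {linear A -> E}) : h 1 = 1 -> {morph h : x y / x * y} ->
    matrix_units (fun i j => h (e i j)).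
  move=> h1 hM; split=> [i j l p|]; last by rewrite -linear_sum e1.
  by rewrite -hM eM linearMn.
have [u uu uP] := units_conj (mu f f1 fM) (mu g g1 gM).
exists u => // a; have [c ->] := eS a.
rewrite !linear_sum mulr_suml mulr_sumr; apply: eq_bigr => i _ /=.
rewrite !linear_sum mulr_suml mulr_sumr; apply: eq_bigr => j _ /=.
by rewrite !linearZ /= -scalerAl -scalerAr uP.
Qed.

End Wedderburn.

(** * Tensors and functionals *)

Lemma tpureZl (k : fieldType) (U V : vectType k) c (u : U) (v : V) :
  (c *: u) ⊗ v = c *: (u ⊗ v).
Proof. exact: bilinZl (tpure_bilin U V) c u v. Qed.

Lemma tpureZr (k : fieldType) (U V : vectType k) c (u : U) (v : V) :
  u ⊗ (c *: v) = c *: (u ⊗ v).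
Proof. exact: bilinZr (tpure_bilin U V) c u v. Qed.

Lemma dual_separates (k : fieldType) (V : vectType k) (v : V) :
  (forall a : dual V, a v = 0) -> v = 0.
Proof.
move=> a0; apply: v2r_inj; apply/rowP => i; rewrite linear0 mxE.
have ls : scalar (fun u : V => v2r u 0 i) by move=> l x y; rewrite linearP !mxE.
by rewrite -(mkdualE ls) a0.
Qed.

Lemma dualZ (k : fieldType) (V : vectType k) c (a : dual V) x :
  dual_app (c *: a) x = c * a x.
Proof. by rewrite /dual_app scale_lfunE. Qed.

Definition dual_basis (k : fieldType) (V : vectType k) (i : 'I_(dim V)) :
  dual V := mkdual (fun w => v2r w 0 i).

Lemma dual_basisE (k : fieldType) (V : vectType k) i (w : V) :
  dual_basis i w = v2r w 0 i.
Proof. by rewrite mkdualE // => l x y; rewrite linearP !mxE. Qed.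

Lemma bilin_form_tensor (k : fieldType) (U V : vectType k) (B : U -> V -> k) :
    (forall v, scalar (B^~ v)) -> (forall u, scalar (B u)) ->
  exists c : tens (dual U) (dual V), forall u v, tpair c u v = B u v.
Proof.
move=> lB rB.
exists (\sum_i \sum_j B (vb i) (vb j) *: (dual_basis i ⊗ dual_basis j)) => u v.
rewrite {2}(vbE u) (scalar_comb (lB v)) /tpair linear_sum.
apply: eq_bigr => i _.
rewrite {2}(vbE v) (scalar_comb (rB (vb i))) linear_sum mulr_sumr /=.
apply: eq_bigr => j _; rewrite linearZ /= -/(tpair _ _ _) tpair_pure.
by rewrite !dual_basisE /GRing.scale /=; ring.
Qed.

Lemma dual_app_tlift (k : fieldType) (U V W : vectType k)
    (B : U -> V -> dual W) t w :
  dual_app (tlift B t) w = tlift (fun u v => dual_app (B u v) w : k^o) t.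
Proof.
rewrite /dual_app /tlift sum_lfunE; apply: eq_bigr => i _.
by rewrite sum_lfunE; apply: eq_bigr => j _; rewrite scale_lfunE.
Qed.

Lemma scalarZ_fun (k : fieldType) (V : lmodType k) (f : V -> k) a x :
  scalar f -> f (a *: x) = a * f x.
Proof.
move=> lf; have := scalar_comb lf (fun=> a) (fun _ : 'I_1 => x).
by rewrite !big_ord1.
Qed.

Lemma scalar_tlift (k : fieldType) (U V : vectType k) (W : lmodType k)
    (B : U -> V -> W) (f : W -> k) t :
  scalar f -> f (tlift B t) = tlift (fun u v => f (B u v) : k^o) t.
Proof.
move=> lf; rewrite /tlift.
have f0 : f 0 = 0 by have := scalarZ_fun 0 0 lf; rewrite scaler0 mul0r.
have fD : {morph f : x y / x + y}.
  by move=> x y; have := lf 1 x y; rewrite scale1r mul1r.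
rewrite (big_morph f fD f0); apply: eq_bigr => i _.
rewrite (big_morph f fD f0); apply: eq_bigr => j _.
exact: scalarZ_fun.
Qed.

Section TliftExtra.
Variable k : fieldType.

Lemma tlift_exchange (U V U' V' : vectType k) (W : lmodType k)
    (F : U -> V -> U' -> V' -> W) s t :
  tlift (fun u v => tlift (F u v) t) s =
  tlift (fun x y => tlift (fun u v => F u v x y) s) t.
Proof.
rewrite /tlift.
transitivity (\sum_i \sum_j \sum_i' \sum_j'
  (s i j * t i' j') *: F (vb i) (vb j) (vb i') (vb j')).
  apply: eq_bigr => i _; apply: eq_bigr => j _; rewrite scaler_sumr.
  apply: eq_bigr => i' _; rewrite scaler_sumr; apply: eq_bigr => j' _.
  by rewrite scalerA.
under eq_bigr do rewrite exchange_big /=; rewrite exchange_big /=.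
apply: eq_bigr => i' _; under eq_bigr do rewrite exchange_big /=.
rewrite exchange_big /=; apply: eq_bigr => j' _; rewrite scaler_sumr.
apply: eq_bigr => i _; rewrite scaler_sumr; apply: eq_bigr => j _.
by rewrite scalerA mulrC.
Qed.

Lemma tlift_mull (U V : vectType k) (A : falgType k) (B : U -> V -> A) t a :
  tlift B t * a = tlift (fun u v => B u v * a) t.
Proof.
rewrite /tlift mulr_suml; apply: eq_bigr => i _.
by rewrite mulr_suml; apply: eq_bigr => j _; rewrite scalerAl.
Qed.

End TliftExtra.

Section TensorMaps.
Variable k : fieldType.

HB.instance Definition _ (U U' V V' : vectType k) (f : U -> U') (g : V -> V') :=
  GRing.isLinear.Build k (tens U V) (tens U' V') *:%R (tmap f g) (tmapP f g).

Lemma tmapM (A A' B B' : falgType k)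
    (f : {linear A -> A'}) (g : {linear B -> B'}) :
    {morph f : x y / x * y} -> {morph g : x y / x * y} ->
  {morph tmap f g : s t / s * t}.
Proof.
move=> fM gM; elim/tens_ind=> [a b|l s s' IH IH' t]; last first.
  by rewrite mulrDl -scalerAl !tmapP IH IH' mulrDl scalerAl.
elim/tens_ind=> [a' b'|l t t' IH IH']; last first.
  by rewrite mulrDr -scalerAr !tmapP IH IH' mulrDr scalerAr.
by rewrite tpureM !tmap_pure tpureM fM gM.
Qed.

Lemma tmapK (U U' V V' : vectType k)
    (f : {linear U -> U'}) (g : {linear V -> V'})
    (f' : {linear U' -> U}) (g' : {linear V' -> V}) :
  cancel f f' -> cancel g g' -> cancel (tmap f g) (tmap f' g').
Proof.
move=> fK gK; elim/tens_ind=> [u v|l s t IH IH'].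
  by rewrite !tmap_pure fK gK.
by rewrite !tmapP IH IH'.
Qed.

End TensorMaps.

(** * Linear bijections and regular elements in finite dimension *)

Section LinearBijections.
Variables (k : fieldType) (U V : vectType k).
Hypothesis dUV : dim U = dim V.

Lemma hom_inj_surj (f : 'Hom(U, V)) : injective f <-> limg f = fullv.
Proof.
have dimE := limg_ker_dim f fullv; rewrite !dimvf in dimE.
split=> [/lker0P/eqP k0|im].
  apply/eqP; rewrite eqEdim subvf dimvf -dUV -dimE k0.
  by rewrite capv0 dimv0; apply: leqnn.
have /lker0P // : lker f == 0%VS.
rewrite -dimv_eq0; move: dimE; rewrite im capfv dimvf dUV => /eqP.
by rewrite -[eqbRHS]add0n eqn_add2r.
Qed.

End LinearBijections.

Lemma dim_dual (k : fieldType) (V : vectType k) : dim V = dim (dual V).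
Proof. by rewrite /dual -[RHS]/(dim V * dim k^o)%N -[dim k^o]/1%N muln1. Qed.

Lemma linear_bij_inverse (k : fieldType) (U V : vectType k) (f : U -> V) :
    dim U = dim V -> linear f -> injective f ->
  exists g : V -> U, [/\ linear g, cancel f g & cancel g f].
Proof.
move=> dUV lf fi; pose fL : {linear U -> V} :=
  HB.pack f (GRing.isLinear.Build k U V *:%R _ lf).
pose F : 'Hom(U, V) := linfun fL.
have FE x : F x = f x by rewrite lfunE.
have Fi : injective F by move=> x y; rewrite !FE => /fi.
have /lker0P F0 := Fi.
exists (F^-1)%VF; split=> [a x y|x|y]; first by rewrite linearP.
  by rewrite -FE lker0_lfunK.
have /(hom_inj_surj dUV) im := Fi.
by rewrite -FE limg_lfunVK // im memvf.
Qed.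

Lemma regular_unit (k : fieldType) (E : falgType k) (c : E) :
  (forall y, c * y = 0 -> y = 0) -> c \is a GRing.unit.
Proof.
move=> reg; have inj : injective (amull c).
  move=> x y; rewrite !lfunE /= => /eqP; rewrite -subr_eq0 -mulrBr => /eqP/reg.
  by move/eqP; rewrite subr_eq0 => /eqP.
have /hom_inj_surj im := inj.
have /memv_imgP[v _] : 1 \in limg (amull c) by rewrite im // memvf.
rewrite lfunE /= => cv; apply/unitrP; exists v; split=> //.
apply/eqP; rewrite -subr_eq0; apply/eqP/reg.
by rewrite mulrBr mulrA -cv mulr1 mul1r subrr.
Qed.

(** * Convolution algebras *)

(** A name of its own for Hom(X, A), to carry the convolution product. *)
Definition conv (k : fieldType) (X : nzCoalgType k) (A : falgType k) : Type :=
  'Hom(X, A).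

HB.instance Definition _ (k : fieldType) (X : nzCoalgType k) (A : falgType k) :=
  Vector.copy (conv X A) 'Hom(X, A).

Definition conv_app (k : fieldType) (X : nzCoalgType k) (A : falgType k)
  (f : conv X A) : X -> A := fun_of_lfun (f : 'Hom(X, A)).
Coercion conv_app : conv >-> Funclass.

Section Convolution.
Variables (k : fieldType) (X : nzCoalgType k) (A : falgType k).
Implicit Types f g l : conv X A.

Fact conv_app_is_linear f : linear (conv_app f).
Proof. by move=> c x y; rewrite /conv_app linearP. Qed.
HB.instance Definition _ f := GRing.isLinear.Build k X A *:%R (conv_app f)
  (conv_app_is_linear f).

Lemma conv_ext f g : conv_app f =1 conv_app g -> f = g.
Proof. by move=> fg; apply/lfunP. Qed.

Lemma convP c f g x : conv_app (c *: f + g) x = c *: f x + g x.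
Proof. by rewrite /conv_app add_lfunE scale_lfunE. Qed.

Lemma convZ c f x : conv_app (c *: f) x = c *: f x.
Proof. by rewrite /conv_app scale_lfunE. Qed.

Definition mkconv (f : X -> A) : conv X A := linfun f.

Lemma mkconvE (f : X -> A) : linear f -> mkconv f =1 f.
Proof.
move=> lf x; pose F : {linear X -> A} :=
  HB.pack f (GRing.isLinear.Build k X A *:%R _ lf).
by rewrite /mkconv /conv_app -[f]/(F : X -> A) lfunE.
Qed.

Lemma conv_bilin f g : bilin (fun x y => f x * g y).
Proof.
by split=> w c x y; rewrite linearP /= ?mulrDl ?mulrDr -?scalerAl -?scalerAr.
Qed.

Definition cmul f g : conv X A :=
  mkconv (fun x => tlift (fun y z => f y * g z) (comul x)).
(** The constants of the convolution algebra: A embeds in it by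
    a |-> (x |-> counit x *: a). *)
Definition conv_const (a : A) : conv X A :=
  mkconv (fun x => (counit x : k) *: a).

Lemma cmulE f g x : cmul f g x = tlift (fun y z => f y * g z) (comul x).
Proof. by rewrite mkconvE // => c u v; rewrite !linearP. Qed.

Lemma conv_constE a x : conv_const a x = (counit x : k) *: a.
Proof. by rewrite mkconvE // => c u v; rewrite linearP scalerDl scalerA. Qed.

Fact cmulPl c f f' g : cmul (c *: f + f') g = c *: cmul f g + cmul f' g.
Proof.
apply: conv_ext => x; rewrite convP !cmulE -tliftPB; apply: eq_tlift => u v.
by rewrite convP mulrDl scalerAl.
Qed.

Fact cmulPr c f g g' : cmul f (c *: g + g') = c *: cmul f g + cmul f g'.
Proof.
apply: conv_ext => x; rewrite convP !cmulE -tliftPB; apply: eq_tlift => u v.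
by rewrite convP mulrDr scalerAr.
Qed.

Fact cmulA : associative cmul.
Proof.
move=> f g l; apply: conv_ext => x; rewrite !cmulE.
pose F (t : tens X (tens X X)) : A :=
  tlift (fun x yz => f x * tlift (fun y z => g y * l z) yz) t.
have FP c s t : F (c *: s + t) = c *: F s + F t by rewrite /F linearP.
have Fp u t : F (u ⊗ t) = f u * tlift (fun y z => g y * l z) t.
  rewrite /F tlift_pure //.
  by split=> w c y z; rewrite linearP /= ?mulrDl ?mulrDr -?scalerAl -?scalerAr.
transitivity (F (tmap idfun comul (comul x))).
  elim/tens_ind: (comul x) => [u v|c s t IH IH'].
    by rewrite (tlift_pure _ _ (conv_bilin _ _)) tmap_pure Fp cmulE.
  by rewrite tmapP FP linearP /= IH IH'.
rewrite -comulA; elim/tens_ind: (comul x) => [u v|c s t IH IH']; last first.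
  by rewrite tmapP tassocP FP linearP /= IH IH'.
rewrite (tlift_pure _ _ (conv_bilin _ _)) tmap_pure /= cmulE.
elim/tens_ind: (comul u) => [a b|c s t IH IH'].
  by rewrite tassoc_pure Fp !(tlift_pure _ _ (conv_bilin _ _)) mulrA.
by rewrite tpurePl tassocP FP IH IH' linearP /= mulrDl scalerAl.
Qed.

Lemma cmul_cstl a f x : cmul (conv_const a) f x = a * f x.
Proof.
rewrite cmulE -[in RHS](comul_counitl x).
elim/tens_ind: (comul x) => [u v|c s t IH IH']; last first.
  by rewrite !linearP /= IH IH' mulrDr scalerAr.
rewrite (tlift_pure _ _ (conv_bilin _ _)) conv_constE tlift_pure.
  by rewrite linearZ /= -scalerAl -scalerAr.
split=> w l y z; first by rewrite linearP scalerDl scalerA.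
by rewrite scalerDr !scalerA mulrC.
Qed.

Lemma cmul_cstr a f x : cmul f (conv_const a) x = f x * a.
Proof.
rewrite cmulE -[in RHS](comul_counitr x).
elim/tens_ind: (comul x) => [u v|c s t IH IH']; last first.
  by rewrite !linearP /= IH IH' mulrDl scalerAl.
rewrite (tlift_pure _ _ (conv_bilin _ _)) conv_constE tlift_pure.
  by rewrite linearZ /= -scalerAl -scalerAr.
split=> w l y z; last by rewrite linearP scalerDl scalerA.
by rewrite scalerDr !scalerA mulrC.
Qed.

Fact cmul1x : left_id (conv_const 1) cmul.
Proof. by move=> f; apply: conv_ext => x; rewrite cmul_cstl mul1r. Qed.

Fact cmulx1 : right_id (conv_const 1) cmul.
Proof. by move=> f; apply: conv_ext => x; rewrite cmul_cstr mulr1. Qed.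

Fact cmulDl : left_distributive cmul +%R.
Proof. by move=> s t u; have := cmulPl 1 s t u; rewrite !scale1r. Qed.

Fact cmulDr : right_distributive cmul +%R.
Proof. by move=> s t u; have := cmulPr 1 s t u; rewrite !scale1r. Qed.

Fact cone_neq0 : conv_const 1 != 0.
Proof.
have [c nc] := @counit_neq0 k X; apply: contraNneq nc => d0.
have := conv_constE 1 c; rewrite d0 /conv_app zero_lfunE => /esym/eqP.
by rewrite scaler_eq0 oner_eq0 orbF.
Qed.

HB.instance Definition _ := GRing.Zmodule_isNzRing.Build (conv X A)
  cmulA cmul1x cmulx1 cmulDl cmulDr cone_neq0.

Fact conv_scaleAl (c : k) f g : c *: (f * g) = c *: f * g.
Proof.
have g0 : cmul 0 g = 0 by apply: (@mul0r (conv X A)).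
by have := cmulPl c f 0 g; rewrite g0 !addr0.
Qed.
HB.instance Definition _ := GRing.Lmodule_isLalgebra.Build k (conv X A)
  conv_scaleAl.

Fact conv_scaleAr (c : k) f g : c *: (f * g) = f * (c *: g).
Proof.
have f0 : cmul f 0 = 0 by apply: (@mulr0 (conv X A)).
by have := cmulPr c f g 0; rewrite f0 !addr0.
Qed.
HB.instance Definition _ := GRing.Lalgebra_isAlgebra.Build k (conv X A)
  conv_scaleAr.
HB.instance Definition _ := Algebra_isFalgebra.Build k (conv X A).

Lemma convME f g x :
  conv_app (f * g) x = tlift (fun y z => f y * g z) (comul x).
Proof. exact: cmulE. Qed.
Lemma conv1E x : conv_app (1 : conv X A) x = (counit x : k) *: 1.
Proof. exact: conv_constE. Qed.
Lemma convM_cstl a f x : conv_app (conv_const a * f) x = a * f x.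
Proof. exact: cmul_cstl. Qed.
Lemma convM_cstr a f x : conv_app (f * conv_const a) x = f x * a.
Proof. exact: cmul_cstr. Qed.

Fact cst_is_linear : linear conv_const.
Proof.
move=> c a b; apply: conv_ext => x; rewrite convP !conv_constE.
by rewrite scalerDr !scalerA mulrC.
Qed.
HB.instance Definition _ := GRing.isLinear.Build k A (conv X A) *:%R conv_const
  cst_is_linear.

Lemma conv_const1 : conv_const 1 = 1. Proof. by []. Qed.
Lemma conv_constM : {morph conv_const : a b / a * b}.
Proof.
by move=> a b; apply: conv_ext => x; rewrite convM_cstl !conv_constE scalerAr.
Qed.
End Convolution.

Lemma conv_app_tlift (k : fieldType) (X : nzCoalgType k) (A : falgType k)
    (U V : vectType k) (B : U -> V -> conv X A) t x :
  conv_app (tlift B t) x = tlift (fun u v => conv_app (B u v) x) t.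
Proof.
rewrite /conv_app /tlift sum_lfunE; apply: eq_bigr => i _.
by rewrite sum_lfunE; apply: eq_bigr => j _; rewrite scale_lfunE.
Qed.

(** * Existence of Skolem-Noether maps *)

Section Action.
Variables (k : fieldType) (H : hopfType k) (J : twist H).
Local Notation A := (dual (twcoalg J)).

Lemma dual_actE (a : A) h c : dual_app (dual_act a h) c = a (h * c : H).
Proof. by rewrite mkdualE // => l x y; rewrite mulrDr -scalerAr linearP. Qed.

Lemma dual_actPr (a : A) : linear (dual_act a).
Proof.
move=> l x y; apply: dual_ext => c; rewrite dualP !dual_actE.
by rewrite mulrDl -scalerAl linearP.
Qed.

Lemma dual_actPl h l (a b : A) :
  dual_act (l *: a + b) h = l *: dual_act a h + dual_act b h.
Proof. by apply: dual_ext => c; rewrite dualP !dual_actE dualP. Qed.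

(** The coaction of the dual of H on A that corresponds to the action of H. *)
Definition act (a : A) : conv H A := mkconv (dual_act a).

Lemma actE a h : act a h = dual_act a h.
Proof. by rewrite mkconvE //; apply: dual_actPr. Qed.

Fact act_is_linear : linear act.
Proof.
by move=> l a b; apply: conv_ext => h; rewrite convP !actE dual_actPl.
Qed.
HB.instance Definition _ := GRing.isLinear.Build k A (conv H A) *:%R act
  act_is_linear.

Lemma twdualME (a b : A) (c : H) :
  dual_app (a * b) c = tpair2 a b (comul c * (J : tens H H)).
Proof. exact: dualME. Qed.

Lemma twdual1E (c : H) : dual_app (1 : A) c = counit c.
Proof. exact: dual1E. Qed.

Lemma tpair2_act (a b : A) (s t : tens H H) :
  tpair2 a b (s * t) =
  tlift (fun x y => tpair2 (dual_act a x) (dual_act b y) t : k^o) s.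
Proof.
elim/tens_ind: s => [x y|l s s' IH IH']; last first.
  by rewrite mulrDl -scalerAl tpair2P IH IH' linearP.
rewrite tlift_pure; last first.
  by split=> w l u v; rewrite dual_actPr ?tpair2Pl ?tpair2Pr.
elim/tens_ind: t => [u v|l t t' IH IH']; last first.
  by rewrite mulrDr -scalerAr !tpair2P IH IH'.
by rewrite tpureM !tpair2_pure !dual_actE.
Qed.

Lemma actM : {morph act : a b / a * b}.
Proof.
move=> a b; apply: conv_ext => h; rewrite convME actE; apply: dual_ext => c.
rewrite dual_actE twdualME comulM -mulrA tpair2_act.
rewrite dual_app_tlift.
by apply: eq_tliftk => x y; rewrite twdualME !actE.
Qed.

Lemma act1 : act 1 = 1.
Proof.
apply: conv_ext => h; rewrite actE conv1E; apply: dual_ext => c.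
rewrite dual_actE twdual1E counitM.
by rewrite -[_ *: _]addr0 dualP twdual1E /dual_app zero_lfunE addr0.
Qed.

Lemma conv_at1M (X : falgType k) (f g : conv H X) :
  conv_app (f * g) 1 = f 1 * g 1.
Proof.
rewrite convME comul1 -[1 : tens _ _]/(1 ⊗ 1).
exact: tlift_pure (conv_bilin f g).
Qed.

(** In Sweedler notation, sum (a . h1) t(h2) = t(h) a: the condition that t
    and its inverse make the action of H inner, freed from the inverse. *)
Definition intertwines (t : conv H A) :=
  forall a, act a * t = t * conv_const H a.

Lemma skolem_noetherP (p q : conv H A) : skolem_noether p q <->
  [/\ p * q = 1, q * p = 1, intertwines q, p 1 = 1 & q 1 = 1].
Proof.
split.
  case=> inv qa [p1 q1].
  have pq : p * q = 1.
    by apply: conv_ext => h; rewrite convME conv1E; case: (inv h).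
  have qp : q * p = 1.
    by apply: conv_ext => h; rewrite convME conv1E; case: (inv h).
  split=> // a; suff -> : act a = q * conv_const H a * p.
    by rewrite -mulrA pq mulr1.
  apply: conv_ext => h; rewrite actE qa convME; apply: eq_tlift => x y.
  by rewrite convM_cstr.
case=> pq qp qa p1 q1; split=> //.
  move=> h; split.
    by rewrite -[LHS](convME p q) pq; apply: conv1E.
  by rewrite -[LHS](convME q p) qp; apply: conv1E.
move=> a h; rewrite -actE -[act a]mulr1 -qp mulrA qa convME.
by apply: eq_tlift => x y; rewrite convM_cstr.
Qed.

End Action.

Section Existence.
Variables (k : closedFieldType) (H : hopfType k) (J : twist H).
Local Notation A := (dual (twcoalg J)).
Hypothesis simA : simple_algebra A.

(** Conjugating [act] to the constants gives an invertible intertwiner u.  Its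
    value at 1 is central since H acts trivially through 1, hence a scalar, and
    dividing by that scalar normalizes u. *)
Lemma exists_skolem_noether : exists p q : conv H A, skolem_noether p q.
Proof.
have [u uu uP] := simple_conj simA (act1 J) (conv_const1 H A)
  (@actM _ _ J) (@conv_constM _ H A).
have eqA (a : A) : act a 1 = a.
  by rewrite actE; apply: dual_ext => c; rewrite dual_actE mul1r.
have [c cE] : exists c : k, conv_app u 1 = c%:A.
  apply: (simple_center simA) => a; rewrite -[a in LHS]eqA.
  by rewrite -conv_at1M uP conv_at1M conv_constE counit1 scale1r.
have uV : conv_app u 1 * conv_app u^-1 1 = 1.
  by rewrite -conv_at1M mulrV // conv1E counit1 scale1r.
have c0 : c != 0.
  apply/eqP => c0; move: uV; rewrite cE c0 scale0r mul0r => /esym/eqP.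
  by apply/negP/oner_neq0.
have V1 : conv_app u^-1 1 = c^-1%:A.
  by rewrite -[LHS]scale1r -(mulVf c0) -scalerA -[c *: _]mulr_algl -cE uV.
exists (c *: u^-1), (c^-1 *: u); apply/skolem_noetherP; split.
- by rewrite -scalerAl -scalerAr scalerA mulfV // scale1r mulVr.
- by rewrite -scalerAl -scalerAr scalerA mulVf // scale1r mulrV.
- by move=> a; rewrite -scalerAr uP scalerAl.
- by rewrite convZ V1 scalerA mulfV // scale1r.
- by rewrite convZ cE scalerA mulVf // scale1r.
Qed.

End Existence.

(** * Injectivity of Skolem-Noether maps *)

Lemma counit_slice (k : fieldType) (H : hopfType k) (a : dual H) h :
  counit (tlift (fun h1 h2 => a h2 *: h1) (comul h)) = a h.
Proof.
rewrite (tlift_comp _ counit) -{2}(comul_counitl h) /dual_app tlift_comp.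
by apply: eq_tliftk => x y; rewrite !linearZ /= /GRing.scale /= mulrC.
Qed.

Section Galois.
Variables (k : fieldType) (H : hopfType k) (J : twist H).

Let mu (t : tens H H) : H := tlift (fun x y => x * antipode y) t.

Let mu_pure x y : mu (x ⊗ y) = x * antipode y.
Proof.
rewrite /mu tlift_pure //.
by split=> w l u v; rewrite ?linearP /= ?mulrDl ?mulrDr -?scalerAl -?scalerAr.
Qed.

Let muP c s t : mu (c *: s + t) = c *: mu s + mu t.
Proof. by rewrite /mu linearP. Qed.

Let mu_mull y e (F : tens H H) : mu ((y ⊗ e) * F) = y * mu ((1 ⊗ e) * F).
Proof.
elim/tens_ind: F => [u v|l s s' IH IH'].
  by rewrite !tpureM !mu_pure mul1r mulrA.
by rewrite !mulrDr -!scalerAr !muP IH IH' mulrDr scalerAr.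
Qed.

(** Galois property of the twisted comultiplication, stated through the linear
    maps that vanish on the elements (comul d * J) * (1 (x) z): these elements
    span, and c (x) 1 is obtained as follows.  Writing comul c * J as a sum of
    terms d (x) e, the sum of (comul d * J) * (1 (x) F1 S(e F2)), where
    F = J^-1 = F1 (x) F2, is computed by coassociativity of H^(J): J cancels
    against F, and the antipode property and the counit leave c (x) 1. *)
Lemma twcomul_galois (Psi : {linear tens H H -> H}) :
    (forall t z, Psi (t * (1 ⊗ z)) = Psi t * z) ->
    (forall c : H, Psi (comul c * (J : tens H H)) = 0) ->
  forall c : H, Psi (c ⊗ 1) = 0.
Proof.
move=> PsiM PsiJ c; have [uJ _ _ _] := twistP J.
pose F : tens H H := (J : tens H H)^-1.
(* N sends both bracketings of the iterated comultiplication of c to H; on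
   the right one J meets its inverse F. *)
pose N (t : tens H (tens H H)) : H :=
  tlift (fun x u => Psi (x ⊗ mu (u * F))) t.
have NP l s t : N (l *: s + t) = l *: N s + N t by rewrite /N linearP.
have Np x u : N (x ⊗ u) = Psi (x ⊗ mu (u * F)).
  rewrite /N tlift_pure //.
  split=> w l y z; first by rewrite tpurePl linearP.
  by rewrite mulrDl -scalerAl muP tpurePr linearP.
have := comulA (c : twcoalg J) => /(congr1 N).
have -> : N (tmap idfun comul (comul (c : twcoalg J))) = Psi (c ⊗ 1).
  rewrite -[in RHS](comul_counitr (c : twcoalg J)).
  elim/tens_ind: (comul (c : twcoalg J)) => [d e|l s t IH IH']; last first.
    by rewrite tmapP NP IH IH' linearP /= tpurePl linearP.
  rewrite tmap_pure Np /= -mulrA mulrV // mulr1.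
  rewrite [mu _](antipoder (e : H)) tlift_pure.
    by rewrite tpureZl tpureZr.
  exact: counitr_bilin.
move=> <-; elim/tens_ind: (comul (c : twcoalg J)) => [d e|l s t IH IH'].
  rewrite tmap_pure /=.
  have E s : N (tassoc (s ⊗ e)) = Psi s * mu ((1 ⊗ e) * F).
    elim/tens_ind: s => [x y|l s t IH IH'].
      rewrite tassoc_pure Np mu_mull -PsiM tpureM mulr1 //.
    by rewrite tpurePl tassocP NP IH IH' linearP /= mulrDl scalerAl.
  by rewrite E [Psi _]PsiJ mul0r.
by rewrite tmapP tassocP NP IH IH' scaler0 addr0.
Qed.

Local Notation A := (dual (twcoalg J)).
Variables p q : conv H A.
Hypotheses (pq : p * q = 1) (qp : q * p = 1) (qJ : intertwines q).

Lemma intertwines_inv a : p * act a = conv_const H a * p.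
Proof.
transitivity (p * (act a * q) * p); first by rewrite mulrA -mulrA qp mulr1.
by rewrite qJ !mulrA pq mul1r.
Qed.

Let Psi (D t : tens H H) : H :=
  tlift (fun x y : H => tlift (fun h1 h2 => conv_app p h1 x *: (h2 * y)) D) t.

Let psi (D : tens H H) (x : H) : H :=
  tlift (fun h1 h2 => conv_app p h1 x *: h2) D.

Let Psi_bilin D : bilin (fun x y : H =>
  tlift (fun h1 h2 => conv_app p h1 x *: (h2 * y)) D).
Proof.
split=> w l u v; rewrite -tliftPB; apply: eq_tlift => h1 h2.
  by rewrite linearP /= scalerDl scalerA.
by rewrite mulrDr -scalerAr scalerDr !scalerA mulrC.
Qed.

Let Psi_pure D x y : Psi D (x ⊗ y) = psi D x * y.
Proof.
rewrite /Psi (tlift_pure _ _ (Psi_bilin D)) /psi /tlift mulr_suml.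
apply: eq_bigr => i _; rewrite mulr_suml; apply: eq_bigr => j _.
by rewrite -!scalerAl.
Qed.

Let psi_dual D x (a : dual H) :
  a (psi D x) = dual_app (tlift (fun h1 h2 => a h2 *: conv_app p h1) D) x.
Proof.
rewrite dual_app_tlift /dual_app tlift_comp; apply: eq_tliftk => h1 h2.
by rewrite linearZ scale_lfunE /= /GRing.scale /= mulrC.
Qed.

Let Psi_dual D t (a : A) :
  a (Psi D t) =
  tlift (fun h1 h2 => tpair2 (conv_app p h1) (dual_act a h2) t : k^o) D.
Proof.
elim/tens_ind: t => [u v|l s t IH IH']; last first.
  rewrite {1}/Psi !linearP /= IH IH' -tliftPk; apply: eq_tliftk => h1 h2.
  by rewrite tpair2P.
rewrite /Psi (tlift_pure _ _ (Psi_bilin D)) /dual_app tlift_comp.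
apply: eq_tliftk => h1 h2.
by rewrite tpair2_pure linearZ /= -/(dual_app a _) dual_actE.
Qed.

(** If p h = 0, then sum p(h1) (a . h2) = a p(h) = 0 for all a, and the Galois
    property turns this into sum p(h1) (x) h2 = 0. *)
Let ker_invariant h : p h = 0 -> forall x, psi (comul h) x = 0.
Proof.
move=> ph x; rewrite -[LHS]mulr1 -Psi_pure.
pose PsiL : {linear tens H H -> H} := tlift (fun x y : H =>
  tlift (fun h1 h2 => conv_app p h1 x *: (h2 * y)) (comul h)).
rewrite -[LHS]/(PsiL _); apply: twcomul_galois => [t z|c].
  elim/tens_ind: t => [u v|l s t IH IH'].
    by rewrite tpureM mulr1 [LHS]Psi_pure [PsiL _]Psi_pure mulrA.
  by rewrite mulrDl -scalerAl !linearP IH IH' mulrDl scalerAl.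
apply: dual_separates => a.
have /(congr1 (fun f : conv H A => dual_app (conv_app f h) c)) :=
  intertwines_inv a.
rewrite convM_cstl ph mulr0 convME dual_app_tlift [dual_app 0 _]zero_lfunE.
move=> <-; rewrite [LHS]Psi_dual; apply: eq_tliftk => h1 h2.
by rewrite actE twdualME.
Qed.

Let dual_ker h (a : dual H) : p h = 0 ->
  p (tlift (fun h1 h2 => a h2 *: h1) (comul h)) = 0.
Proof.
move=> ph; rewrite (tlift_comp _ (conv_app p)).
under eq_tlift do rewrite linearZ /=.
apply: dual_ext => x; rewrite -psi_dual ker_invariant // linear0.
by rewrite /dual_app zero_lfunE.
Qed.

(** Apply x (x) y |-> x q(y) to sum p(h1) (x) h2 = 0. *)
Let counit_ker h : p h = 0 -> counit h = 0.
Proof.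
move=> ph; have /(congr1 (fun f : conv H A => conv_app f h)) := pq.
rewrite conv1E convME.
have -> : tlift (fun h1 h2 => conv_app p h1 * conv_app q h2) (comul h) = 0.
  have pair0 (t : tens H H) : tlift (fun h1 h2 =>
      tpair2 (conv_app p h1) (conv_app q h2) t : k^o) (comul h) = 0 :> k.
    elim/tens_ind: t => [u v|l s t IH IH'].
      under eq_tliftk do rewrite tpair2_pure.
      have := congr1 (fun z => dual_app (conv_app q z) v) (ker_invariant ph u).
      rewrite /psi linear0 [dual_app 0 _]zero_lfunE => <-.
      rewrite (tlift_comp _ (conv_app q)) dual_app_tlift.
      by apply: eq_tliftk => x1 x2; rewrite linearZ /= [RHS]scale_lfunE.
    under eq_tliftk do rewrite tpair2P.
    by rewrite tliftPk IH IH' mulr0 addr0.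
  apply: dual_ext => x; rewrite dual_app_tlift [RHS]zero_lfunE.
  rewrite -[RHS](pair0 (comul (x : H) * (J : tens H H))).
  by apply: eq_tliftk => x1 x2; rewrite twdualME.
by move/esym/eqP; rewrite scaler_eq0 oner_eq0 orbF => /eqP.
Qed.

(** The kernel of p is stable under h |-> sum a(h2) h1 by [dual_ker] and lies
    in the kernel of the counit, so a h = 0 for every functional a. *)
Lemma sn_map_inj : injective p.
Proof.
suff ker0 h : p h = 0 -> h = 0.
  move=> x y pxy; apply/eqP; rewrite -subr_eq0; apply/eqP/ker0.
  by rewrite linearB /= pxy subrr.
move=> ph; apply: dual_separates => a.
by rewrite -counit_slice (counit_ker (dual_ker a ph)).
Qed.

End Galois.

(** * The dual twist and bijectivity of the inverse map *)

Section Lifts.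
Variables (k : fieldType) (H : hopfType k) (A : falgType k).
Local Notation E1 := (conv H A).
Local Notation E2 := (conv H E1).
Implicit Types u v : E1.

(** Bilinear maps H x H -> A are handled in the curried form
    Hom(H, Hom(H, A)), whose convolution product is that of Hom(H (x) H, A).
    The maps lift1, lift2 and lift12 send u to (h, g) |-> counit g *: u h,
    counit h *: u g and u (h * g). *)
Definition lift1 u : E2 := mkconv (fun h => conv_const H (u h)).
Definition lift2 u : E2 := conv_const H u.
Definition lmul_conv u h : E1 := mkconv (fun g => u (h * g)).
Definition lift12 u : E2 := mkconv (lmul_conv u).

Lemma lift1E u h : conv_app (lift1 u) h = conv_const H (u h).
Proof. by rewrite mkconvE // => l x y; rewrite !linearP. Qed.

Lemma lmul_convE u h g : conv_app (lmul_conv u h) g = u (h * g).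
Proof. by rewrite mkconvE // => l x y; rewrite mulrDr -scalerAr linearP. Qed.

Lemma lift12E u h : conv_app (lift12 u) h = lmul_conv u h.
Proof.
rewrite mkconvE // => l x y; apply: conv_ext => g.
by rewrite convP !lmul_convE mulrDl -scalerAl linearP.
Qed.

Lemma lift1M u v : lift1 (u * v) = lift1 u * lift1 v.
Proof.
apply: conv_ext => h; rewrite lift1E !convME (tlift_comp _ (@conv_const k H A)).
by apply: eq_tlift => x y; rewrite !lift1E /= conv_constM.
Qed.

Lemma lift2M u v : lift2 (u * v) = lift2 u * lift2 v.
Proof. exact: conv_constM. Qed.

(** The multiplication of H is a homomorphism of coalgebras, so composing
    with it respects convolution. *)
Lemma lift12M u v : lift12 (u * v) = lift12 u * lift12 v.
Proof.
apply: conv_ext => h; rewrite lift12E convME; apply: conv_ext => g.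
rewrite lmul_convE convME comulM conv_app_tlift.
transitivity (tlift (fun x y => tlift (fun x' y' => u (x * x') * v (y * y'))
  (comul g)) (comul h)); last first.
  apply: eq_tlift => x y; rewrite !lift12E convME; apply: eq_tlift => x' y'.
  by rewrite !lmul_convE.
elim/tens_ind: (comul h) => [x y|l s t IH IH']; last first.
  by rewrite mulrDl -scalerAl !linearP /= IH IH'.
rewrite tlift_pure; last first.
  split=> w l a b; rewrite -tliftPB; apply: eq_tlift => x' y'.
    by rewrite mulrDl -scalerAl linearP /= mulrDl scalerAl.
  by rewrite mulrDl -scalerAl linearP /= mulrDr scalerAr.
elim/tens_ind: (comul g) => [x' y'|l s t IH IH']; last first.
  by rewrite mulrDr -scalerAr !linearP /= IH IH'.
rewrite tpureM (tlift_pure _ _ (conv_bilin _ _)) tlift_pure //.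
split=> w l a b; rewrite mulrDr -scalerAr linearP /=.
  by rewrite mulrDl scalerAl.
by rewrite mulrDr scalerAr.
Qed.

Lemma lift12_const a : lift12 (conv_const H a) = lift1 (conv_const H a).
Proof.
apply: conv_ext => h; rewrite lift12E lift1E; apply: conv_ext => g.
by rewrite lmul_convE !conv_constE counitM scalerA mulrC.
Qed.

Lemma lift1_const a : lift1 (conv_const H a) = conv_const H (conv_const H a).
Proof.
apply: conv_ext => h; rewrite lift1E; apply: conv_ext => g.
by rewrite !conv_constE convZ conv_constE !scalerA mulrC.
Qed.

Lemma lift12_1 : lift12 1 = 1.
Proof. by rewrite -conv_const1 lift12_const lift1_const !conv_const1. Qed.

Lemma lift21E u v h g : conv_app (conv_app (lift2 u * lift1 v) h) g = u g * v h.
Proof. by rewrite convM_cstl lift1E convM_cstr. Qed.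

Lemma lift12ME u (F : E2) h g :
  conv_app (conv_app (lift12 u * F) h) g =
  tlift (fun h1 h2 => tlift (fun g1 g2 =>
    u (h1 * g1) * conv_app (conv_app F h2) g2) (comul g)) (comul h).
Proof.
rewrite convME conv_app_tlift; apply: eq_tlift => x y; rewrite convME lift12E.
by apply: eq_tlift => x' y'; rewrite lmul_convE.
Qed.

End Lifts.

(** The product deformed by the form c; the twist condition on c amounts to
    its associativity, see [cocyclel] and [cocycler]. *)
Definition star (k : fieldType) (H : hopfType k)
  (c : tens (dual H) (dual H)) (h g : H) : H :=
  tlift (fun h1 h2 => tlift (fun g1 g2 => tpair c h2 g2 *: (h1 * g1))
    (comul g)) (comul h).

Section InnerMaps.
Variables (k : fieldType) (H : hopfType k) (J : twist H).
Local Notation A := (dual (twcoalg J)).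
Variables p q : conv H A.
Hypotheses (pq : p * q = 1) (qp : q * p = 1) (qJ : intertwines q).

Let X := lift12 p * (lift2 q * lift1 q).

Lemma is_dual_twistE c : is_dual_twist p q c <->
  forall h g, (tpair c h g)%:A = conv_app (conv_app X h) g.
Proof.
have E h g : conv_app (conv_app X h) g = tlift (fun h1 h2 =>
      tlift (fun g1 g2 => conv_app p (h1 * g1) * conv_app q g2 * conv_app q h2)
        (comul g)) (comul h).
  rewrite lift12ME; apply: eq_tlift => x y; apply: eq_tlift => x' y'.
  by rewrite lift21E mulrA.
by split=> cE h g; rewrite cE E.
Qed.

(** Both sides come from (a . h) . g = a . (h g). *)
Lemma lift_act a : lift2 q * lift1 (act a) = lift12 (act a) * lift2 q.
Proof.
apply: conv_ext => h; apply: conv_ext => g; rewrite lift21E convM_cstr lift12E.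
have -> : lmul_conv (act a) h = act (act a h).
  apply: conv_ext => x; rewrite lmul_convE !actE; apply: dual_ext => c.
  by rewrite !dual_actE mulrA.
by rewrite qJ convM_cstr.
Qed.

(** The values commute with A because lift12 q and lift2 q * lift1 q conjugate
    the constants to the same coaction. *)
Lemma dual_twist_central h g a :
  a * conv_app (conv_app X h) g = conv_app (conv_app X h) g * a.
Proof.
have pJ := intertwines_inv pq qp qJ.
have XC : conv_const H (conv_const H a) * X = X * conv_const H (conv_const H a).
  rewrite -lift1_const /X -!mulrA -lift1M -qJ lift1M.
  rewrite [lift2 q * (_ * _)]mulrA lift_act -[_ * _ * lift1 q]mulrA.
  by rewrite [RHS]mulrA -lift12M pJ lift12M lift12_const !mulrA.
rewrite -(convM_cstl a (conv_app X h)) -(convM_cstl (conv_const H a) X) XC.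
by rewrite (convM_cstr (conv_const H a) X) (convM_cstr a (conv_app X h)).
Qed.

Lemma exists_dual_twist :
    (forall z : A, (forall a, a * z = z * a) -> exists c : k, z = c%:A) ->
  exists c, is_dual_twist p q c.
Proof.
move=> center.
(* The unit of A is the counit of H, so a scalar of A is its value at 1. *)
pose B h g : k := dual_app (conv_app (conv_app X h) g) (1 : H).
have [||c cE] := @bilin_form_tensor k H H B.
- by move=> g l x y; rewrite /B linearP convP dualP.
- by move=> h l x y; rewrite /B linearP dualP.
exists c; apply/is_dual_twistE => h g; rewrite cE /B.
have [s ->] := center _ (fun a => dual_twist_central h g a).
by rewrite dualZ twdual1E counit1 mulr1.
Qed.

(** Multiply the definition of c by lift12 q on the left. *)
Lemma dual_twist_star c : is_dual_twist p q c ->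
  forall h g, conv_app q g * conv_app q h = conv_app q (star c h g).
Proof.
move=> /is_dual_twistE cE h g.
have : lift12 q * X = lift2 q * lift1 q.
  by rewrite mulrA -lift12M qp lift12_1 mul1r.
move/(congr1 (fun F : conv H (conv H A) => conv_app (conv_app F h) g)).
rewrite lift21E lift12ME => <-; rewrite (tlift_comp _ (conv_app q)).
apply: eq_tlift => x y; rewrite (tlift_comp _ (conv_app q)).
by apply: eq_tlift => x' y'; rewrite -cE linearZ /= -scalerAr mulr1.
Qed.

End InnerMaps.

Section Bijective.
Variables (k : fieldType) (H : hopfType k) (J : twist H).
Local Notation A := (dual (twcoalg J)).

Variables p q : conv H A.
Hypotheses (pq : p * q = 1) (qp : q * p = 1) (qJ : intertwines q).
Hypothesis q1 : conv_app q 1 = 1.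
Variable c : tens (dual H) (dual H).
Hypothesis cE : is_dual_twist p q c.

Lemma sn_map_surj a : exists h, conv_app p h = a.
Proof.
have /(hom_inj_surj (dim_dual H)) im := sn_map_inj pq qp qJ.
have /memv_imgP[h _ ->] : a \in limg p by rewrite im memvf.
by exists h.
Qed.

(** The image S of q is closed under multiplication by [dual_twist_star].
    Left multiplication by q maps the maps with values in S injectively, hence
    bijectively, to themselves, so 1 = q * v for some v with values in S, and
    v = p; but p is onto. *)
Lemma sn_inverse_surj a : exists h, conv_app q h = a.
Proof.
pose S := limg q; move: a.
have memS h : conv_app q h \in S by rewrite memv_img ?memvf.
have SM a b : a \in S -> b \in S -> a * b \in S.
  move=> /memv_imgP[x _ ->] /memv_imgP[y _ ->].
  by rewrite (dual_twist_star qp cE) memS.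
(* An endomorphism with kernel S, used to cut out the maps valued in S. *)
pose coS : 'Hom(A, A) := \1%VF - projv S.
have coSE a : (a \in S) = (coS a == 0).
  rewrite add_lfunE opp_lfunE id_lfunE subr_eq0.
  apply/idP/eqP => [aS|->]; first by rewrite projv_id.
  by rewrite memv_proj.
pose K (v : conv H A) : conv H A := (coS \o (v : 'Hom(H, A)))%VF.
have KE v h : conv_app (K v) h = coS (conv_app v h).
  by rewrite /conv_app comp_lfunE.
have lK : linear K.
  by move=> l u v; apply: conv_ext => h; rewrite convP !KE convP linearP.
pose KL : {linear conv H A -> conv H A} :=
  HB.pack K (GRing.isLinear.Build k (conv H A) (conv H A) *:%R _ lK).
pose M := lker (linfun KL).
have memM v : reflect (forall h, conv_app v h \in S) (v \in M).
  rewrite memv_ker lfunE; apply: (iffP eqP) => [v0 h|vS].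
    by rewrite coSE -KE [K v]v0 /conv_app zero_lfunE.
  apply: conv_ext => h; rewrite [LHS]KE; move: (vS h); rewrite coSE => /eqP->.
  by rewrite /conv_app zero_lfunE.
have qM : (amull q @: M <= M)%VS.
  apply/subvP => _ /memv_imgP[v /memM vM ->]; rewrite lfunE /=; apply/memM => h.
  rewrite convME /tlift; apply: memv_suml => i _; apply: memv_suml => j _.
  by rewrite memvZ // SM.
have qU : q \is a GRing.unit by apply/unitrP; exists p.
have {}qM : (amull q @: M)%VS = M.
  apply/eqP; rewrite eqEdim qM limg_dim_eq ?leqnn //.
  by rewrite (eqP (lker0_amull qU)) capv0.
have /memv_imgP[v /memM vM] : 1 \in (amull q @: M)%VS.
  rewrite qM; apply/memM => h; rewrite conv1E memvZ // -q1; exact: memS.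
rewrite lfunE /= => qv; move=> a; have [h <-] := sn_map_surj a.
have /memv_imgP[x _ ->] : conv_app p h \in S.
  by rewrite -[p]mulr1 qv mulrA pq mul1r.
by exists x.
Qed.

Lemma sn_inverse_inj : injective (conv_app q).
Proof.
apply/(hom_inj_surj (dim_dual H)); apply/eqP; rewrite eqEsubv subvf.
apply/subvP => a _; have [h <-] := sn_inverse_surj a.
by rewrite memv_img ?memvf.
Qed.

End Bijective.

(** * The dual twist is a twist *)

Section Scalars.
Variables (k : fieldType) (H : hopfType k) (A : falgType k).
Local Notation R := (dual H).

(** Functionals on H, and tensors of functionals, seen as scalar-valued
    elements of the convolution algebras. *)
Definition scal1 (x : R) : conv H A := mkconv (fun h => (x h)%:A).

Lemma scal1E x h : conv_app (scal1 x) h = (x h)%:A.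
Proof. by rewrite mkconvE // => l a b; rewrite linearP scalerDl scalerA. Qed.

Fact scal1_is_linear : linear scal1.
Proof.
move=> l x y; apply: conv_ext => h.
by rewrite convP !scal1E dualP scalerDl scalerA.
Qed.
HB.instance Definition _ := GRing.isLinear.Build k R (conv H A) *:%R scal1
  scal1_is_linear.

Definition scal2 (c : tens R R) : conv H (conv H A) :=
  mkconv (fun h => scal1 (mkdual (tpair c h))).

Lemma scal2E c h g : conv_app (conv_app (scal2 c) h) g = (tpair c h g)%:A.
Proof.
have lt x : scalar (tpair c x) by move=> l a b; rewrite tpairPr.
rewrite mkconvE; first by rewrite scal1E mkdualE.
move=> l a b; apply: conv_ext => y.
by rewrite convP !scal1E !mkdualE // tpairPl scalerDl scalerA.
Qed.

Fact scal2_is_linear : linear scal2.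
Proof.
move=> l c d; apply: conv_ext => h; apply: conv_ext => g.
by rewrite !(convP, scal2E) tpairP scalerDl scalerA.
Qed.
HB.instance Definition _ := GRing.isLinear.Build k (tens R R)
  (conv H (conv H A)) *:%R scal2 scal2_is_linear.

Lemma alg_inj (a b : k) : a%:A = b%:A :> A -> a = b.
Proof. exact: (fmorph_inj (in_alg A)). Qed.

Lemma scal2_inj : injective scal2.
Proof.
move=> c d /(congr1 (fun f : conv H (conv H A) => conv_app f)) cd.
by apply: tpair_ext => h g; apply: alg_inj; rewrite -!scal2E cd.
Qed.

Lemma tlift_alg (U V : vectType k) (B : U -> V -> k) t :
  tlift (fun u v => (B u v)%:A : A) t = (tlift (B : U -> V -> k^o) t : k)%:A.
Proof.
rewrite /tlift scaler_suml; apply: eq_bigr => i _.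
by rewrite scaler_suml; apply: eq_bigr => j _; rewrite scalerA.
Qed.

Lemma scal1M x y : scal1 (x * y) = scal1 x * scal1 y.
Proof.
apply: conv_ext => h; rewrite convME scal1E dualME -tlift_alg.
by apply: eq_tlift => u v; rewrite !scal1E -scalerAl mul1r scalerA.
Qed.

Lemma scal2M c d : scal2 (c * d) = scal2 c * scal2 d.
Proof.
apply: conv_ext => h; apply: conv_ext => g; rewrite scal2E tpairM -tlift_alg.
rewrite convME conv_app_tlift; apply: eq_tlift => x y.
rewrite -tlift_alg convME.
by apply: eq_tlift => u v; rewrite !scal2E -scalerAl mul1r scalerA.
Qed.

Lemma lift12_scal x : lift12 (scal1 x) = scal2 (comul x).
Proof.
apply: conv_ext => h; apply: conv_ext => g.
by rewrite lift12E lmul_convE scal1E scal2E tpair_comul.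
Qed.

Lemma lift21_scal x y : lift2 (scal1 y) * lift1 (scal1 x) = scal2 (x ⊗ y).
Proof.
apply: conv_ext => h; apply: conv_ext => g.
by rewrite lift21E !scal1E scal2E tpair_pure -scalerAl mul1r scalerA mulrC.
Qed.

Lemma lift2_scal_comm (x : R) (u : conv H A) :
  lift2 (scal1 x) * lift1 u = lift1 u * lift2 (scal1 x).
Proof.
apply: conv_ext => h; apply: conv_ext => g.
rewrite lift21E convM_cstr lift1E scal1E convM_cstl scal1E.
by rewrite -scalerAl -scalerAr mulr1 mul1r.
Qed.

End Scalars.

Section Star.
Variables (k : fieldType) (H : hopfType k).
Implicit Types c : tens (dual H) (dual H).

Lemma scalar_star (f : H -> k) c h g : scalar f ->
  f (star c h g) = tlift (fun h1 h2 => tlift (fun g1 g2 =>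
    tpair c h2 g2 * f (h1 * g1) : k^o) (comul g)) (comul h).
Proof.
move=> lf; rewrite (scalar_tlift _ _ lf); apply: eq_tliftk => x y.
rewrite (scalar_tlift _ _ lf); apply: eq_tliftk => u v.
exact: scalarZ_fun.
Qed.

Lemma counit_tpairl c h g :
  tlift (fun h1 h2 => (counit h1 : k) * tpair c h2 g : k^o) (comul h) =
  tpair c h g :> k.
Proof.
have lf : scalar (fun x => tpair c x g) by move=> a x y; rewrite tpairPl.
rewrite -[in RHS](comul_counitl h) [RHS](scalar_tlift _ _ lf).
by apply: eq_tliftk => x y; rewrite (scalarZ_fun _ _ lf).
Qed.

Lemma counit_tpairr c h g :
  tlift (fun g1 g2 => (counit g1 : k) * tpair c h g2 : k^o) (comul g) =
  tpair c h g :> k.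
Proof.
have lf : scalar (tpair c h) by move=> a x y; rewrite tpairPr.
rewrite -[in RHS](comul_counitl g) [RHS](scalar_tlift _ _ lf).
by apply: eq_tliftk => x y; rewrite (scalarZ_fun _ _ lf).
Qed.

Lemma counit_star c h g : counit (star c h g) = tpair c h g.
Proof.
rewrite (@scalar_star counit) => [|a x y]; last by rewrite linearP.
rewrite -[RHS]counit_tpairl; apply: eq_tliftk => h1 h2; rewrite -counit_tpairr.
have lf : scalar (fun z : k^o => (counit h1 : k) * z).
  by move=> a x y; rewrite mulrDr mulrCA.
have /= -> := scalar_tlift (fun g1 g2 => (counit g1 : k) * tpair c h2 g2 : k^o)
  (comul g) lf.
by apply: eq_tliftk => g1 g2; rewrite counitM; ring.
Qed.

Lemma tpair3_tassoc (s : tens (dual H) (dual H)) (b : dual H) h g l :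
  tpair3 (tassoc (s ⊗ b)) h g l = tpair s h g * b l.
Proof.
elim/tens_ind: s => [x y|a s t IH IH'].
  by rewrite tassoc_pure tpair3_pure !tpair_pure mulrA.
by rewrite tpurePl tassocP tpair3P tpairP IH IH'; ring.
Qed.

(** The two sides of the twist equation, evaluated on h, g and l, are the two
    bracketings of a triple product for [star], composed with the counit. *)
Lemma cocyclel c d h g l :
  tpair3 (tassoc (tmap comul idfun d * (c ⊗ (1 : dual H)))) h g l =
  tpair d (star c h g) l.
Proof.
rewrite (scalar_star (f := fun x => tpair d x l)); last first.
  by move=> a x y; rewrite tpairPl.
elim/tens_ind: d => [x y|a s t IH IH']; last first.
  rewrite tmapP mulrDl -scalerAl tassocP tpair3P IH IH'.
  rewrite -tliftPk; apply: eq_tliftk => u v.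
  rewrite -tliftPk; apply: eq_tliftk => u' v'.
  by rewrite [tpair (_ + _) _ _]tpairP; ring.
rewrite tmap_pure tpureM mulr1 tpair3_tassoc tpairM.
have lf : scalar (fun z : k^o => z * y l).
  by move=> b u v; rewrite mulrDl -mulrA.
rewrite [LHS](scalar_tlift _ _ lf); apply: eq_tliftk => h1 h2.
rewrite [LHS](scalar_tlift _ _ lf); apply: eq_tliftk => g1 g2.
by rewrite tpair_comul tpair_pure [RHS]mulrCA mulrA.
Qed.

Lemma cocycler c d h g l :
  tpair3 (tmap idfun comul d * ((1 : dual H) ⊗ c)) h g l =
  tpair d h (star c g l).
Proof.
rewrite (scalar_star (f := tpair d h)); last by move=> a x y; rewrite tpairPr.
elim/tens_ind: d => [x y|a s t IH IH']; last first.
  rewrite tmapP mulrDl -scalerAl tpair3P IH IH'.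
  rewrite -tliftPk; apply: eq_tliftk => u v.
  rewrite -tliftPk; apply: eq_tliftk => u' v'.
  by rewrite [tpair (_ + _) _ _]tpairP; ring.
rewrite tmap_pure tpureM mulr1 tpair3_pure tpairM.
have lf : scalar (fun z : k^o => x h * z).
  by move=> b u v; rewrite mulrDr mulrCA.
rewrite [LHS](scalar_tlift _ _ lf); apply: eq_tliftk => g1 g2.
rewrite [LHS](scalar_tlift _ _ lf); apply: eq_tliftk => l1 l2.
by rewrite tpair_comul tpair_pure [RHS]mulrC mulrA.
Qed.

End Star.

Section TwistOfSkolemNoether.
Variables (k : fieldType) (H : hopfType k) (J : twist H).
Local Notation A := (dual (twcoalg J)).
Variables p q : conv H A.
Hypothesis snpq : skolem_noether p q.
Variable c : tens (dual H) (dual H).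
Hypothesis cE : is_dual_twist p q c.

Lemma dual_twist_scal2 : scal2 A c = lift12 p * (lift2 q * lift1 q).
Proof.
apply: conv_ext => h; apply: conv_ext => g; rewrite scal2E.
exact: (is_dual_twistE p q c).1.
Qed.

(** In the convolution algebra c becomes a product of lifts of p and q, which
    are invertible, so c is not a zero divisor. *)
Lemma dual_twist_unit : c \is a GRing.unit.
Proof.
have [pq qp qJ p1 q1] := (skolem_noetherP p q).1 snpq.
apply: regular_unit => y /(congr1 (@scal2 k H A)).
rewrite scal2M dual_twist_scal2.
have l1 : lift1 (1 : conv H A) = 1.
  by rewrite -conv_const1 lift1_const !conv_const1.
rewrite linear0 => /(congr1 (fun F => lift1 p * (lift2 p * (lift12 q * F)))).
rewrite !mulr0 -[lift12 p * _ * _]mulrA [lift12 q * (lift12 p * _)]mulrA.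
rewrite -lift12M qp lift12_1 mul1r -[lift2 q * _ * _]mulrA.
rewrite [lift2 p * (lift2 q * _)]mulrA -lift2M pq [lift2 1]conv_const1 mul1r.
by rewrite mulrA -lift1M pq l1 mul1r -(linear0 (@scal2 k H A)) => /scal2_inj.
Qed.

(** Since q is injective and reverses products, [star] inherits associativity
    and its unit from A. *)
Lemma dual_twist_is_twist : is_twist c.
Proof.
have [pq qp qJ p1 q1] := (skolem_noetherP p q).1 snpq.
have inj := sn_inverse_inj pq qp qJ q1 cE.
have starE := dual_twist_star qp cE.
split; first exact: dual_twist_unit.
- apply: tpair3_ext => h g l; rewrite cocyclel cocycler -2!counit_star.
  suff -> : star c (star c h g) l = star c h (star c g l) by [].
  by apply: inj; rewrite -!starE mulrA.
- apply: dual_ext => g; rewrite dual_app_tlift dual1E.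
  have -> : counit g = tpair c 1 g.
    rewrite -counit_star; congr (counit _).
    by apply: inj; rewrite -starE q1 mulr1.
  by apply: eq_tliftk => x y; rewrite dualZ dual_counitE.
- apply: dual_ext => h; rewrite dual_app_tlift dual1E.
  have -> : counit h = tpair c h 1.
    rewrite -counit_star; congr (counit _).
    by apply: inj; rewrite -starE q1 mul1r.
  by apply: eq_tliftk => x y; rewrite dualZ dual_counitE mulrC.
Qed.

End TwistOfSkolemNoether.

(** * Gauge equivalence and uniqueness of the dual twist *)

Section Gauge.
Variables (k : fieldType) (H : hopfType k).
Implicit Types J : tens H H.

Lemma tpure_unit (x : H) : x \is a GRing.unit ->
  (x ⊗ x) * (x^-1 ⊗ x^-1) = 1 :> tens H H /\
  (x^-1 ⊗ x^-1) * (x ⊗ x) = 1 :> tens H H.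
Proof. by move=> ux; rewrite !tpureM mulrV ?mulVr. Qed.

Lemma comul_inv (x : H) : x \is a GRing.unit ->
  comul x * comul x^-1 = 1 :> tens H H /\ comul x^-1 * comul x = 1 :> tens H H.
Proof. by move=> ux; rewrite -!comulM mulrV ?mulVr // comul1. Qed.

Lemma counit_inv (x : H) :
  x \is a GRing.unit -> counit x = 1 -> counit x^-1 = 1.
Proof.
by move=> ux x1; rewrite -[LHS]mul1r -x1 -counitM mulrV // counit1.
Qed.

Lemma gauge_refl J : gauge_equiv J J.
Proof.
exists 1; split; rewrite ?unitr1 ?counit1 //.
by rewrite comul1 mul1r invr1 -[1 ⊗ 1]/(1 : tens H H) mulr1.
Qed.

Lemma gauge_sym J J' : gauge_equiv J J' -> gauge_equiv J' J.
Proof.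
move=> [x [ux x1 ->]]; exists x^-1; split; rewrite ?unitrV ?counit_inv //.
rewrite invrK !mulrA (comul_inv ux).2 mul1r -mulrA (tpure_unit ux).2 mulr1 //.
Qed.

Lemma gauge_trans J J' J'' :
  gauge_equiv J J' -> gauge_equiv J' J'' -> gauge_equiv J J''.
Proof.
move=> [x [ux x1 ->]] [y [uy y1 ->]]; exists (y * x); split.
- by rewrite unitrMl.
- by rewrite counitM x1 y1 mulr1.
- by rewrite invrM // comulM -tpureM !mulrA.
Qed.

End Gauge.

Section DualPair.
Variables (k : fieldType) (H : hopfType k).

(** The relation between J and its dual twists, in a form that mentions only
    the inverse of the Skolem-Noether map and is symmetric in the two twists. *)
Definition dual_pair (J : twist H) (c : tens (dual H) (dual H)) : Prop :=
  exists t : conv H (dual (twcoalg J)),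
    [/\ injective (conv_app t), conv_app t 1 = 1, intertwines t
      & forall h g, conv_app t g * conv_app t h = conv_app t (star c h g)].

Lemma skolem_noether_dual_pair (J : twist H)
    (p q : conv H (dual (twcoalg J))) c :
  skolem_noether p q -> is_dual_twist p q c -> dual_pair J c.
Proof.
move=> /skolem_noetherP[pq qp qJ p1 q1] cE; exists q; split=> //.
  exact (sn_inverse_inj pq qp qJ q1 cE).
exact (dual_twist_star qp cE).
Qed.

Lemma intertwinesE (J : twist H) (t : conv H (dual (twcoalg J))) :
  intertwines t <-> forall a h,
    conv_app t h * a = tlift (fun x y => dual_act a x * conv_app t y) (comul h).
Proof.
split=> [tJ a h|tE a].
  by rewrite -convM_cstr -tJ convME; apply: eq_tlift => x y; rewrite actE.
apply: conv_ext => h; rewrite convM_cstr tE convME.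
by apply: eq_tlift => x y; rewrite actE.
Qed.

Section Transport.
Variables (J J' : twist H) (x : H).
Hypotheses (ux : x \is a GRing.unit) (x1 : counit x = 1).
Hypothesis JJ' : J' = comul x * (J : tens H H) * (x^-1 ⊗ x^-1) :> tens H H.

(** Right translation by x is an H-linear isomorphism of coalgebras from
    H^(J') to H^(J); this is the dual isomorphism of algebras. *)
Definition rtrans (a : dual (twcoalg J)) : dual (twcoalg J') :=
  mkdual (fun c : H => a (c * x : H)).

Lemma rtransE a (c : H) : dual_app (rtrans a) c = a (c * x : H).
Proof. by rewrite mkdualE // => l u v; rewrite mulrDl -scalerAl linearP. Qed.

Fact rtrans_is_linear : linear rtrans.
Proof. by move=> l a b; apply: dual_ext => c; rewrite dualP !rtransE dualP. Qed.
HB.instance Definition _ := GRing.isLinear.Build k (dual (twcoalg J))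
  (dual (twcoalg J')) *:%R rtrans rtrans_is_linear.

Lemma rtrans_inj : injective rtrans.
Proof.
move=> a b ab; apply: dual_ext => c.
have := congr1 (fun f => dual_app f (c * x^-1 : H)) ab.
by rewrite !rtransE mulrVK.
Qed.

Lemma rtrans_surj b : exists a, rtrans a = b.
Proof.
exists (mkdual (fun c : H => b (c * x^-1 : H))); apply: dual_ext => c.
rewrite rtransE mkdualE ?mulrK // => l u v.
by rewrite mulrDl -scalerAl linearP.
Qed.

Lemma rtransM a b : rtrans (a * b) = rtrans a * rtrans b.
Proof.
apply: dual_ext => c; rewrite rtransE !twdualME JJ' comulM.
have E t : tpair2 (rtrans a) (rtrans b) t = tpair2 a b (t * (x ⊗ x)).
  elim/tens_ind: t => [u v|l s t IH IH'].
    by rewrite tpureM !tpair2_pure !rtransE.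
  by rewrite mulrDl -scalerAl !tpair2P IH IH'.
by rewrite E -!mulrA (tpure_unit ux).2 mulr1.
Qed.

Lemma rtrans1 : rtrans 1 = 1.
Proof.
by apply: dual_ext => c; rewrite rtransE !twdual1E counitM x1 mulr1.
Qed.

Lemma rtrans_act a h : rtrans (dual_act a h) = dual_act (rtrans a) h.
Proof. by apply: dual_ext => c; rewrite rtransE !dual_actE rtransE mulrA. Qed.

Lemma dual_pair_rtrans c : dual_pair J c -> dual_pair J' c.
Proof.
move=> [t [ti t1 /intertwinesE tJ tM]].
have lt : linear (fun h => rtrans (conv_app t h)).
  by move=> l u v; rewrite !linearP.
pose t' : conv H (dual (twcoalg J')) := mkconv (fun h => rtrans (conv_app t h)).
have t'E h : conv_app t' h = rtrans (conv_app t h) by apply: mkconvE.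
exists t'; split.
- by move=> h g; rewrite !t'E => /rtrans_inj/ti.
- by rewrite t'E t1 rtrans1.
- apply/intertwinesE => b h; have [a <-] := rtrans_surj b.
  rewrite t'E -rtransM tJ (tlift_comp _ rtrans); apply: eq_tlift => u v.
  by rewrite t'E /= rtransM rtrans_act.
- by move=> h g; rewrite !t'E -rtransM tM.
Qed.

End Transport.

Lemma dual_pair_gauge (J J' : twist H) c :
  gauge_equiv J J' -> dual_pair J c -> dual_pair J' c.
Proof. by move=> [x [ux x1 JJ']]; apply: dual_pair_rtrans ux x1 JJ' c. Qed.

Section Uniqueness.
Variable J : twist H.
Local Notation A := (dual (twcoalg J)).
Hypothesis center :
  forall z : A, (forall a, a * z = z * a) -> exists c : k, z = c%:A.
Variables p q : conv H A.
Hypothesis snpq : skolem_noether p q.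
Variable c : tens (dual H) (dual H).
Hypothesis cE : is_dual_twist p q c.

(** The factor p * t commutes with the constants, so it takes values in the
    center of A and is a functional x on H; it is not a zero divisor because t
    is injective.  Comparing the equations that define c and c' then gives
    comul x * c' = c * (x (x) x). *)
Lemma dual_pair_unique c' : dual_pair J c' -> gauge_equiv c c'.
Proof.
have [pq qp qJ p1 q1] := (skolem_noetherP p q).1 snpq.
move=> [t [ti t1 tJ tM]].
pose chi := p * t.
have pJ := intertwines_inv pq qp qJ.
have chiC a : conv_const H a * chi = chi * conv_const H a.
  by rewrite mulrA -pJ -mulrA tJ mulrA.
pose x : dual H := mkdual (fun h => dual_app (conv_app chi h) (1 : H)).
have xE h : conv_app chi h = (x h)%:A.
  rewrite mkdualE; last by move=> l u v; rewrite linearP dualP.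
  have [|s ->] := center (z := conv_app chi h).
    by move=> a; rewrite -convM_cstl chiC convM_cstr.
  by rewrite dualZ twdual1E counit1 mulr1.
have chiE : chi = scal1 A x by apply: conv_ext => h; rewrite xE scal1E.
have tE : t = q * scal1 A x by rewrite -chiE mulrA qp mul1r.
have ux : x \is a GRing.unit.
  apply: regular_unit => y /(congr1 (@scal1 k H A)); rewrite scal1M.
  move/(congr1 (fun f => q * f)); rewrite mulrA -tE => ty.
  have {}ty : t * scal1 A y = 0 by rewrite ty (linear0 (@scal1 k H A)) mulr0.
  apply: dual_ext => h; have ty0 := convME t (scal1 A y) h.
  rewrite ty [LHS]zero_lfunE in ty0.
  rewrite -counit_slice [dual_app 0 h]zero_lfunE.
  suff -> : tlift (fun h1 h2 => y h2 *: h1) (comul h) = 0 by rewrite linear0.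
  apply: ti; rewrite linear0 [RHS]ty0 (tlift_comp _ (conv_app t)).
  by apply: eq_tlift => u v; rewrite linearZ /= scal1E -scalerAr mulr1.
have x1 : counit x = 1.
  apply: (@alg_inj k A).
  by rewrite dual_counitE -xE conv_at1M p1 t1 mulr1 scale1r.
have XC := dual_twist_scal2 cE.
have tC : lift12 t * scal2 A c' = lift2 t * lift1 t.
  apply: conv_ext => h; apply: conv_ext => g; rewrite lift12ME lift21E tM.
  rewrite (tlift_comp _ (conv_app t)); apply: eq_tlift => u v.
  rewrite (tlift_comp _ (conv_app t)); apply: eq_tlift => u' v'.
  by rewrite scal2E linearZ /= -scalerAr mulr1.
have key : comul x * c' = c * (x ⊗ x).
  apply: (@scal2_inj k H A); rewrite !scal2M -lift12_scal XC.
  rewrite -lift21_scal -!mulrA [lift1 q * (_ * _)]mulrA -lift2_scal_comm.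
  rewrite -!mulrA [lift2 q * _]mulrA -lift2M -[lift1 q * _]lift1M -tE -tC.
  rewrite tE (lift12M q) -(mulrA (lift12 q)) [RHS]mulrA.
  have pq12 : lift12 p * lift12 q = 1 by rewrite -lift12M pq lift12_1.
  by rewrite pq12 mul1r.
exists x^-1; split; [by rewrite unitrV | exact: counit_inv | ].
by rewrite invrK -mulrA -key mulrA (comul_inv ux).2 mul1r.
Qed.

End Uniqueness.

End DualPair.

(** * Symmetry between a twist and its dual *)

Section Evaluation.
Variables (k : fieldType) (H : hopfType k).

Lemma ev_bij : exists e : dual (dual H) -> H,
  [/\ linear e, cancel (@ev k H) e & cancel e (@ev k H)].
Proof.
apply: linear_bij_inverse.
- by rewrite -!dim_dual.
- exact: ev_is_linear.
- exact: ev_inj.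
Qed.

Lemma tpair2_ev g h (s : tens (dual H) (dual H)) :
  tpair2 (ev g) (ev h) s = tpair s g h.
Proof. by apply: eq_tliftk => a b; rewrite !evE. Qed.

Lemma tpair_ev (t : tens H H) (f g : dual H) :
  tpair (tmap (@ev k H) (@ev k H) t) f g = tpair2 f g t.
Proof.
elim/tens_ind: t => [x y|l s t IH IH'].
  by rewrite tmap_pure tpair_pure tpair2_pure !evE.
by rewrite tmapP tpairP tpair2P IH IH'.
Qed.

(** Under the identification of H with its bidual, [star] is the product of
    the algebra dual to the coalgebra twisted by K. *)
Lemma ev_star (K : twist (dual H)) g h :
  (ev g : dual (twcoalg K)) * (ev h : dual (twcoalg K)) = ev (star K g h).
Proof.
apply: dual_ext => f; rewrite twdualME [LHS]tpair2_ev tpairM [RHS]evE.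
rewrite (@scalar_star _ _ (dual_app (f : dual H))); last first.
  by move=> l x y; rewrite linearP.
apply: eq_tliftk => g1 g2; apply: eq_tliftk => h1 h2.
by rewrite tpair_comul mulrC.
Qed.

Lemma ev_twist1 (K : twist (dual H)) : (1 : dual (twcoalg K)) = ev 1.
Proof. by apply: dual_ext => f; rewrite [RHS]evE [LHS]twdual1E. Qed.

Lemma tpair2M (f g : dual H) (s t : tens H H) :
  tpair2 f g (s * t) = tlift (fun f1 f2 => tlift (fun g1 g2 =>
    tpair2 f2 g2 t * tpair2 f1 g1 s : k^o) (comul g)) (comul f).
Proof.
elim/tens_ind: s => [x y|l s s' IH IH']; last first.
  rewrite mulrDl -scalerAl tpair2P IH IH' -tliftPk; apply: eq_tliftk => u v.
  by rewrite -tliftPk; apply: eq_tliftk => u' v'; rewrite tpair2P; ring.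
elim/tens_ind: t => [x' y'|l s s' IH IH']; last first.
  rewrite mulrDr -scalerAr tpair2P IH IH' -tliftPk; apply: eq_tliftk => u v.
  rewrite -tliftPk; apply: eq_tliftk => u' v'.
  by rewrite [tpair2 _ _ (_ + _)]tpair2P; ring.
rewrite tpureM tpair2_pure -!tpair_comul /tpair.
have lf : scalar (fun z : k^o =>
    z * (tlift (fun a b : dual H => a y * b y' : k^o) (comul g) : k)).
  by move=> l u v; rewrite mulrDl -mulrA.
rewrite [LHS](scalar_tlift _ _ lf); apply: eq_tliftk => f1 f2.
have lg : scalar (fun z : k^o => (f1 x * f2 x') * z).
  by move=> l u v; rewrite mulrDr mulrCA.
rewrite [LHS](scalar_tlift _ _ lg); apply: eq_tliftk => g1 g2.
by rewrite !tpair2_pure [RHS]mulrC mulrACA.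
Qed.

(** The same identification read on the other side: the product of A is the
    deformation by J of the product of the dual of H. *)
Lemma twdual_star (J : twist H) (f g : dual H) :
  (f : dual (twcoalg J)) * (g : dual (twcoalg J)) =
  star (tmap (@ev k H) (@ev k H) J) f g.
Proof.
apply: dual_ext => c; rewrite twdualME [LHS]tpair2M /star [RHS]dual_app_tlift.
apply: eq_tliftk => f1 f2; rewrite dual_app_tlift; apply: eq_tliftk => g1 g2.
rewrite tpair_ev [RHS]dualZ; congr (_ * _).
exact: (esym (dualME (f1 : dual H) g1 (c : H))).
Qed.

Lemma dual_act_comul (J : twist H) (f : dual H) h :
  dual_act (f : dual (twcoalg J)) h =
  tlift (fun f1 f2 : dual H => f1 h *: f2) (comul f).
Proof.
apply: dual_ext => c; rewrite dual_actE.
rewrite [LHS](esym (tpair_comul (f : dual H) _ _)).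
rewrite [RHS]dual_app_tlift; apply: eq_tliftk => u v.
by rewrite [RHS]dualZ.
Qed.

Lemma dual_act_ev (K : twist (dual H)) h (f : dual H) :
  dual_act (ev h : dual (twcoalg K)) f =
  ev (tlift (fun h1 h2 => f h1 *: h2) (comul h)).
Proof.
apply: dual_ext => g; rewrite dual_actE [LHS]evE [LHS]dualME [RHS]evE.
rewrite [RHS](scalar_tlift _ _ (dual_app_is_scalar (g : dual H))).
apply: eq_tliftk => x y.
by rewrite [RHS](scalarZ_fun _ _ (dual_app_is_scalar (g : dual H))).
Qed.

End Evaluation.

Section Symmetry.
Variables (k : fieldType) (H : hopfType k) (J : twist H).
Local Notation starJ := (star (tmap (@ev k H) (@ev k H) J)).

(** With products of A written through [twdual_star], the relation involves
    only the products [star] on H and on its dual. *)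
Lemma dual_pair_forward c : dual_pair J c <->
  exists t : H -> dual H, [/\ linear t, injective t, t 1 = 1,
      forall h g, starJ (t g) (t h) = t (star c h g)
    & forall h f, starJ (t h) f =
        tlift (fun f1 f2 : dual H => tlift (fun x y => f1 x *: starJ f2 (t y))
          (comul h)) (comul f)].
Proof.
have one1 : (1 : dual (twcoalg J)) = 1 :> dual H.
  by apply: dual_ext => h; rewrite [RHS]dual1E [LHS]twdual1E.
have actE1 (t : H -> dual H) f h :
    tlift (fun x y => dual_act (f : dual (twcoalg J)) x *
      (t y : dual (twcoalg J))) (comul h) =
    tlift (fun f1 f2 : dual H => tlift (fun x y => f1 x *: starJ f2 (t y))
          (comul h)) (comul f) :> dual H.
  rewrite -[RHS]tlift_exchange; apply: eq_tlift => x y.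
  rewrite dual_act_comul tlift_mull; apply: eq_tlift => f1 f2.
  by rewrite -scalerAl twdual_star.
split.
  move=> [t [ti t1 /intertwinesE tJ tM]].
  exists (fun h => conv_app t h); split.
  - by move=> l x y; rewrite linearP.
  - exact ti.
  - exact: etrans t1 one1.
  - by move=> h g; rewrite -twdual_star tM.
  - by move=> h f; rewrite -twdual_star tJ actE1.
move=> [t [lt ti t1 tM tJ]].
pose u : conv H (dual (twcoalg J)) := mkconv (t : H -> dual (twcoalg J)).
have uE h : conv_app u h = t h by apply: mkconvE.
exists u; split.
- by move=> x y; rewrite !uE => /ti.
- by rewrite uE t1 -one1.
- apply/intertwinesE => f h; rewrite uE twdual_star tJ.
  under [RHS]eq_tlift do rewrite uE; by rewrite actE1.
- by move=> h g; rewrite !uE twdual_star tM.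
Qed.

Lemma dual_pair_backward (K : twist (dual H)) :
  dual_pair K (tmap (@ev k H) (@ev k H) J) <->
  exists s : dual H -> H, [/\ linear s, injective s, s 1 = 1,
      forall f g, star K (s g) (s f) = s (starJ f g)
    & forall h f, star K (s f) h =
        tlift (fun f1 f2 : dual H => tlift (fun x y => f1 x *: star K y (s f2))
          (comul h)) (comul f)].
Proof.
have [e [le eK Ke]] := ev_bij H.
have actE1 (s : dual H -> H) h (f : dual H) :
    tlift (fun x y => dual_act (ev h : dual (twcoalg K)) x *
      (ev (s y) : dual (twcoalg K))) (comul f) =
    ev (tlift (fun f1 f2 : dual H => tlift (fun x y => f1 x *: star K y (s f2))
          (comul h)) (comul f)) :> dual (twcoalg K).
  rewrite [RHS](tlift_comp _ (@ev k H)); apply: eq_tlift => f1 f2.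
  rewrite dual_act_ev [RHS](tlift_comp _ (@ev k H)) (tlift_comp _ (@ev k H)).
  rewrite [LHS]tlift_mull; apply: eq_tlift => x y.
  by rewrite !linearZ /= -scalerAl ev_star.
split.
  move=> [t [ti t1 /intertwinesE tJ tM]].
  pose s f : H := e (conv_app t f).
  have sE f : conv_app t f = ev (s f) by rewrite /s Ke.
  exists s; split.
  - by move=> l x y; rewrite /s linearP le.
  - by move=> f g /(congr1 (@ev k H)); rewrite -!sE => /ti.
  - by apply: (can_inj eK); rewrite -sE t1 ev_twist1.
  - by move=> f g; apply: (can_inj eK); rewrite -ev_star -!sE tM.
  - move=> h f; apply: (can_inj eK); rewrite -ev_star -actE1 -sE tJ.
    by apply: eq_tlift => x y; rewrite sE.
move=> [s [ls si s1 sM sJ]].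
have lt : linear (fun f => ev (s f) : dual (twcoalg K)).
  by move=> l x y; rewrite ls linearP.
pose u : conv (dual H) (dual (twcoalg K)) := mkconv (fun f => ev (s f)).
have uE f : conv_app u f = ev (s f) by apply: mkconvE.
exists u; split.
- by move=> x y; rewrite !uE => /(can_inj eK)/si.
- by rewrite uE s1 ev_twist1.
- apply/intertwinesE => b f; rewrite -[b]Ke uE ev_star sJ -actE1.
  by apply: eq_tlift => x y; rewrite uE.
- by move=> f g; rewrite !uE ev_star sM.
Qed.

(** The conditions on t : H -> dual H and on s : dual H -> H correspond to
    each other when s and t are inverse maps. *)
Theorem dual_pair_sym (K : twist (dual H)) :
  dual_pair J K <-> dual_pair K (tmap (@ev k H) (@ev k H) J).
Proof.
rewrite dual_pair_forward dual_pair_backward; split.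
  move=> [t [lt ti t1 tM tJ]].
  have [s [ls ts st]] := linear_bij_inverse (dim_dual H) lt ti.
  pose tL : {linear H -> dual H} :=
    HB.pack t (GRing.isLinear.Build k H (dual H) *:%R _ lt).
  exists s; split=> //; first exact: can_inj st.
  - by rewrite -t1 ts.
  - by move=> f g; apply: (can_inj ts); rewrite st -tM !st.
  - move=> h f; apply: (can_inj ts); rewrite -tM st tJ.
    rewrite -[RHS]/(tL _) tlift_comp; apply: eq_tlift => f1 f2.
    rewrite tlift_comp; apply: eq_tlift => x y.
    by rewrite linearZ /= -tM st.
move=> [s [ls si s1 sM sJ]].
have [t [lt st ts]] := linear_bij_inverse (esym (dim_dual H)) ls si.
pose sL : {linear dual H -> H} :=
  HB.pack s (GRing.isLinear.Build k (dual H) H *:%R _ ls).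
exists t; split=> //; first exact: can_inj ts.
- by rewrite -s1 st.
- by move=> h g; apply: (can_inj st); rewrite -sM !ts.
- move=> h f; apply: (can_inj st); rewrite -sM ts sJ.
  rewrite -[RHS]/(sL _) tlift_comp; apply: eq_tlift => f1 f2.
  rewrite tlift_comp; apply: eq_tlift => x y.
  by rewrite linearZ /= -sM ts.
Qed.

End Symmetry.

(** * Simple coalgebras and simple algebras *)

Section SimpleDuality.
Variables (k : fieldType) (C : nzCoalgType k).

Lemma dual_dual_eval (f : dual (dual C)) :
  exists c : C, forall a : dual C, f a = a c.
Proof.
exists (\sum_i f (dual_basis i) *: vb i) => a.
have {1}-> : a = \sum_i a (vb i) *: dual_basis i.
  apply: dual_ext => c; rewrite {1}(vbE c) /dual_app sum_lfunE linear_sum.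
  apply: eq_bigr => i _; rewrite scale_lfunE linearZ /= -dual_basisE.
  by rewrite /GRing.scale /= mulrC.
rewrite (scalar_comb (dual_app_is_scalar f)).
rewrite [RHS](scalar_comb (dual_app_is_scalar a)).
by apply: eq_bigr => i _; rewrite mulrC.
Qed.

Lemma exists_separating (V : vectType k) (U : {vspace V}) v : v \notin U ->
  exists a : dual V, (forall u, u \in U -> a u = 0) /\ a v != 0.
Proof.
move=> vU; pose w := v - projv U v.
have w0 : w != 0.
  by apply: contra vU; rewrite subr_eq0 => /eqP->; apply: memv_proj.
have /existsNP[a /eqP aw] : ~ (forall a : dual V, a w = 0).
  by move=> /dual_separates w00; rewrite w00 eqxx in w0.
have ls : scalar (fun u => a (u - projv U u)).
  move=> l x y; rewrite -linearP; congr (dual_app a _).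
  by rewrite linearP scalerBr opprD addrACA.
exists (mkdual (fun u => a (u - projv U u))); split=> [u uU|].
  by rewrite mkdualE // projv_id // subrr linear0.
by rewrite mkdualE.
Qed.

Definition annihilator (I : {vspace dual C}) : {vspace C} :=
  (\bigcap_(i < \dim I) lker ((vbasis I)`_i : 'Hom(C, k^o)))%VS.

Lemma annihilatorP (I : {vspace dual C}) c :
  reflect (forall a : dual C, a \in I -> a c = 0) (c \in annihilator I).
Proof.
rewrite memvE; apply: (iffP subv_bigcapP) => [c0 a aI|c0 i _].
  rewrite (coord_vbasis aI) /dual_app sum_lfunE big1 // => i _.
  have := c0 i isT; rewrite -memvE memv_ker => /eqP ci.
  by rewrite scale_lfunE ci scaler0.
rewrite -memvE memv_ker; apply/eqP/c0.
by apply: vbasis_mem; rewrite mem_nth // size_tuple.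
Qed.

Definition coannihilator (D : {vspace C}) : {vspace dual C} :=
  (\bigcap_(i < \dim D)
     lker (linfun (fun a : dual C => a (vbasis D)`_i : k^o)))%VS.

Lemma coannihilatorP (D : {vspace C}) (a : dual C) :
  reflect (forall d, d \in D -> a d = 0) (a \in coannihilator D).
Proof.
have evE i :
    linfun (fun b : dual C => b (vbasis D)`_i : k^o) a = a (vbasis D)`_i.
  pose L : {linear dual C -> k^o} := HB.pack
    (fun b : dual C => b (vbasis D)`_i : k^o)
    (GRing.isLinear.Build k (dual C) k^o *:%R _ (fun l x y => dualP l x y _)).
  by rewrite -[LHS]/(linfun L a) lfunE.
rewrite memvE; apply: (iffP subv_bigcapP) => [a0 d dD|a0 i _].
  rewrite (coord_vbasis dD) (scalar_comb (dual_app_is_scalar a)) big1 // => i _.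
  have := a0 i isT; rewrite -memvE memv_ker evE => /eqP ->.
  by rewrite mulr0.
rewrite -memvE memv_ker evE; apply/eqP/a0.
by apply: vbasis_mem; rewrite mem_nth // size_tuple.
Qed.

(** A functional on the dual of C that vanishes on I and not on a would be
    the evaluation at an element of the annihilator of I. *)
Lemma biannihilator (I : {vspace dual C}) (a : dual C) :
  (forall c, c \in annihilator I -> a c = 0) -> a \in I.
Proof.
move=> a0; apply/negPn/negP => aI.
have [f [f0 fa]] := exists_separating aI; have [c fc] := dual_dual_eval f.
case/negP: fa; rewrite fc a0 //; apply/annihilatorP => b bI.
by rewrite -fc f0.
Qed.

Lemma tpure_tensv (D : {vspace C}) x y :
  x \in D -> y \in D -> x ⊗ y \in tensv D D.
Proof.
move=> xD yD; rewrite (coord_vbasis xD) (bilin_suml (tpure_bilin C C)).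
apply: memv_suml => i _; rewrite (bilinZl (tpure_bilin C C)) memvZ //.
rewrite (coord_vbasis yD) (bilin_sumr (tpure_bilin C C)).
apply: memv_suml => j _; rewrite (bilinZr (tpure_bilin C C)) memvZ //.
by apply/memv_span/allpairs_f; rewrite mem_nth // size_tuple.
Qed.

Lemma tpair2_tensv (D : {vspace C}) (t : tens C C) (a b : dual C) :
    t \in tensv D D ->
    (forall x y, x \in D -> y \in D -> a x = 0 \/ b y = 0) ->
  tpair2 a b t = 0.
Proof.
move=> tD ab.
pose L : {linear tens C C -> k^o} := HB.pack (tpair2 a b : tens C C -> k^o)
  (GRing.isLinear.Build k (tens C C) k^o *:%R _ (tpair2P a b)).
suff : (tensv D D <= lker (linfun L))%VS.
  by move/subvP/(_ t tD); rewrite memv_ker lfunE => /eqP.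
apply/span_subvP => _ /allpairsP[[x y] /= [xD yD ->]].
rewrite memv_ker (lfunE L) /= tpair2_pure; apply/eqP.
by case: (ab x y (vbasis_mem xD) (vbasis_mem yD)) => ->; rewrite ?mul0r ?mulr0.
Qed.

Lemma tpair2_eq0 (t : tens C C) :
  (forall a b : dual C, tpair2 a b t = 0) -> t = 0.
Proof.
move=> t0; apply: (@tens_sep k C C (dual C) (dual C)
  (fun a u => a u) (fun a u => a u)) => //.
- by move=> a; apply: dual_app_is_scalar.
- by move=> a; apply: dual_app_is_scalar.
- exact: dual_separates.
- exact: dual_separates.
Qed.

(** With P a projection onto D, the hypotheses allow to replace a and b by
    their composites with P, so t is fixed by P (x) P. *)
Lemma mem_tensv (D : {vspace C}) (t : tens C C) :
    (forall a b : dual C, a \in coannihilator D -> tpair2 a b t = 0) ->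
    (forall a b : dual C, b \in coannihilator D -> tpair2 a b t = 0) ->
  t \in tensv D D.
Proof.
move=> tl tr; pose P := projv D.
have tP : tmap P P t \in tensv D D.
  elim/tens_ind: (t) => [u v|l s s' IH IH'].
    by rewrite tmap_pure tpure_tensv ?memv_proj.
  by rewrite tmapP memvD ?memvZ.
suff -> : t = tmap P P t by [].
apply/eqP; rewrite -subr_eq0; apply/eqP/tpair2_eq0 => a b.
pose aP (f : dual C) : dual C := mkdual (fun c => f (P c)).
have aPE f c : aP f c = f (P c).
  by rewrite mkdualE // => l x y; rewrite !linearP.
have coD f : f - aP f \in coannihilator D.
  apply/coannihilatorP => d dD; rewrite -[f - _]addrC -scaleN1r dualP aPE.
  by rewrite projv_id // mulN1r addNr.
have E (s : tens C C) : tpair2 a b (tmap P P s) = tpair2 (aP a) (aP b) s.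
  elim/tens_ind: s => [u v|l s s' IH IH'].
    by rewrite tmap_pure !tpair2_pure !aPE.
  by rewrite tmapP !tpair2P IH IH'.
have subE (V : lmodType k) (u v : V) : u - v = (-1) *: v + u.
  by rewrite scaleN1r addrC.
have := tl (a - aP a) b (coD a); have := tr (aP a) (b - aP b) (coD b).
rewrite !subE tpair2Pl tpair2Pr tpair2P E !mulN1r.
by move=> /eqP; rewrite addr_eq0 eqr_opp => /eqP->.
Qed.

(** Annihilators exchange ideals of the dual algebra and subcoalgebras. *)
Lemma dual_simple_algebra : simple_coalgebra C -> simple_algebra (dual C).
Proof.
move=> [_ simC] I idI.
have coI a : a \in coannihilator (annihilator I) -> a \in I.
  by move/coannihilatorP; apply: biannihilator.
have sub : subcoalgebra (annihilator I).
  move=> c /annihilatorP cI; apply: mem_tensv => a b /coI h.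
    by rewrite -dualME cI //; case: (idI b a h).
  by rewrite -dualME cI //; case: (idI a b h).
case: (simC _ sub) => D0.
  right; apply/eqP; rewrite eqEsubv subvf; apply/subvP => a _.
  by apply: biannihilator => c; rewrite D0 memv0 => /eqP->; rewrite linear0.
left; apply/eqP; rewrite -subv0; apply/subvP => a aI.
rewrite memv0; apply/eqP/dual_ext => c; rewrite [RHS]zero_lfunE.
by have /annihilatorP-> : c \in annihilator I by rewrite D0 memvf.
Qed.

Lemma dual_simple_coalgebra : simple_algebra (dual C) -> simple_coalgebra C.
Proof.
move=> simA; split.
  have [c c0] := @counit_neq0 k C; apply: contraNneq c0 => C0.
  have : c \in {:C}%VS by apply: memvf.
  by rewrite C0 memv0 => /eqP->; rewrite linear0.
move=> D subD; have idD : ideal (coannihilator D).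
  move=> b a /coannihilatorP aD; split; apply/coannihilatorP => d /subD dD.
    by rewrite dualME (tpair2_tensv dD) // => *; right; apply: aD.
  by rewrite dualME (tpair2_tensv dD) // => *; left; apply: aD.
case: (simA _ idD) => [I0|If].
  right; apply/eqP; rewrite eqEsubv subvf; apply/subvP => c _.
  apply/negPn/negP => cD; have [a [aD]] := exists_separating cD.
  have /coannihilatorP := aD; rewrite I0 memv0 => /eqP->.
  by rewrite /dual_app zero_lfunE eqxx.
left; apply/eqP; rewrite -subv0; apply/subvP => d dD; rewrite memv0.
apply/eqP/dual_separates => a.
by have /coannihilatorP-> : a \in coannihilator D by rewrite If memvf.
Qed.

End SimpleDuality.

Lemma anti_iso_simple (k : fieldType) (A B : falgType k) (f : 'Hom(A, B)) :
    (forall x y, f (x * y) = f y * f x) -> limg f = fullv ->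
  simple_algebra A -> simple_algebra B.
Proof.
move=> fM im simA I idI.
have onto b : exists a, b = f a.
  by have /memv_imgP[a _ ->] : b \in limg f; [rewrite im memvf | exists a].
have idJ : ideal (f @^-1: I)%VS.
  move=> a x; rewrite -!memv_preim => fx; rewrite !fM.
  by have [h1 h2] := idI (f a) _ fx.
case: (simA _ idJ) => [J0|Jf].
  left; apply/eqP; rewrite -subv0; apply/subvP => b bI.
  have [a ea] := onto b; suff -> : b = 0 by rewrite mem0v.
  suff /eqP a0 : a == 0 by rewrite ea a0 linear0.
  by rewrite -memv0 -J0 -memv_preim -ea.
right; apply/eqP; rewrite eqEsubv subvf; apply/subvP => b _.
have [a ->] := onto b; rewrite memv_preim Jf; exact: memvf.
Qed.

(** * Transport of twists along an isomorphism of Hopf algebras *)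

Section HopfIsomorphism.
Variables (k : fieldType) (H L : hopfType k).
Variables (f : {linear H -> L}) (e : {linear L -> H}).
Hypotheses (fK : cancel f e) (eK : cancel e f).
Hypotheses (fM : {morph f : x y / x * y}) (f1 : f 1 = 1).
Hypothesis f_counit : forall x, counit (f x) = counit x.
Hypothesis f_comul : forall x, comul (f x) = tmap f f (comul x).
Local Notation ff := (tmap f f).
Implicit Types (J : tens H H) (x : H).

Let f_inj : injective f := can_inj fK.

Let ffM : {morph ff : s t / s * t}.
Proof. exact: tmapM. Qed.

Let ff1 : ff 1 = 1.
Proof. by rewrite -[1 : tens H H]/(1 ⊗ 1) tmap_pure f1. Qed.

Lemma iso_tens_inj : injective ff.
Proof. exact: can_inj (tmapK fK fK). Qed.

Lemma iso_unit x : f x \is a GRing.unit -> x \is a GRing.unit.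
Proof.
move=> ufx; apply/unitrP; exists (e (f x)^-1).
by split; apply: f_inj; rewrite fM eK f1 ?mulVr ?mulrV.
Qed.

Lemma iso_inv x : x \is a GRing.unit ->
  f x \is a GRing.unit /\ (f x)^-1 = f x^-1.
Proof.
move=> ux; have e1 : f x^-1 * f x = 1 by rewrite -fM mulVr // f1.
have e2 : f x * f x^-1 = 1 by rewrite -fM mulrV // f1.
have ufx : f x \is a GRing.unit by apply/unitrP; exists (f x^-1).
by split=> //; apply: (mulrI ufx); rewrite mulrV.
Qed.

Lemma iso_tens_unit J : ff J \is a GRing.unit -> J \is a GRing.unit.
Proof.
move=> uJ; have gK := tmapK eK eK; set v := tmap e e (ff J)^-1.
have vE : ff v = (ff J)^-1 by apply: gK.
apply/unitrP; exists v.
by split; apply: iso_tens_inj; rewrite ffM vE ff1 ?mulVr ?mulrV.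
Qed.

Let assoc_nat (T : tens (tens H H) H) :
  tmap f ff (tassoc T) = tassoc (tmap ff f T).
Proof.
elim/tens_ind: T => [s z|l s t IH IH']; last first.
  by rewrite !(tassocP, tmapP) IH IH'.
rewrite tmap_pure /=; elim/tens_ind: s => [x y|l s t IH IH'].
  by rewrite !tmap_pure !tassoc_pure !tmap_pure /= tmap_pure.
by rewrite tpurePl tassocP !tmapP IH IH' tpurePl tassocP.
Qed.

Let comul_natl t : tmap ff f (tmap comul idfun t) = tmap comul idfun (ff t).
Proof.
elim/tens_ind: t => [x y|l s t IH IH']; last by rewrite !tmapP IH IH'.
by rewrite !tmap_pure /= f_comul.
Qed.

Let comul_natr t : tmap f ff (tmap idfun comul t) = tmap idfun comul (ff t).
Proof.
elim/tens_ind: t => [x y|l s t IH IH']; last by rewrite !tmapP IH IH'.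
by rewrite !tmap_pure /= f_comul.
Qed.

Lemma is_twist_iso J : is_twist (ff J) -> is_twist J.
Proof.
move=> [uJ JA Jl Jr]; split; first exact: iso_tens_unit.
- apply: (can_inj (tmapK fK (tmapK fK fK))).
  rewrite assoc_nat (tmapM ffM fM) (tmapM fM ffM) comul_natl comul_natr.
  by rewrite !tmap_pure /= f1 JA.
- apply: f_inj; rewrite f1 -Jl.
  elim/tens_ind: (J) => [x y|l s t IH IH'].
    rewrite tmap_pure !(tlift_pure _ _ (counitl_bilin _)) linearZ /=.
    by rewrite -f_counit.
  by rewrite tmapP !linearP /= IH IH'.
- apply: f_inj; rewrite f1 -Jr.
  elim/tens_ind: (J) => [x y|l s t IH IH'].
    rewrite tmap_pure !(tlift_pure _ _ (counitr_bilin _)) linearZ /=.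
    by rewrite -f_counit.
  by rewrite tmapP !linearP /= IH IH'.
Qed.

Lemma gauge_equiv_iso J J' : gauge_equiv (ff J) (ff J') <-> gauge_equiv J J'.
Proof.
have tr x : x \is a GRing.unit -> ff (comul x * J * (x^-1 ⊗ x^-1)) =
    comul (f x) * ff J * ((f x)^-1 ⊗ (f x)^-1).
  by move=> ux; rewrite !ffM f_comul tmap_pure (iso_inv ux).2.
split=> [[y [uy y1 EJ]]|[x [ux x1 ->]]].
  rewrite -[y]eK in uy y1 EJ; have ux := iso_unit uy.
  exists (e y); split=> //; first by rewrite -f_counit.
  by apply: iso_tens_inj; rewrite EJ tr.
exists (f x); split; [exact: (iso_inv ux).1|by rewrite f_counit|exact: tr].
Qed.

End HopfIsomorphism.

Section EvaluationTwists.
Variables (k : fieldType) (H : hopfType k).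
Local Notation evev := (tmap (@ev k H) (@ev k H)).

Lemma ev_inverse : exists e : {linear dual (dual H) -> H},
  cancel (@ev k H) e /\ cancel e (@ev k H).
Proof.
have [e [le eK Ke]] := ev_bij H.
by exists (HB.pack e (GRing.isLinear.Build k (dual (dual H)) H *:%R _ le)
   : {linear dual (dual H) -> H}).
Qed.

Lemma tmap_ev_surj c : exists t, c = evev t.
Proof.
have [e [_ Ke]] := ev_inverse; exists (tmap e e c).
by rewrite (tmapK Ke Ke).
Qed.

Lemma is_twist_ev (J : tens H H) : is_twist (evev J) -> is_twist J.
Proof.
have [e [eK Ke]] := ev_inverse.
exact: (is_twist_iso eK Ke (@evM k H) (ev1 H)
  (@ev_counit k H) (@ev_comul k H)).
Qed.

Lemma gauge_equiv_ev (J J' : tens H H) :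
  gauge_equiv (evev J) (evev J') <-> gauge_equiv J J'.
Proof.
have [e [eK Ke]] := ev_inverse.
exact: (gauge_equiv_iso eK Ke (@evM k H) (ev1 H)
  (@ev_counit k H) (@ev_comul k H)).
Qed.

End EvaluationTwists.

(** * The bijection on gauge classes *)
Lemma nondegenerate_simple (k : fieldType) (H : hopfType k) (J : twist H) :
  Defs.nondegenerate J <-> simple_algebra (dual (twcoalg J)).
Proof.
split; first exact: dual_simple_algebra.
exact: dual_simple_coalgebra.
Qed.

Section DualityOnClasses.
Variables (k : fieldType) (H : hopfType k).

(** The map of the pair is an anti-isomorphism between the two dual algebras,
    once H is identified with its bidual. *)
Lemma dual_pair_nondegenerate (J : twist H) (K : twist (dual H)) :
  dual_pair J K -> Defs.nondegenerate J <-> Defs.nondegenerate K.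
Proof.
move=> [t [ti _ _ tM]].
have lt : linear (conv_app t) by exact: conv_app_is_linear.
have [s [ls ts st]] := linear_bij_inverse (dim_dual H) lt ti.
have [e [eK Ke]] := ev_inverse H.
rewrite (nondegenerate_simple J) (nondegenerate_simple K); split.
- have lf : linear (fun a => ev (s a) : dual (twcoalg K)).
    by move=> l x y; rewrite ls linearP.
  pose f : {linear dual (twcoalg J) -> dual (twcoalg K)} :=
    HB.pack (fun a => ev (s a) : dual (twcoalg K))
    (GRing.isLinear.Build k (dual (twcoalg J)) (dual (twcoalg K)) *:%R _ lf).
  apply (@anti_iso_simple k (dual (twcoalg J)) (dual (twcoalg K)) (linfun f)).
    move=> a b; rewrite !lfunE /= ev_star; congr ev.
    by apply: (can_inj ts); rewrite -tM !st.
  apply/eqP; rewrite eqEsubv subvf; apply/subvP => b _.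
  rewrite -[b]Ke -[e b]ts -[ev _]/(f _) -lfunE memv_img ?memvf //.
- have lg : linear (fun b : dual (twcoalg K) => conv_app t (e b)).
    by move=> l x y; rewrite !linearP.
  pose g : {linear dual (twcoalg K) -> dual (twcoalg J)} :=
    HB.pack (fun b : dual (twcoalg K) => conv_app t (e b))
    (GRing.isLinear.Build k (dual (twcoalg K)) (dual (twcoalg J)) *:%R _ lg).
  apply (@anti_iso_simple k (dual (twcoalg K)) (dual (twcoalg J)) (linfun g)).
    move=> a b; rewrite !lfunE /= tM; congr (conv_app t _).
    by rewrite -[a]Ke -[b]Ke ev_star !eK.
  apply/eqP; rewrite eqEsubv subvf; apply/subvP => a _.
  rewrite -[a]st -[s a]eK -[conv_app _ _]/(g _) -lfunE memv_img ?memvf //.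
Qed.

End DualityOnClasses.

Section Main.
Variables (k : closedFieldType) (H : hopfType k).

Lemma exists_dual_pair (J : twist H) : Defs.nondegenerate J -> exists p q c,
  [/\ @skolem_noether k H J p q, is_dual_twist p q c & is_twist c].
Proof.
move=> /nondegenerate_simple simA.
have [p [q sn]] := exists_skolem_noether simA.
have [pq qp qJ _ _] := (skolem_noetherP p q).1 sn.
have [c cE] := exists_dual_twist pq qp qJ (simple_center simA).
by exists p, q, c; split=> //; apply: dual_twist_is_twist sn c cE.
Qed.

Lemma dual_pair_gauge_unique (J : twist H) c c' : Defs.nondegenerate J ->
  dual_pair J c -> dual_pair J c' -> gauge_equiv c c'.
Proof.
move=> ndJ; have [p [q [d [sn dE _]]]] := exists_dual_pair ndJ.
have center := simple_center ((nondegenerate_simple J).1 ndJ).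
move=> /(dual_pair_unique center sn dE)/gauge_sym h.
by move=> /(dual_pair_unique center sn dE); apply: gauge_trans h.
Qed.

Lemma dual_map_class (J : twist H) c : Defs.nondegenerate J -> dual_pair J c ->
  dual_map (gauge_class J) = gauge_class c.
Proof.
move=> ndJ Jc; apply/seteqP; split=> K /=.
  move=> [J' [p [q [c' [JJ' ndJ' sn c'E c'K]]]]].
  have J'c' := skolem_noether_dual_pair sn c'E.
  have Jc' := dual_pair_gauge (gauge_sym JJ') J'c'.
  exact: gauge_trans (dual_pair_gauge_unique ndJ Jc Jc') c'K.
move=> cK; have [p [q [c' [sn c'E _]]]] := exists_dual_pair ndJ.
exists J, p, q, c'; split=> //; first exact: gauge_refl.
have Jc' := skolem_noether_dual_pair sn c'E.
exact: gauge_trans (dual_pair_gauge_unique ndJ Jc' Jc) cK.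
Qed.

Lemma exists_dual (J : twist H) : Defs.nondegenerate J ->
  exists K : twist (dual H), Defs.nondegenerate K /\ dual_pair J K.
Proof.
move=> ndJ; have [p [q [c [sn cE cT]]]] := exists_dual_pair ndJ.
have Jc : dual_pair J (Twist cT) by apply: skolem_noether_dual_pair sn cE.
by exists (Twist cT); split=> //; apply/(dual_pair_nondegenerate Jc).
Qed.

End Main.

(** A dual L of K is a twist of the bidual of H; the corresponding twist of H
    has K as a dual by symmetry. *)
Lemma exists_predual (k : closedFieldType) (H : hopfType k)
    (K : twist (dual H)) : Defs.nondegenerate K ->
  exists J : twist H, Defs.nondegenerate J /\ dual_pair J K.
Proof.
move=> ndK; have [L [ndL KL]] := exists_dual ndK.
have [j ej] := tmap_ev_surj (L : tens (dual (dual H)) (dual (dual H))).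
have jT : is_twist j by apply: is_twist_ev; rewrite -ej; apply: twistP.
have JK : dual_pair (Twist jT) K by apply/dual_pair_sym; rewrite /= -ej.
by exists (Twist jT); split=> //; apply/(dual_pair_nondegenerate JK).
Qed.

Lemma dual_map_inv_class (k : closedFieldType) (H : hopfType k)
    (J : twist H) (K : twist (dual H)) :
  Defs.nondegenerate K -> dual_pair J K ->
  dual_map_inv (gauge_class K) = gauge_class J.
Proof.
move=> ndK /dual_pair_sym KJ; apply/seteqP.
rewrite /dual_map_inv (dual_map_class ndK KJ).
by split=> J'; case: (gauge_equiv_ev J J').
Qed.

Theorem theorem5p7 (k : closedFieldType) (H : hopfType k) :
  [/\ set_bij (NT H) (NT (dual H)) (@dual_map k H),
      forall C', NT (dual H) C' -> NT H (dual_map_inv C'),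
      forall C, NT H C -> dual_map_inv (dual_map C) = C
    & forall C', NT (dual H) C' -> dual_map (dual_map_inv C') = C'].
Proof.
have invK C : NT H C -> dual_map_inv (dual_map C) = C.
  move=> [J [ndJ ->]]; have [K [ndK JK]] := exists_dual ndJ.
  by rewrite (dual_map_class ndJ JK) (dual_map_inv_class ndK JK).
have mapK C' : NT (dual H) C' ->
    NT H (dual_map_inv C') /\ dual_map (dual_map_inv C') = C'.
  move=> [K [ndK ->]]; have [J [ndJ JK]] := exists_predual ndK.
  rewrite (dual_map_inv_class ndK JK) (dual_map_class ndJ JK).
  by split=> //; exists J.
split=> //; [split | by move=> C' /mapK[] | by move=> C' /mapK[]].
- move=> C [J [ndJ ->]]; have [K [ndK JK]] := exists_dual ndJ.
  by exists K; rewrite (dual_map_class ndJ JK).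
- move=> C1 C2 /set_mem NC1 /set_mem NC2 eC.
  by rewrite -[C1]invK // -[C2]invK // eC.
- by move=> C' /mapK[NC eC]; exists (dual_map_inv C').
Qed.
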